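(* Let $0<\alpha<1$. Let $\gamma\in C^2(\mathbb{R}^+)$ be a real-valued function that is monotonic on $\mathbb{R}^+$, with $\lim_{t\to0^+}\gamma(t)=\lim_{t\to0^+}\gamma'(t)=0$, with $\omega_{\infty,1}\ge\omega_{0,2}$ and $\omega_{0,1}>1$, and such that there exist positive constants $C^{(1)}_1,C^{(2)}_1,C^{(1)}_2$ with $$\left|\frac{t\gamma'(t)}{\gamma(t)}\right|\le C^{(1)}_2\quad\text{and}\quad \left|\frac{t^j\gamma^{(j)}(t)}{\gamma(t)}\right|\ge C^{(j)}_1\ \ (j=1,2)\qquad\text{for all } t\in\mathbb{R}^+ .$$ Assume moreover that $$\frac{\omega_{\infty,2}-\omega_{\infty,1}}{\omega_{\infty,2}-1}<\frac{\alpha}{1-\alpha}<\frac{\omega_{\infty,2}}{\omega_{\infty,2}-\omega_{\infty,1}+1}.$$ Let $\left(\frac1p,\frac1q,\frac1r\right)$ lie in the open convex hull of the points $$A(\alpha,0,0),\quad B(1,0,1-\alpha),\quad C_1\left(0,\tfrac{\alpha}{\omega_{\infty,1}},0\right),\quad C_2\left(0,\tfrac{\alpha}{\omega_{0,2}},0\right),$$ $$D_1\left(0,1,1-\tfrac{\alpha}{\omega_{\infty,1}}\right),\quad D_2\left(0,1,1-\tfrac{\alpha}{\omega_{0,2}}\right),$$ $$E\left(1,\tfrac{\omega_{\infty,2}-\alpha}{2\omega_{\infty,2}-\omega_{\infty,1}},\tfrac{2(\omega_{\infty,2}-\alpha)}{2\omega_{\infty,2}-\omega_{\infty,1}}\right),\quad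 F\left(\tfrac{\omega_{\infty,2}-\alpha}{2\omega_{\infty,2}-\omega_{\infty,1}},1,\tfrac{2(\omega_{\infty,2}-\alpha)}{2\omega_{\infty,2}-\omega_{\infty,1}}\right).$$ Then there exists a positive constant $C$ such that $$\|H_{\alpha,\gamma}(f,g)\|_{L^r(\mathbb{R})}\le C\|f\|_{L^p(\mathbb{R})}\|g\|_{L^q(\mathbb{R})}$$ for all $f\in L^p(\mathbb{R})$ and $g\in L^q(\mathbb{R})$.
   Context: $\mathbb{R}^+=(0,\infty)$. For $0<\alpha<1$, the bilinear fractional integral along the curve $(t,\gamma(t))$ is $$H_{\alpha,\gamma}(f,g)(x):=\int_0^\infty f(x-t)\,g(x-\gamma(t))\,\frac{dt}{t^{1-\alpha}},\qquad x\in\mathbb{R}.$$ The indices of $\gamma$ are $$\omega_{0,1}:=\liminf_{t\to0^+}\frac{\ln|\gamma(t)|}{\ln t},\quad \omega_{0,2}:=\limsup_{t\to0^+}\frac{\ln|\gamma(t)|}{\ln t},\quad \omega_{\infty,1}:=\liminf_{t\to\infty}\frac{\ln|\gamma(t)|}{\ln t},\quad \omega_{\infty,2}:=\limsup_{t\to\infty}\frac{\ln|\gamma(t)|}{\ln t}.$$ The open convex hull of a finite set of points in $\mathbb{R}^3$ is the interior of its convex hull. When $r<1$, $\|\cdot\|_{L^r}$ denotes the usual quasi-norm. *)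

(* Defs.v *)
From HB Require Import structures.
From mathcomp Require Import all_boot all_order all_algebra.
From mathcomp Require Import complex.
From mathcomp Require Import all_classical all_reals all_analysis.

Set Implicit Arguments.
Unset Strict Implicit.
Unset Printing Implicit Defensive.

Import Order.TTheory GRing.Theory Num.Theory.
Import numFieldNormedType.Exports.

Local Open Scope ring_scope.
Local Open Scope classical_set_scope.
Local Open Scope complex_scope.

(* Functions on R^+ = (0, oo) are represented by total functions R -> R whose
   values outside R^+ are never used. *)

Definition C2_pos (R : realType) (gamma : R -> R) : Prop :=
  forall t : R, 0 < t ->
    [/\ derivable gamma t 1, derivable (derive1n 1 gamma) t 1
      & {for t, continuous (derive1n 2 gamma)}].

Definition monotonic_pos (R : realType) (gamma : R -> R) : Prop :=
  {in [pred t | 0 < t] &, {homo gamma : s t / s <= t}} \/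
  {in [pred t | 0 < t] &, {homo gamma : s t /~ s <= t}}.

(* The four indices are liminf/limsup in \bar R projected to R by fine (which
   sends infinities to 0).  The bounds C1 <= |t gamma'(t) / gamma(t)| <= C2
   assumed on R^+ make the liminf and limsup finite, so fine loses nothing. *)
Definition log_ratio (R : realType) (gamma : R -> R) (t : R) : \bar R :=
  (ln `|gamma t| / ln t)%:E.

Definition omega0_1 (R : realType) (gamma : R -> R) : R :=
  fine (limf_einf (log_ratio gamma) 0^'+).

Definition omega0_2 (R : realType) (gamma : R -> R) : R :=
  fine (limf_esup (log_ratio gamma) 0^'+).

Definition omegaoo_1 (R : realType) (gamma : R -> R) : R :=
  fine (limf_einf (log_ratio gamma) +oo%R).

Definition omegaoo_2 (R : realType) (gamma : R -> R) : R :=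
  fine (limf_esup (log_ratio gamma) +oo%R).

Definition convex_hull (R : realType) (E : lmodType R) (A : set E) : set E :=
  smallest (@convex_set R E) A.

Definition exponent_points (R : realType) (alpha : R) (gamma : R -> R) :
    set (R * R * R) :=
  let w02 := omega0_2 gamma in
  let w1 := omegaoo_1 gamma in
  let w2 := omegaoo_2 gamma in
  let e := (w2 - alpha) / (2 * w2 - w1) in
  [set (alpha, 0, 0);
       (1, 0, 1 - alpha);
       (0, alpha / w1, 0);
       (0, alpha / w02, 0);
       (0, 1, 1 - alpha / w1);
       (0, 1, 1 - alpha / w02);
       (1, e, 2 * (w2 - alpha) / (2 * w2 - w1));
       (e, 1, 2 * (w2 - alpha) / (2 * w2 - w1))].

Notation mu1 R := (@lebesgue_measure R).

(* Measurability is Borel: every Lebesgue measurable function agrees a.e. with a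
   Borel one, and null-set modifications of f, g do not affect the operator
   below, since gamma' does not vanish on R^+. *)
Definition cmeasurable (R : realType) (f : R -> R[i]) : Prop :=
  measurable_fun setT (fun x => complex.Re (f x)) /\
  measurable_fun setT (fun x => complex.Im (f x)).

Definition cLnorm (R : realType) (p : R) (f : R -> R[i]) : \bar R :=
  'N[mu1 R]_(p%:E)[(fun x => (Normc.normc (f x))%:E)].

Definition in_Lp (R : realType) (p : R) (f : R -> R[i]) : Prop :=
  cmeasurable f /\ (cLnorm p f < +oo)%E.

Definition cintegrable (R : realType) (D : set R) (h : R -> R[i]) : Prop :=
  (mu1 R).-integrable D (fun t => (complex.Re (h t))%:E) /\
  (mu1 R).-integrable D (fun t => (complex.Im (h t))%:E).

Definition cintegral (R : realType) (D : set R) (h : R -> R[i]) : R[i] :=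
  Rintegral (mu1 R) D (fun t => complex.Re (h t)) +i*
  Rintegral (mu1 R) D (fun t => complex.Im (h t)).

Definition H_integrand (R : realType) (alpha : R) (gamma : R -> R)
    (f g : R -> R[i]) (x t : R) : R[i] :=
  f (x - t) * g (x - gamma t) / (t `^ (1 - alpha))%:C.

Definition H_op (R : realType) (alpha : R) (gamma : R -> R)
    (f g : R -> R[i]) (x : R) : R[i] :=
  cintegral `]0, +oo[ (H_integrand alpha gamma f g x).

(* H_op takes a junk finite value where the defining integral diverges, so a
   norm bound on it only has its usual meaning together with this condition. *)
Definition H_defined (R : realType) (alpha : R) (gamma : R -> R)
    (f g : R -> R[i]) : Prop :=
  {ae mu1 R, forall x, cintegrable `]0, +oo[ (H_integrand alpha gamma f g x)}.

(* Main.v *)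
Require Import Defs.
From HB Require Import structures.
From mathcomp Require Import all_boot all_order all_algebra.
From mathcomp Require Import complex.
From mathcomp Require Import all_classical all_reals all_analysis.
From mathcomp Require Import measurable_realfun.
From mathcomp Require Import ring lra.

(** Write a = 1/p, b = 1/q, c = 1/r and sg = a + b - c. The operator is dominated by a
    positive one, so let F = |f|^p and G = |g|^q have mass at most one and consider, for
    a piece J of (0, oo),
      T_J(x) = int_J F(x - t)^a G(x - gamma t)^b t^(alpha - 1) dt.

    On one piece everything follows from a single geometric fact: a map that expands
    distances by d pulls Lebesgue measure back to at most 1/d times itself
    ([ge0_integral_expanding]). Applied to the maps t, gamma t and t - gamma t it bounds
    the double integrals of the products FH, GH and FG over R x J, where H(x) is a third
    function of mass one. If r > 1, the integral of T_J H^(1-c) is a weighted geometric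
    mean of such products, and the arithmetic-geometric inequality ([weighted_amgm6])
    bounds it; duality ([dual_norm_lt1]) gives the norm of T_J. If r <= 1 there is no
    duality. There 1/H is replaced by a weight S built from the local mass of G
    ([local_weight]), and Young's inequality ([weighted_norm_ge1]) recovers the
    quasi-norm. Either way a piece of length m, on which |gamma'| is comparable to s and
    t - gamma t expands by d, contributes at most a constant times
    m^(1 - sg) d^(-(a+b-1)^+) s^(-t3) times the size of the kernel, with some freedom in
    t3 ([piece_interval_lt1]); for r <= 1 a power of the Lipschitz constant of t - gamma t
    takes the place of the last factor ([piece_interval_ge1]).

    The curve is cut into dyadic octaves near zero and near infinity. The bounds on
    t gamma' / gamma make gamma doubling and |gamma'| comparable to |gamma t| / t there
    ([log_growth]), and the indices bound gamma below by powers of t. In between, the only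
    obstruction is a point t0 where gamma' = 1 or comes closest to it; as gamma'' does not
    vanish, |1 - gamma'| is at least a multiple of |t - t0|, and the pieces are taken at
    dyadic distances from t0. In all three regions the bounds decay geometrically, so that
    they can be summed in L^r for every r > 0 ([bilin_bounded_family]).

    Each exponent of decay is a minimum of affine functions of (a, b, c). These are
    nonnegative at the eight points, hence positive in the interior of their hull
    ([affine_interior_hull], [exponents_interior]); this is where the conditions on alpha
    and on the indices enter.
    Finally the integrability of T^r shows that T, and with it the integral that defines the
    operator, is finite almost everywhere ([operator_defined], [operator_bound]). *)

Set Implicit Arguments.
Unset Strict Implicit.
Unset Printing Implicit Defensive.

Import Order.TTheory GRing.Theory Num.Theory.
Import numFieldNormedType.Exports.

Local Open Scope ring_scope.
Local Open Scope classical_set_scope.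

(** * Expanding maps and Lebesgue measure *)

Local Notation mu := (@lebesgue_measure _).

Lemma lebesgue_measure_diam (R : realType) (X : set R) (rho : R) :
  measurable X -> 0 <= rho ->
  (forall s t, X s -> X t -> `|s - t| <= rho) ->
  (mu X <= rho%:E)%E.
Proof.
move=> mX rho0 dX.
have [->|/set0P[x0 Xx0]] := eqVneq X set0; first by rewrite measure0 lee_fin.
have hs : has_sup X.
  split; first by exists x0.
  exists (x0 + rho) => x Xx; have := dX _ _ Xx Xx0.
  by rewrite ler_norml => /andP[_]; rewrite lerBlDl.
have sub : X `<=` `[sup X - rho, sup X]%classic.
  move=> x Xx /=; rewrite in_itv/=; apply/andP; split; last first.
    by apply: ub_le_sup => //; exact: (proj2 hs).
  rewrite lerBlDr; apply: ge_sup; first by exists x0.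
  move=> y Xy; have := dX _ _ Xy Xx.
  by rewrite ler_norml => /andP[_]; rewrite lerBlDl.
apply: le_trans (_ : (mu `[(sup X - rho)%R, sup X] <= _)%E).
  by apply: le_measure => //; rewrite inE.
rewrite lebesgue_measure_itv/= lte_fin; case: ifPn => _; last by rewrite lee_fin.
by rewrite lee_fin; lra.
Qed.

(** Only distances enter: cover A by intervals; the preimage of an interval of
    length l has diameter at most l / d. *)
Lemma expanding_preimage (R : realType) (D : set R) (phi : R -> R) (d : R) :
  measurable D -> measurable_fun [set: R] phi -> 0 < d ->
  (forall s t, D s -> D t -> d * `|s - t| <= `|phi s - phi t|) ->
  forall A : set R, measurable A ->
  (mu (D `&` phi @^-1` A) <= d^-1%:E * mu A)%E.
Proof.
move=> mD mphi d0 hphi A mA.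
rewrite -lee_pdivrMl ?invr_gt0// invrK.
rewrite [leRHS]/lebesgue_measure/= /lebesgue_stieltjes_measure/= /measure_extension/=.
apply: le_ereal_inf_tmp => _ [B [mB AB] <-].
have mphiB (C : set R) : measurable C -> measurable (phi @^-1` C).
  by move=> mC; rewrite -[X in measurable X]setTI; exact: mphi.
have mB' k : measurable (B k : set R).
  by have := mB k; exact: sub_sigma_algebra.
apply: (@le_trans _ _ (d%:E * mu (\bigcup_k (D `&` phi @^-1` (B k)))))%E.
  rewrite lee_pmul2l// le_measure ?inE//.
  - by apply: measurableI => //; exact: mphiB.
  - by apply: bigcup_measurable => k _; apply: measurableI => //; exact: mphiB.
  - by move=> x [Dx /AB[k _ Bk]]; exists k.
apply: (@le_trans _ _ (d%:E * \sum_(k <oo) mu (D `&` phi @^-1` (B k))))%E.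
  rewrite lee_pmul2l//; apply: measure_sigma_subadditive => //.
  - by move=> k; apply: measurableI => //; exact: mphiB.
  - by apply: bigcup_measurable => k _; apply: measurableI => //; exact: mphiB.
rewrite -nneseriesZl//; apply: lee_nneseries => [k _ _|k _]; first by rewrite mule_ge0// lee_fin ltW.
have [[a b] /= _ <-] := mB k.
have [ab|ba] := leP a b; last first.
  by rewrite set_itv_ge ?preimage_set0 ?setI0 ?measure0 ?mule0 ?wlength_ge0// bnd_simp -leNgt ltW.
rewrite wlength_itv_bnd//= -lee_pdivlMl// -EFinM.
apply: lebesgue_measure_diam.
- by apply: measurableI => //; exact: mphiB.
- by rewrite mulr_ge0 ?invr_ge0 ?subr_ge0// ltW.
move=> s t [Ds /=]; rewrite in_itv/= => /andP[s1 s2] [Dt].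
rewrite /= in_itv/= => /andP[t1 t2].
rewrite ler_pdivlMl//; apply: le_trans (hphi _ _ Ds Dt) _.
by rewrite ler_norml; apply/andP; split; lra.
Qed.

(** The pushforward of m restricted to D is a measure below k m', and integrals of
    nonnegative functions are monotone in the measure. *)
Lemma ge0_integral_comp_le d d' (X : measurableType d) (Y : measurableType d')
    (R : realType) (m : {measure set X -> \bar R}) (m' : {measure set Y -> \bar R})
    (D : set X) (phi : X -> Y) (k : {nonneg R}) (G : Y -> \bar R) :
  measurable D -> measurable_fun setT phi ->
  (forall A, measurable A -> m (D `&` phi @^-1` A) <= k%:num%:E * m' A)%E ->
  measurable_fun setT G -> (forall y, 0 <= G y)%E ->
  (\int[m]_(x in D) G (phi x) <= k%:num%:E * \int[m']_y G y)%E.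
Proof.
move=> mD mphi hle mG G0.
have -> : (\int[m]_(t in D) G (phi t) = \int[mrestr m mD]_(t in D) (G \o phi) t)%E.
  by apply: eq_measure_integral => A mA AD; rewrite /= /mrestr setIidl.
have mGphi : measurable_fun setT (G \o phi) by exact: measurableT_comp.
apply: (@le_trans _ _ (\int[mrestr m mD]_t (G \o phi) t)%E).
  by apply: ge0_subset_integral => //= x _; exact: G0.
have -> : (\int[mrestr m mD]_t (G \o phi) t =
    \int[pushforward (mrestr m mD) phi]_y G y)%E.
  by rewrite ge0_integral_pushforward// => y _; exact: G0.
have -> : (k%:num%:E * \int[m']_y G y = \int[mscale k m']_y G y)%E.
  by rewrite ge0_integral_mscale// => y _; exact: G0.
pose m1 : {measure set Y -> \bar R} := pushforward (mrestr m mD) phi.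
apply: (@ge0_le_measure_integral _ _ _ (m1 mphi) (mscale k m')) => //= A mA.
change (m (phi @^-1` A `&` D) <= k%:num%:E * m' A)%E.
by rewrite setIC; exact: hle.
Qed.

(** The change of variables inequality behind all the estimates along the curve. The
    set E records where phi sends D; it carries the localisation in
    [local_weight_ratio]. *)
Lemma ge0_integral_expanding (R : realType) (D E : set R) (phi : R -> R) (d : R)
    (G : R -> \bar R) :
  measurable D -> measurable E -> measurable_fun [set: R] phi -> 0 < d ->
  (forall s t, D s -> D t -> d * `|s - t| <= `|phi s - phi t|) ->
  (forall t, D t -> E (phi t)) ->
  measurable_fun [set: R] G -> (forall x, 0 <= G x)%E ->
  (\int[mu]_(t in D) G (phi t) <= d^-1%:E * \int[mu]_(x in E) G x)%E.
Proof.
move=> mD mE mphi d0 hphi DE mG G0.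
pose GE := (G \_ E).
have mGE : measurable_fun [set: R] GE.
  apply/(measurable_restrictT _ mE).
  exact: measurable_funTS.
have GE0 x : (0 <= GE x)%E by rewrite /GE patchE; case: ifPn.
rewrite [in leRHS]integral_mkcond -/GE.
have -> : (\int[mu]_(t in D) G (phi t) = \int[mu]_(t in D) GE (phi t))%E.
  apply: eq_integral => t /[!inE] Dt /=; rewrite /GE patchE ifT// inE; exact: DE.
have dn : 0 <= d^-1 by rewrite invr_ge0 ltW.
have := (@ge0_integral_comp_le _ _ _ _ R mu mu D phi (NngNum dn) GE mD mphi).
apply => //= A mA.
exact: expanding_preimage.
Qed.

(** * Weighted means of products *)

(** Jensen: average the tangents of exp at the mean of the points. *)
Lemma expR_convex6 (R : realType) (t1 t2 t3 t4 t5 t6 y1 y2 y3 y4 y5 y6 : R) :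
  0 <= t1 -> 0 <= t2 -> 0 <= t3 -> 0 <= t4 -> 0 <= t5 -> 0 <= t6 ->
  t1 + t2 + t3 + t4 + t5 + t6 = 1 ->
  expR (t1 * y1 + t2 * y2 + t3 * y3 + t4 * y4 + t5 * y5 + t6 * y6) <=
  t1 * expR y1 + t2 * expR y2 + t3 * expR y3 + t4 * expR y4 + t5 * expR y5 +
  t6 * expR y6.
Proof.
move=> h1 h2 h3 h4 h5 h6 h.
have tangent (s y : R) : expR s * (1 + (y - s)) <= expR y.
  rewrite [in leRHS](_ : y = s + (y - s)); last by rewrite addrC subrK.
  by rewrite expRD ler_wpM2l ?expR_ge0// expR_ge1Dx.
have [s sE] : exists s, s = t1 * y1 + t2 * y2 + t3 * y3 + t4 * y4 + t5 * y5 + t6 * y6.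
  by eexists.
rewrite -sE.
apply: le_trans (lerD (lerD (lerD (lerD (lerD (ler_wpM2l h1 (tangent s y1))
  (ler_wpM2l h2 (tangent s y2))) (ler_wpM2l h3 (tangent s y3)))
  (ler_wpM2l h4 (tangent s y4))) (ler_wpM2l h5 (tangent s y5)))
  (ler_wpM2l h6 (tangent s y6))).
rewrite le_eqVlt; apply/predU1l.
transitivity (expR s * (t1 + t2 + t3 + t4 + t5 + t6 +
    (s - (t1 + t2 + t3 + t4 + t5 + t6) * s))).
  by rewrite h; ring.
by rewrite [X in _ * (_ + (X - _))]sE; ring.
Qed.

(** This takes the place of multilinear interpolation. The coefficients t1, ..., t6
    write (a, b, d) as a convex combination of the exponents of the six products
    fg, hf, hg, f, g, h. The weights u1, ..., u6 are free; they are later chosen as the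
    inverses of the double integrals of these products. *)
Lemma weighted_amgm6 (R : realType) (a b d f g h u1 u2 u3 u4 u5 u6
    t1 t2 t3 t4 t5 t6 : R) :
  0 < a -> 0 < b -> 0 < d -> 0 <= f -> 0 <= g -> 0 <= h ->
  0 < u1 -> 0 < u2 -> 0 < u3 -> 0 < u4 -> 0 < u5 -> 0 < u6 ->
  0 <= t1 -> 0 <= t2 -> 0 <= t3 -> 0 <= t4 -> 0 <= t5 -> 0 <= t6 ->
  a = t1 + t2 + t4 -> b = t1 + t3 + t5 -> d = t2 + t3 + t6 ->
  t1 + t2 + t3 + t4 + t5 + t6 = 1 ->
  f `^ a * g `^ b * h `^ d <=
  expR (- (t1 * ln u1 + t2 * ln u2 + t3 * ln u3 + t4 * ln u4 + t5 * ln u5 +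
    t6 * ln u6)) *
  (t1 * (u1 * (f * g)) + t2 * (u2 * (h * f)) + t3 * (u3 * (h * g)) +
   t4 * (u4 * f) + t5 * (u5 * g) + t6 * (u6 * h)).
Proof.
move=> a0 b0 d0 f0 g0 h0 u10 u20 u30 u40 u50 u60 t10 t20 t30 t40 t50 t60 aE bE dE ts.
have rhs0 : 0 <= t1 * (u1 * (f * g)) + t2 * (u2 * (h * f)) + t3 * (u3 * (h * g)) +
   t4 * (u4 * f) + t5 * (u5 * g) + t6 * (u6 * h).
  by rewrite !addr_ge0// !mulr_ge0// ltW.
move: f0; rewrite le_eqVlt => /orP[/eqP f0|f0].
  by rewrite -{1}f0 powR0 ?gt_eqF// !mul0r mulr_ge0 ?expR_ge0.
move: g0; rewrite le_eqVlt => /orP[/eqP g0|g0].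
  by rewrite -{1}g0 powR0 ?gt_eqF// mulr0 mul0r mulr_ge0 ?expR_ge0.
move: h0; rewrite le_eqVlt => /orP[/eqP h0|h0].
  by rewrite -{1}h0 powR0 ?gt_eqF// mulr0 mulr_ge0 ?expR_ge0.
rewrite /powR !gt_eqF// -!expRD.
set F := ln f; set G := ln g; set H := ln h.
have := @expR_convex6 R t1 t2 t3 t4 t5 t6 (ln u1 + (F + G)) (ln u2 + (H + F))
  (ln u3 + (H + G)) (ln u4 + F) (ln u5 + G) (ln u6 + H) t10 t20 t30 t40 t50 t60 ts.
rewrite !expRD !lnK ?posrE// => cvx.
rewrite -ler_pdivrMl ?expR_gt0// -expRN opprK -expRD.
apply: le_trans cvx; rewrite -!expRD ler_expR.
by rewrite aE bE dE le_eqVlt; apply/predU1l; ring.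
Qed.

(** The version for a + b > 1, where q is the inverse of a weight. The exponent e of q is
    taken out of the exponent a + b - 1 that the product fg has in the combination
    f^a g^b = (fg)^(a+b-1) f^(1-b) g^(1-a). *)
Lemma weighted_amgm4 (R : realType) (a b e f g q d m : R) :
  0 < a -> 0 < b -> 0 <= e -> 0 <= f -> 0 <= g -> 0 < q -> 0 < d -> 0 < m ->
  a <= 1 -> b <= 1 -> e <= a + b - 1 ->
  f `^ a * g `^ b * q `^ e <=
  expR (- ((a + b - 1) * ln d) + (2 - a - b) * ln m) *
  (e * (d * (f * g * q)) + (a + b - 1 - e) * (d * (f * g)) +
   (1 - b) * (m^-1 * f) + (1 - a) * (m^-1 * g)).
Proof.
move=> a0 b0 e0 f0 g0 q0 d0 m0 a1 b1 eab.
have ab1 : 0 <= a + b - 1 - e by rewrite subr_ge0.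
have a1' : 0 <= 1 - a by rewrite subr_ge0.
have b1' : 0 <= 1 - b by rewrite subr_ge0.
have rhs0 : 0 <= e * (d * (f * g * q)) + (a + b - 1 - e) * (d * (f * g)) +
   (1 - b) * (m^-1 * f) + (1 - a) * (m^-1 * g).
  by rewrite !addr_ge0// !mulr_ge0// ?invr_ge0 ltW.
move: f0; rewrite le_eqVlt => /orP[/eqP f0|f0].
  by rewrite -{1}f0 powR0 ?gt_eqF// !mul0r mulr_ge0 ?expR_ge0.
move: g0; rewrite le_eqVlt => /orP[/eqP g0|g0].
  by rewrite -{1}g0 powR0 ?gt_eqF// mulr0 mul0r mulr_ge0 ?expR_ge0.
rewrite /powR !gt_eqF// -!expRD.
set F := ln f; set G := ln g; set H := ln q.
have := @expR_convex6 R e (a + b - 1 - e) (1 - b) (1 - a) 0 0 (ln d + (F + G + H)) (ln d + (F + G))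
  (ln m^-1 + F) (ln m^-1 + G) 0 0 e0 ab1 b1' a1' (lexx _) (lexx _).
move=> /(_ ltac:(ring)) cvx; rewrite !mul0r !addr0 in cvx.
rewrite !expRD !lnK ?posrE ?invr_gt0// in cvx.
rewrite -ler_pdivrMl ?expR_gt0// -expRN -expRD.
apply: le_trans cvx; rewrite -!expRD ler_expR.
by rewrite lnV ?posrE// le_eqVlt; apply/predU1l; ring.
Qed.

(** * Double integrals along the curve *)

(** After the substitution F = |f|^p and G = |g|^q the only information kept about
    the two functions is this class; the exponents reappear as the powers 1/p and
    1/q under the integral. *)
Definition unit_mass (R : realType) (F : R -> R) :=
  measurable_fun [set: R] F /\ (forall x, 0 <= F x) /\
  (\int[@lebesgue_measure R]_x (F x)%:E <= 1)%E.

Section Tonelli.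
Context {R : realType}.
Implicit Types (J : set R) (f : R * R -> \bar R).

Let patch2 f J := f \_ (setT `*` J).

Let mpatch2 f J : measurable J -> measurable_fun [set: R * R] f ->
  measurable_fun [set: R * R] (patch2 f J).
Proof.
move=> mJ mf; have mX : measurable ([set: R] `*` J) by exact: measurableX.
by apply/(measurable_restrictT _ mX); exact: measurable_funTS.
Qed.

Let patch2_ge0 f J : (forall z, 0 <= f z)%E -> forall z, (0 <= patch2 f J z)%E.
Proof. by move=> f0 z; rewrite /patch2 patchE; case: ifPn. Qed.

Let patch2E f J x t : patch2 f J (x, t) = ((fun t => f (x, t)) \_ J) t.
Proof.
rewrite /patch2 !patchE; have [tJ|tJ] := boolP (t \in J).
  by rewrite ifT// inE; split => //=; rewrite -inE.
by rewrite ifF//; apply/negbTE/negP; rewrite inE => -[_ /=]; rewrite -inE; apply/negP.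
Qed.

Lemma measurable_fun_ge0_integral f J : measurable J ->
  measurable_fun [set: R * R] f -> (forall z, 0 <= f z)%E ->
  measurable_fun [set: R] (fun x => \int[mu]_(t in J) f (x, t))%E.
Proof.
move=> mJ mf f0.
rewrite (_ : (fun x => _) = (fun x => \int[mu]_t patch2 f J (x, t))%E).
  have := @measurable_fun_fubini_tonelli_F _ _ _ _ R mu (patch2 f J).
  apply; first exact: mpatch2.
  exact: patch2_ge0.
apply/funext => x; rewrite integral_mkcond; apply: eq_integral => t _.
by rewrite patch2E.
Qed.

Lemma tonelli_restrict f J : measurable J ->
  measurable_fun [set: R * R] f -> (forall z, 0 <= f z)%E ->
  (\int[mu]_x \int[mu]_(t in J) f (x, t) = \int[mu]_(t in J) \int[mu]_x f (x, t))%E.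
Proof.
move=> mJ mf f0.
transitivity (\int[mu]_x \int[mu]_t patch2 f J (x, t))%E.
  apply: eq_integral => x _; rewrite integral_mkcond; apply: eq_integral => t _.
  by rewrite patch2E.
rewrite (@fubini_tonelli _ _ _ _ R mu mu)//; last 2 first.
- exact: mpatch2.
- exact: patch2_ge0.
rewrite [RHS]integral_mkcond; apply: eq_integral => t _.
rewrite patchE; case: ifPn => tJ.
  by apply: eq_integral => x _; rewrite patch2E patchE tJ.
by rewrite integral0_eq// => x _; rewrite patch2E patchE (negbTE tJ).
Qed.

End Tonelli.

Section Terms.
Context {R : realType}.
Local Notation mu := (@lebesgue_measure R).
Variables (J : set R) (mJ : measurable J).
Implicit Types (F G H : R -> R) (phi : R -> R).

Lemma measurable_fun_shift F phi : measurable_fun [set: R] F ->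
  measurable_fun [set: R] phi ->
  measurable_fun [set: R * R] (fun z => F (z.1 - phi z.2)).
Proof.
move=> mF mphi; apply: measurableT_comp => //; apply: measurable_funB => //.
exact: measurableT_comp.
Qed.

Lemma integral_translate_le (G : R -> \bar R) (z : R) : measurable_fun [set: R] G ->
  (forall x, 0 <= G x)%E ->
  (\int[mu]_x G (x - z)%R <= \int[mu]_x G x)%E.
Proof.
move=> mG G0.
have := @ge0_integral_expanding R setT setT (fun x => x - z) 1 G.
rewrite invr1 mul1e; apply => //; first exact: measurable_funB.
by move=> s t _ _; rewrite mul1r le_eqVlt; apply/predU1l; congr (`|_|); ring.
Qed.

(** For fixed t the inner integral is that of a translate of G. *)
Lemma single_term G phi (m : R) : unit_mass G -> measurable_fun [set: R] phi ->
  (mu J <= m%:E)%E ->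
  (\int[mu]_x \int[mu]_(t in J) (G (x - phi t))%:E <= m%:E)%E.
Proof.
move=> [mG [G0 G1]] mphi Jm.
rewrite (tonelli_restrict (f := fun z => (G (z.1 - phi z.2))%:E))//=; last 2 first.
- by apply/measurable_EFinP; exact: (measurable_fun_shift mG mphi).
- by move=> z; rewrite lee_fin.
apply: (@le_trans _ _ (\int[mu]_(t in J) (cst 1 t))%E); last first.
  by rewrite integral_cst// mul1e.
apply: ge0_le_integral => //.
- by move=> t _; apply: integral_ge0 => x _; rewrite lee_fin.
- apply: measurable_funTS.
  apply: (@measurable_fun_ge0_integral R (fun z => (G (z.2 - phi z.1))%:E) setT) => //.
  + apply/measurable_EFinP; apply: measurableT_comp => //; apply: measurable_funB => //.
    exact: measurableT_comp.
  + by move=> z; rewrite lee_fin.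
- move=> t _; apply: le_trans G1.
  by apply: (@integral_translate_le (EFin \o G)) => //; exact/measurable_EFinP.
Qed.

(** For fixed x the map t |-> x - phi t expands distances by d, so integrating in t
    first costs 1 / d whatever x is. *)
Lemma pair_term G H phi (d : R) : unit_mass G -> unit_mass H -> measurable_fun [set: R] phi ->
  0 < d -> (forall s t, J s -> J t -> d * `|s - t| <= `|phi s - phi t|) ->
  (\int[mu]_x \int[mu]_(t in J) (H x * G (x - phi t))%:E <= d^-1%:E)%E.
Proof.
move=> [mG [G0 G1]] [mH [H0 H1]] mphi d0 hphi.
have d0' : (0 <= d^-1%:E)%E by rewrite lee_fin invr_ge0 ltW.
apply: (@le_trans _ _ (\int[mu]_x (d^-1%:E * (H x)%:E))%E); last first.
  rewrite ge0_integralZl//; last 2 first.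
  - exact/measurable_EFinP.
  - by move=> x _; rewrite lee_fin.
  by rewrite -[leRHS]mule1 lee_wpmul2l ?lee_fin.
have mHG : measurable_fun [set: R * R] (fun z => (H z.1 * G (z.1 - phi z.2))%:E).
  apply/measurable_EFinP; apply: measurable_funM; last exact: (measurable_fun_shift mG mphi).
  exact: measurableT_comp.
apply: ge0_le_integral => //.
- by move=> x _; apply: integral_ge0 => t _; rewrite lee_fin mulr_ge0.
- apply: (@measurable_fun_ge0_integral R (fun z => (H z.1 * G (z.1 - phi z.2))%:E) J) => //.
  by move=> z; rewrite lee_fin mulr_ge0.
- by apply: measurable_funeM; exact/measurable_EFinP.
move=> x _.
under eq_integral do rewrite EFinM.
have mx : measurable_fun [set: R] (fun t => x - phi t) by exact: measurable_funB.
rewrite ge0_integralZl//; last 3 first.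
- by apply/measurable_EFinP; apply: measurable_funTS; exact: measurableT_comp.
- by move=> t _; rewrite lee_fin.
- by rewrite lee_fin.
rewrite muleC lee_wpmul2r ?lee_fin//.
have := @ge0_integral_expanding R J setT (fun t => x - phi t) d (EFin \o G).
move=> /(_ mJ measurableT mx d0) E.
apply: le_trans (E _ _ _ _) _ => //.
- move=> s t Js Jt; apply: le_trans (hphi _ _ Js Jt) _.
  by rewrite -normrN le_eqVlt; apply/predU1l; congr (`|_|); ring.
- exact/measurable_EFinP.
by rewrite -[leRHS]mule1 lee_wpmul2l ?lee_fin.
Qed.

(** Substituting x = u + t turns the first factor into F(u), which is constant in t;
    what is left is the integral of the other two factors along the curve, for fixed u. *)
Lemma triple_term F G (Q : R -> R) (gam : R -> R) (B : R) :
  unit_mass F -> unit_mass G -> measurable_fun [set: R] Q -> (forall x, 0 <= Q x) ->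
  measurable_fun [set: R] gam -> 0 <= B ->
  (forall u, \int[mu]_(t in J) (G (u + (t - gam t)) * Q (u + t))%:E <= B%:E)%E ->
  (\int[mu]_x \int[mu]_(t in J) (F (x - t) * G (x - gam t) * Q x)%:E <= B%:E)%E.
Proof.
move=> [mF [F0 F1]] [mG [G0 G1]] mQ Q0 mgam B0 hB.
have p0 x y z : 0 <= F x * G y * Q z by rewrite !mulr_ge0.
pose f1 (z : R * R) := F (z.1 - z.2) * G (z.1 - gam z.2) * Q z.1.
pose f2 (z : R * R) := F z.1 * (G (z.1 + (z.2 - gam z.2)) * Q (z.1 + z.2)).
have mg2 : measurable_fun [set: R * R] (fun z : R * R => gam z.2) by exact: measurableT_comp.
have mf1 : measurable_fun [set: R * R] f1.
  apply: measurable_funM; last exact: measurableT_comp.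
  apply: measurable_funM; last exact: (measurable_fun_shift mG mgam).
  by apply: measurableT_comp => //; exact: measurable_funB.
have mf2 : measurable_fun [set: R * R] f2.
  apply: measurable_funM; first exact: measurableT_comp.
  apply: measurable_funM; apply: measurableT_comp => //.
    by apply: measurable_funD => //; exact: measurable_funB.
  exact: measurable_funD.
rewrite (tonelli_restrict (f := EFin \o f1))//=; last 2 first.
- exact/measurable_EFinP.
- by move=> z; rewrite lee_fin; exact: p0.
apply: (@le_trans _ _ (\int[mu]_(t in J) \int[mu]_x (f2 (x, t))%:E)%E).
  have msw : measurable_fun [set: R * R] (fun z : R * R => (z.2, z.1)) by exact: measurable_fun_pair.
  apply: ge0_le_integral => //.
  - by move=> t _; apply: integral_ge0 => x _; rewrite lee_fin; exact: p0.
  - apply: measurable_funTS.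
    apply: (@measurable_fun_ge0_integral R (fun z => (f1 (z.2, z.1))%:E) setT) => //.
    + by apply/measurable_EFinP; apply: measurableT_comp.
    + by move=> z; rewrite lee_fin; exact: p0.
  - apply: measurable_funTS.
    apply: (@measurable_fun_ge0_integral R (fun z => (f2 (z.2, z.1))%:E) setT) => //.
    + by apply/measurable_EFinP; apply: measurableT_comp.
    + by move=> z; rewrite lee_fin mulr_ge0// mulr_ge0.
  move=> t _.
  have mt : measurable_fun [set: R] (fun x => (f2 (x, t))%:E).
    by apply/measurable_EFinP; apply: measurableT_comp.
  apply: le_trans (integral_translate_le t mt _); last first.
    by move=> x; rewrite lee_fin mulr_ge0// mulr_ge0.
  rewrite le_eqVlt; apply/predU1l; apply: eq_integral => x _; rewrite /f1 /f2/= -mulrA.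
  by congr (_ * (G _ * Q _))%:E; ring.
rewrite -(tonelli_restrict (f := EFin \o f2))//=; last 2 first.
- exact/measurable_EFinP.
- by move=> z; rewrite lee_fin !mulr_ge0.
apply: (@le_trans _ _ (\int[mu]_x (B%:E * (F x)%:E))%E); last first.
  rewrite ge0_integralZl//; last 2 first.
  - exact/measurable_EFinP.
  - by move=> x _; rewrite lee_fin.
  by rewrite -[leRHS]mule1 lee_wpmul2l ?lee_fin.
apply: ge0_le_integral => //.
- by move=> x _; apply: integral_ge0 => t _; rewrite lee_fin !mulr_ge0.
- apply: (@measurable_fun_ge0_integral R (EFin \o f2) J) => //.
  + exact/measurable_EFinP.
  + by move=> z; rewrite lee_fin !mulr_ge0.
- by apply: measurable_funeM; exact/measurable_EFinP.
move=> x _; under eq_integral do rewrite /f2/= EFinM.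
rewrite ge0_integralZl//; last 3 first.
- apply/measurable_EFinP; apply: measurable_funTS; apply: measurable_funM; apply: measurableT_comp => //.
    by apply: measurable_funD => //; exact: measurable_funB.
  exact: measurable_funD.
- by move=> t _; rewrite lee_fin mulr_ge0.
- by rewrite lee_fin.
by rewrite muleC lee_wpmul2r ?lee_fin.
Qed.

End Terms.

Section DoubleIntegral.
Context {R : realType}.
Local Notation mu := (@lebesgue_measure R).
Variables (J : set R) (mJ : measurable J).
Implicit Types (f g : R * R -> R).

(** Bundles measurability and positivity with the bound, so that such bounds can be
    compared, added and scaled without side conditions. *)
Definition dint_le f (B : R) :=
  [/\ measurable_fun [set: R * R] f, (forall z, 0 <= f z) &
   (\int[mu]_x \int[mu]_(t in J) (f (x, t))%:E <= B%:E)%E].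

Lemma measurable_section f x : measurable_fun [set: R * R] f ->
  measurable_fun J (fun t => (f (x, t))%:E).
Proof.
by move=> mf; apply: measurable_funTS; apply/measurable_EFinP; exact: measurableT_comp.
Qed.

Lemma measurable_dint f : measurable_fun [set: R * R] f -> (forall z, 0 <= f z) ->
  measurable_fun [set: R] (fun x => \int[mu]_(t in J) (f (x, t))%:E)%E.
Proof.
move=> mf f0; apply: (measurable_fun_ge0_integral (f := EFin \o f)) => //.
exact/measurable_EFinP.
Qed.

Lemma dint_leS f g B : measurable_fun [set: R * R] f -> (forall z, 0 <= f z) ->
  (forall z, f z <= g z) -> dint_le g B -> dint_le f B.
Proof.
move=> mf f0 fg [mg g0 gB]; split => //; apply: le_trans gB.
apply: ge0_le_integral => //.
- by move=> x _; apply: integral_ge0 => t _; rewrite lee_fin.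
- exact: measurable_dint.
- exact: measurable_dint.
move=> x _; apply: ge0_le_integral => //.
- by move=> t _; rewrite lee_fin.
- exact: measurable_section.
- exact: measurable_section.
- by move=> t _; rewrite lee_fin.
Qed.

Lemma dint_leD f g A B : dint_le f A -> dint_le g B ->
  dint_le (fun z => f z + g z) (A + B).
Proof.
move=> [mf f0 fA] [mg g0 gB]; split.
- exact: measurable_funD.
- by move=> z; rewrite addr_ge0.
have E x : (\int[mu]_(t in J) (f (x, t) + g (x, t))%:E =
    \int[mu]_(t in J) (f (x, t))%:E + \int[mu]_(t in J) (g (x, t))%:E)%E.
  under eq_integral do rewrite EFinD.
  rewrite ge0_integralD//; last 4 first.
  - by move=> t _; rewrite lee_fin.
  - exact: (measurable_section x mf).
  - by move=> t _; rewrite lee_fin.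
  - exact: (measurable_section x mg).
under eq_integral do rewrite E.
rewrite ge0_integralD//; last 4 first.
- by move=> x _; apply: integral_ge0 => t _; rewrite lee_fin.
- exact: measurable_dint.
- by move=> x _; apply: integral_ge0 => t _; rewrite lee_fin.
- exact: measurable_dint.
by rewrite EFinD leeD.
Qed.

Lemma dint_leZ k f A : 0 <= k -> dint_le f A -> dint_le (fun z => k * f z) (k * A).
Proof.
move=> k0 [mf f0 fA]; split.
- exact: measurable_funM.
- by move=> z; rewrite mulr_ge0.
have E x : (\int[mu]_(t in J) (k * f (x, t))%:E =
    k%:E * \int[mu]_(t in J) (f (x, t))%:E)%E.
  under eq_integral do rewrite EFinM.
  rewrite ge0_integralZl ?lee_fin//; first exact: (measurable_section x mf).
  by move=> t _; rewrite lee_fin.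
under eq_integral do rewrite E.
rewrite ge0_integralZl ?lee_fin//; last 2 first.
- exact: measurable_dint.
- by move=> x _; apply: integral_ge0 => t _; rewrite lee_fin.
by rewrite EFinM lee_wpmul2l.
Qed.

End DoubleIntegral.

Section Trilinear.
Context {R : realType}.
Local Notation mu := (@lebesgue_measure R).
Variables (J : set R) (mJ : measurable J) (m : R) (m0 : 0 < m) (Jm : (mu J <= m%:E)%E).
Variables (gam : R -> R) (mgam : measurable_fun [set: R] gam).
Variables (s d : R) (s0 : 0 < s) (d0 : 0 < d).
Hypothesis gam_exp : forall x y, J x -> J y -> s * `|x - y| <= `|gam x - gam y|.
Hypothesis h_exp : forall x y, J x -> J y ->
  d * `|x - y| <= `|(x - gam x) - (y - gam y)|.
Variables (F G : R -> R) (LF : unit_mass F) (LG : unit_mass G).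

Let mF := LF.1.
Let F0 := LF.2.1.
Let mG := LG.1.
Let G0 := LG.2.1.

Lemma measurable_shiftF : measurable_fun [set: R * R] (fun z => F (z.1 - z.2)).
Proof. exact: (measurable_fun_shift mF (phi := id)). Qed.

Lemma measurable_shiftG : measurable_fun [set: R * R] (fun z => G (z.1 - gam z.2)).
Proof. exact: (measurable_fun_shift mG mgam). Qed.

Lemma measurable_fst_comp (H : R -> R) : measurable_fun [set: R] H ->
  measurable_fun [set: R * R] (fun z => H z.1).
Proof. by move=> mH; exact: measurableT_comp. Qed.

Lemma dint_F : dint_le J (fun z => F (z.1 - z.2)) m.
Proof.
split=> [|//|]; first exact: measurable_shiftF.
exact: (single_term mJ LF (phi := id) (@measurable_id _ _ _) Jm).
Qed.

Lemma dint_G : dint_le J (fun z => G (z.1 - gam z.2)) m.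
Proof.
split=> [|//|]; first exact: measurable_shiftG.
exact: (single_term mJ LG mgam Jm).
Qed.

Lemma dint_H (H : R -> R) : unit_mass H -> dint_le J (fun z => H z.1) m.
Proof.
move=> LH; split=> [|z|]; first by apply: measurable_fst_comp; exact: LH.1.
  exact: LH.2.1.
have := single_term mJ LH (phi := cst 0) (measurable_cst _) Jm.
by under eq_integral do under eq_integral do rewrite subr0.
Qed.

Lemma dint_HF (H : R -> R) : unit_mass H -> dint_le J (fun z => H z.1 * F (z.1 - z.2)) 1.
Proof.
move=> LH; split=> [|z|].
- apply: measurable_funM; last exact: measurable_shiftF.
  by apply: measurable_fst_comp; exact: LH.1.
- by rewrite mulr_ge0//; exact: LH.2.1.
have := pair_term mJ LF LH (phi := id) (d := 1); rewrite invr1; apply => //.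
by move=> x y _ _; rewrite mul1r.
Qed.

Lemma dint_HG (H : R -> R) : unit_mass H ->
  dint_le J (fun z => H z.1 * G (z.1 - gam z.2)) s^-1.
Proof.
move=> LH; split=> [|z|].
- apply: measurable_funM; last exact: measurable_shiftG.
  by apply: measurable_fst_comp; exact: LH.1.
- by rewrite mulr_ge0//; exact: LH.2.1.
exact: (pair_term mJ LG LH mgam s0 gam_exp).
Qed.

Lemma integral_hG u (I' : set R) : measurable I' ->
  (forall t, J t -> I' (t - gam t)) ->
  (\int[mu]_(t in J) (G (u + (t - gam t)))%:E <=
   d^-1%:E * \int[mu]_(v in I') (G (u + v))%:E)%E.
Proof.
move=> mI' JI'.
apply: (@ge0_integral_expanding R J I' (fun t => t - gam t) d (fun v => (G (u + v))%:E)) => //.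
- exact: measurable_funB.
- apply/measurable_EFinP; apply: measurableT_comp => //; exact: measurable_funD.
- by move=> v; rewrite lee_fin.
Qed.

Lemma integral_translate_le1 u : (\int[mu]_(v in [set: R]) (G (u + v))%:E <= 1)%E.
Proof.
apply: le_trans LG.2.2.
have := @integral_translate_le R (EFin \o G) (- u); rewrite /=.
under eq_integral do rewrite opprK addrC; apply; first exact/measurable_EFinP.
by move=> x; rewrite lee_fin.
Qed.

(** With x = u + t the argument of G is u + (t - gam t): this is where the tangency of
    the curve with the diagonal direction matters. *)
Lemma dint_FG : dint_le J (fun z => F (z.1 - z.2) * G (z.1 - gam z.2)) d^-1.
Proof.
split=> [|z|].
- apply: measurable_funM; [exact: measurable_shiftF|exact: measurable_shiftG].
- by rewrite mulr_ge0.
have d0' : 0 <= d^-1 by rewrite invr_ge0 ltW.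
apply: le_trans (@triple_term R J mJ F G (cst 1) gam d^-1 LF LG
  (measurable_cst _) (fun _ => ler01) mgam d0' _).
  rewrite le_eqVlt; apply/predU1l.
  by apply: eq_integral => x _; apply: eq_integral => t _; rewrite mulr1.
move=> u; under eq_integral do rewrite mulr1.
apply: le_trans (integral_hG u measurableT (fun _ _ => I)) _.
rewrite -[leRHS]mule1 lee_wpmul2l//.
exact: integral_translate_le1.
Qed.

End Trilinear.

(** * Quasi-norms from weighted integrals *)

Lemma measurable_fun_inv_pos (R : realType) (S : R -> R) :
  measurable_fun [set: R] S -> (forall x, 0 < S x) ->
  measurable_fun [set: R] (fun x => (S x)^-1).
Proof.
move=> mS S0; rewrite (_ : (fun x => _) = (fun x => S x `^ (- 1))).
  exact: (measurableT_comp (measurable_powR _)).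
by apply/funext => x; rewrite powRN powRr1 ?ltW.
Qed.

Section Duality.
Context {R : realType}.
Local Notation mu := (@lebesgue_measure R).
Variables (T : R -> \bar R) (mT : measurable_fun [set: R] T).
Hypothesis T0 : forall x, (0 <= T x)%E.

(** Replaces duality when the target exponent r = 1/c is at most 1. As r(c - 1) = 1 - r,
    Young's inequality applied to T^r = (T S^(1-c))^r S^(1-r) turns a weighted bound of
    the integral of T into a bound of the integral of T^r. *)
Lemma weighted_norm_ge1 (c K M : R) (S : R -> R) :
  1 <= c -> 0 < K -> 0 < M ->
  measurable_fun [set: R] S -> (forall x, 0 < S x) ->
  (\int[mu]_x (S x)%:E <= M%:E)%E ->
  (\int[mu]_x (T x * ((S x)^-1 `^ (c - 1))%:E) <= K%:E)%E ->
  (\int[mu]_x (T x `^ c^-1) <= (K `^ c^-1 * M `^ (1 - c^-1))%:E)%E.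
Proof.
move=> c1 K0 M0 mS S0 SM TK.
have c0 : 0 < c by rewrite (lt_le_trans _ c1).
set r := c^-1.
have r0 : 0 < r by rewrite invr_gt0.
have r1 : r <= 1 by rewrite invf_le1.
have rc : r * c = 1 by rewrite mulVf// gt_eqF.
have w1 : 0 <= (1 - r) / M by rewrite divr_ge0 ?subr_ge0// ltW.
have w2 : 0 <= r / K by rewrite divr_ge0// ltW.
have wS x : 0 <= (1 - r) / M * S x by rewrite mulr_ge0// ltW.
set C := K `^ r * M `^ (1 - r).
have C0 : 0 < C by rewrite mulr_gt0// powR_gt0.
have mTS : measurable_fun [set: R] (fun x => T x * ((S x)^-1 `^ (c - 1))%:E)%E.
  apply: emeasurable_funM => //; apply/measurable_EFinP.
  apply: (measurableT_comp (measurable_powR _)).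
  exact: measurable_fun_inv_pos.
have TS0 x : (0 <= T x * ((S x)^-1 `^ (c - 1))%:E)%E by rewrite mule_ge0// lee_fin powR_ge0.
have pw x : (T x `^ r <= C%:E * ((r / K)%:E * (T x * ((S x)^-1 `^ (c - 1))%:E) +
    ((1 - r) / M * S x)%:E))%E.
  have := T0 x; case: (T x) => [t| |]//; last first.
    move=> _; rewrite gt0_mulye ?lte_fin ?powR_gt0 ?invr_gt0//.
    by rewrite gt0_muley ?lte_fin ?divr_gt0// addye// gt0_muley ?lte_fin// leey.
  rewrite lee_fin le_eqVlt => /orP[/eqP <-|t0].
    rewrite poweR0r ?gt_eqF// mul0e mule0 add0e mule_ge0 ?lee_fin ?(ltW C0)//.
  rewrite poweR_EFin.
  change ((t `^ r)%:E <= (C * (r / K * (t * (S x)^-1 `^ (c - 1)) +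
    (1 - r) / M * S x))%:E)%E; rewrite lee_fin.
  have S0' := S0 x; have SV0 : 0 < (S x)^-1 by rewrite invr_gt0.
  rewrite /C /powR !gt_eqF// -!expRD.
  have r1' : 0 <= 1 - r by rewrite subr_ge0.
  have := @expR_convex6 R r (1 - r) 0 0 0 0 (- ln K + (ln t + (c - 1) * ln (S x)^-1))
    (- ln M + ln (S x)) 0 0 0 0 (ltW r0) r1' (lexx _) (lexx _) (lexx _) (lexx _).
  move=> /(_ ltac:(ring)) cvx; rewrite !mul0r !addr0 in cvx.
  rewrite -ler_pdivrMl ?expR_gt0// -expRN -expRD.
  apply: le_trans (le_trans _ cvx) _.
    rewrite ler_expR lnV ?posrE//.
    rewrite (_ : r * (- ln K + (ln t + (c - 1) * - ln (S x))) =
      r * ln t - r * ln K - (r * c) * ln (S x) + r * ln (S x)); last by ring.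
    by rewrite rc le_eqVlt; apply/predU1l; ring.
  rewrite !expRD !expRN !lnK ?posrE//.
  by rewrite le_eqVlt; apply/predU1l; ring.
apply: (@le_trans _ _ (\int[mu]_x (C%:E * ((r / K)%:E * (T x * ((S x)^-1 `^ (c - 1))%:E) +
    ((1 - r) / M * S x)%:E)))%E).
  apply: ge0_le_integral => //.
  - by move=> x _; exact: poweR_ge0.
  - exact: (measurableT_comp (measurable_poweR _)).
  apply: measurable_funeM; apply: emeasurable_funD.
    exact: measurable_funeM.
  by apply/measurable_EFinP; exact: measurable_funM.
rewrite ge0_integralZl//; last 3 first.
- apply: emeasurable_funD; first exact: measurable_funeM.
  by apply/measurable_EFinP; exact: measurable_funM.
- by move=> x _; rewrite adde_ge0 ?lee_fin// mule_ge0.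
- by rewrite lee_fin ltW.
rewrite -[leRHS]mule1 lee_wpmul2l ?lee_fin ?(ltW C0)//.
rewrite ge0_integralD//; last 4 first.
- by move=> x _; rewrite mule_ge0.
- exact: measurable_funeM.
- by move=> x _; rewrite lee_fin.
- by apply/measurable_EFinP; exact: measurable_funM.
rewrite ge0_integralZl//.
under [X in (_ + X)%E]eq_integral do rewrite EFinM.
rewrite ge0_integralZl ?lee_fin//; last 2 first.
- exact/measurable_EFinP.
- by move=> x _; rewrite lee_fin ltW.
have -> : 1%E = ((r / K)%:E * K%:E + ((1 - r) / M)%:E * M%:E :> \bar R)%E.
  by rewrite -!EFinM -EFinD !divfK ?gt_eqF//; congr (_%:E); ring.
by rewrite leeD// lee_wpmul2l.
Qed.

(** Test T against the multiple of T^(1/c) that has mass one. The truncations make the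
    normalising integral finite, and monotone convergence removes them. *)
Lemma dual_norm_lt1 (c K : R) : 0 < c -> c < 1 -> 0 < K ->
  (forall H : R -> R, measurable_fun [set: R] H -> (forall x, 0 <= H x) ->
    (\int[mu]_x (H x)%:E <= 1)%E ->
    (\int[mu]_x (T x * (H x `^ (1 - c))%:E) <= K%:E)%E) ->
  (\int[mu]_x (T x `^ c^-1) <= (K `^ c^-1)%:E)%E.
Proof.
move=> c0 c1 K0 hT.
set r := c^-1.
have r0 : 0 < r by rewrite invr_gt0.
have rc : r * c = 1 by rewrite mulVf// gt_eqF.
(* bounded, compactly supported truncations of T *)
pose Tn n x := fine (mine (T x) n%:R%:E) * \1_(`[- n%:R, n%:R]%classic : set R) x.
have mTfin x n : mine (T x) n%:R%:E \is a fin_num.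
  rewrite ge0_fin_numE; first by rewrite gt_min ltry orbT.
  by rewrite le_min T0 lee_fin ler0n.
have Tn0 n x : 0 <= Tn n x.
  by rewrite mulr_ge0// fine_ge0// le_min T0 lee_fin ler0n.
have mTn n : measurable_fun [set: R] (Tn n).
  apply: measurable_funM => //; apply: measurableT_comp => //.
  by apply: measurable_mine => //; exact: measurable_cst.
have TnT n x : ((Tn n x)%:E <= T x)%E.
  rewrite /Tn EFinM fineK// indicE; case: (x \in _); last by rewrite mule0.
  by rewrite mule1 ge_min lexx.
have mTr n : measurable_fun [set: R] (fun x => Tn n x `^ r).
  exact: (measurableT_comp (measurable_powR _)).
have mTrE n : measurable_fun [set: R] (fun x => (Tn n x `^ r)%:E).
  by apply/measurable_EFinP; exact: mTr.
have mI n : measurable_fun [set: R] (fun x => (\1_(`[- n%:R, n%:R]%classic : set R) x : R)%:E).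
  by apply/measurable_EFinP.
have bound n : (\int[mu]_x (Tn n x `^ r)%:E <= (K `^ r)%:E)%E.
  have Tnn x : ((Tn n x `^ r)%:E <= (n%:R `^ r)%:E * (\1_(`[- n%:R, n%:R]%classic : set R) x)%:E)%E.
    rewrite /Tn indicE; case: (x \in _); last by rewrite mulr0 powR0 ?gt_eqF// mule0.
    rewrite mulr1 mule1 lee_fin ge0_ler_powR ?nnegrE ?(ltW r0)//.
    - by rewrite fine_ge0// le_min T0 lee_fin ler0n.
    - by rewrite -lee_fin fineK// ge_min lexx orbT.
  have Nfin : (\int[mu]_x (Tn n x `^ r)%:E < +oo)%E.
    apply: (@le_lt_trans _ _ (\int[mu]_x ((n%:R `^ r)%:E * (\1_(`[- n%:R, n%:R]%classic : set R) x)%:E))%E).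
      apply: ge0_le_integral => //.
      - by move=> x _; rewrite lee_fin powR_ge0.
      - exact: mTrE.
      - by apply: measurable_funeM; exact: mI.
    rewrite ge0_integralZl ?lee_fin ?powR_ge0//; last exact: mI.
    rewrite integral_indic//= setIT lebesgue_measure_itv/=.
    by case: ifP => _; rewrite ?mule0// -EFinD -EFinM ltry.
  set N := fine (\int[mu]_x (Tn n x `^ r)%:E).
  have NE : (\int[mu]_x (Tn n x `^ r)%:E = N%:E)%E.
    by rewrite fineK// ge0_fin_numE// integral_ge0// => x _; rewrite lee_fin powR_ge0.
  have : 0 <= N by rewrite fine_ge0// integral_ge0// => x _; rewrite lee_fin powR_ge0.
  rewrite le_eqVlt => /orP[/eqP N0|N0]; first by rewrite NE -N0 lee_fin powR_ge0.
  pose H x := N^-1 * Tn n x `^ r.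
  have mH : measurable_fun [set: R] H by exact: measurable_funM.
  have H0 x : 0 <= H x by rewrite mulr_ge0 ?invr_ge0 ?powR_ge0 ?ltW.
  have H1 : (\int[mu]_x (H x)%:E <= 1)%E.
    under eq_integral do rewrite EFinM.
    rewrite ge0_integralZl ?lee_fin ?invr_ge0 ?(ltW N0)//; last 2 first.
    - exact: mTrE.
    - by move=> x _; rewrite lee_fin powR_ge0.
    by rewrite NE -EFinM mulVf ?gt_eqF.
  have := hT H mH H0 H1.
  have lower : ((N `^ (c - 1))%:E * \int[mu]_x (Tn n x `^ r)%:E <=
      \int[mu]_x (T x * (H x `^ (1 - c))%:E))%E.
    rewrite -ge0_integralZl ?lee_fin ?powR_ge0//; last 2 first.
    - exact: mTrE.
    - by move=> x _; rewrite lee_fin powR_ge0.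
    apply: ge0_le_integral => //.
    - by move=> x _; rewrite -EFinM lee_fin mulr_ge0 ?powR_ge0.
    - by apply: measurable_funeM; exact: mTrE.
    - apply: emeasurable_funM => //; apply/measurable_EFinP.
      exact: (measurableT_comp (measurable_powR _)).
    move=> x _.
    apply: (@le_trans _ _ ((Tn n x)%:E * (H x `^ (1 - c))%:E)%E); last first.
      by rewrite lee_wpmul2r// lee_fin powR_ge0.
    rewrite -!EFinM lee_fin /H.
    have := Tn0 n x; move: (Tn n x) => t; rewrite le_eqVlt => /orP[/eqP <-|t0].
      by rewrite powR0 ?gt_eqF// mulr0 mul0r.
    rewrite powRM ?invr_ge0 ?powR_ge0 ?(ltW N0)// -powRrM.
    rewrite /powR !gt_eqF ?invr_gt0//.
    rewrite lnV ?posrE//.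
    rewrite -[X in _ <= X * _](lnK t0) -!expRD ler_expR.
    rewrite (_ : r * (1 - c) = r - r * c); last by ring.
    by rewrite rc le_eqVlt; apply/predU1l; ring.
  move=> /(le_trans lower); rewrite NE -EFinM lee_fin => NK.
  have {}NK : N `^ c <= K.
    apply: le_trans NK; rewrite /powR !gt_eqF// -{3}(lnK N0) -expRD ler_expR.
    by rewrite le_eqVlt; apply/predU1l; ring.
  rewrite lee_fin -[N](powRr1 (ltW N0)) -rc mulrC powRrM.
  by rewrite ge0_ler_powR ?nnegrE ?powR_ge0 ?(ltW r0) ?(ltW K0).
have in_cube n x : `|x| <= n%:R -> Tn n x = fine (mine (T x) n%:R%:E).
  move=> xn; rewrite /Tn indicE mem_set ?mulr1//=.
  by rewrite in_itv/= -ler_norml.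
have out_cube n x : n%:R < `|x| -> Tn n x = 0.
  move=> nx; rewrite /Tn indicE memNset ?mulr0//= in_itv/= -ler_norml.
  by apply/negP; rewrite -ltNge.
have ndTn x n m : (n <= m)%N -> Tn n x <= Tn m x.
  move=> nm; have [xn|nx] := leP `|x| n%:R; last by rewrite (out_cube _ _ nx).
  have nm' : n%:R <= m%:R :> R by rewrite ler_nat.
  rewrite !in_cube ?(le_trans xn)// fine_le//.
  by rewrite le_min !ge_min lexx/= lee_fin nm' orbT.
have nd x : {homo (fun n => (Tn n x `^ r)%:E) : n m / (n <= m)%N >-> (n <= m)%E}.
  by move=> n m nm; rewrite lee_fin ge0_ler_powR ?nnegrE ?ndTn// ltW.
have cvgT x : ((Tn n x `^ r)%:E @[n --> \oo] --> T x `^ r)%E.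
  have nat_ge (y : R) : \forall n \near \oo, y <= n%:R.
    exists (Num.truncn `|y|).+1 => // n /= yn; rewrite (le_trans (ler_norm _))//.
    by rewrite ltW// (lt_le_trans (truncnS_gt _))// ler_nat.
  have := T0 x; case Tx : (T x) => [t| |]// t0.
  - apply: cvg_near_cst; near=> n; rewrite in_cube; last by near: n; exact: nat_ge.
    rewrite Tx min_l//= lee_fin; near: n; exact: nat_ge.
  - rewrite poweRyr ?gt_eqF//; apply/cvgeyPge => A; near=> n.
    rewrite in_cube; last by near: n; exact: nat_ge.
    rewrite Tx min_r ?leey//= lee_fin.
    apply: (@le_trans _ _ ((`|A| `^ r^-1) `^ r)).
      by rewrite -powRrM mulVf ?gt_eqF// powRr1// ler_norm.
    rewrite ge0_ler_powR ?nnegrE ?powR_ge0// ?(ltW r0)//.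
    by near: n; exact: nat_ge.
have -> : (\int[mu]_x (T x `^ r) = limn (fun n => \int[mu]_x (Tn n x `^ r)%:E))%E.
  rewrite -monotone_convergence//.
  - by apply: eq_integral => x _; apply/esym/cvg_lim => //; exact: cvgT.
  - by move=> n x _; rewrite lee_fin powR_ge0.
apply: lime_le; last by apply: nearW => n; exact: bound.
apply: ereal_nondecreasing_is_cvgn => n m nm; apply: ge0_le_integral => //.
- by move=> x _; rewrite lee_fin powR_ge0.
- exact: mTrE.
- exact: mTrE.
- by move=> x _; exact: nd.
Unshelve. all: by end_near. Qed.

End Duality.

(** * A single piece of the curve *)

(** F and G stand for |f|^p and |g|^q, w for the kernel t^(alpha - 1); J is the part of
    the curve that is being estimated. *)
Definition bilin (R : realType) (a b : R) (gam w : R -> R) (J : set R) (F G : R -> R)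
    (x : R) : \bar R :=
  (\int[mu]_(t in J) (F (x - t)%R `^ a * G (x - gam t)%R `^ b * w t)%:E)%E.

Section Piece.
Context {R : realType}.
Local Notation mu := (@lebesgue_measure R).
Variables (a b : R) (a0 : 0 < a) (a1 : a < 1) (b0 : 0 < b) (b1 : b < 1).
Variables (gam : R -> R) (mgam : measurable_fun [set: R] gam).
Variables (w : R -> R) (mw : measurable_fun [set: R] w) (w0 : forall t, 0 <= w t).

Lemma measurable_bilin_integrand (F G : R -> R) :
  measurable_fun [set: R] F -> measurable_fun [set: R] G ->
  measurable_fun [set: R * R] (fun z => F (z.1 - z.2) `^ a * G (z.1 - gam z.2) `^ b).
Proof.
move=> mF mG; apply: measurable_funM;
  apply: (measurableT_comp (measurable_powR _)).
- exact: (measurable_fun_shift mF (phi := id)).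
- exact: (measurable_fun_shift mG mgam).
Qed.

Lemma measurable_bilin_integrandw (F G : R -> R) :
  measurable_fun [set: R] F -> measurable_fun [set: R] G ->
  measurable_fun [set: R * R]
    (fun z => F (z.1 - z.2) `^ a * G (z.1 - gam z.2) `^ b * w z.2).
Proof.
move=> mF mG; apply: measurable_funM; first exact: measurable_bilin_integrand.
exact: measurableT_comp.
Qed.

Lemma bilin_ge0 J F G x : (0 <= bilin a b gam w J F G x)%E.
Proof.
by apply: integral_ge0 => t _; rewrite lee_fin !mulr_ge0 ?powR_ge0.
Qed.

Lemma measurable_bilin J (F G : R -> R) : measurable J ->
  measurable_fun [set: R] F -> measurable_fun [set: R] G ->
  measurable_fun [set: R] (bilin a b gam w J F G).
Proof.
move=> mJ mF mG.
apply: (@measurable_dint R J mJ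
  (fun z => F (z.1 - z.2) `^ a * G (z.1 - gam z.2) `^ b * w z.2)).
  exact: measurable_bilin_integrandw.
by move=> z; rewrite !mulr_ge0 ?powR_ge0.
Qed.

Variables (J : set R) (mJ : measurable J) (m : R) (m0 : 0 < m) (Jm : (mu J <= m%:E)%E).
Variables (s d W : R) (s0 : 0 < s) (d0 : 0 < d) (W0 : 0 < W).
Hypothesis wW : forall t, J t -> w t <= W.
Hypothesis gam_exp : forall x y, J x -> J y -> s * `|x - y| <= `|gam x - gam y|.
Hypothesis h_exp : forall x y, J x -> J y ->
  d * `|x - y| <= `|(x - gam x) - (y - gam y)|.

Section FixFG.
Variables (F G : R -> R) (LF : unit_mass F) (LG : unit_mass G).
Let mF := LF.1.
Let F0 := LF.2.1.
Let mG := LG.1.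
Let G0 := LG.2.1.

Lemma bilin_weighted (Q : R -> R) K0 : measurable_fun [set: R] Q ->
  (forall x, 0 <= Q x) ->
  dint_le J (fun z => F (z.1 - z.2) `^ a * G (z.1 - gam z.2) `^ b * Q z.1) K0 ->
  (\int[mu]_x (bilin a b gam w J F G x * (Q x)%:E) <= (W * K0)%:E)%E.
Proof.
move=> mQ Q0 hQ.
have [mf f0 fK] := dint_leZ mJ (ltW W0) hQ.
apply: le_trans fK.
have mB := measurable_bilin mJ mF mG.
apply: ge0_le_integral => //.
- by move=> x _; rewrite mule_ge0 ?lee_fin// bilin_ge0.
- by apply: emeasurable_funM => //; exact/measurable_EFinP.
- exact: (measurable_dint mJ mf f0).
move=> x _; rewrite /bilin muleC -ge0_integralZl ?lee_fin//; last 2 first.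
- exact: (measurable_section x (measurable_bilin_integrandw mF mG)).
- by move=> t _; rewrite lee_fin !mulr_ge0 ?powR_ge0.
apply: ge0_le_integral => //.
- by move=> t _; rewrite -EFinM lee_fin !mulr_ge0 ?powR_ge0.
- apply: measurable_funeM.
  exact: (measurable_section x (measurable_bilin_integrandw mF mG)).
- exact: (measurable_section x mf).
move=> t Jt; rewrite -EFinM lee_fin /=.
rewrite mulrC -!mulrA [leRHS]mulrC -!mulrA !ler_wpM2l ?powR_ge0//.
by rewrite mulrC ler_wpM2l// wW.
Qed.

(** In [weighted_amgm6] give each product the inverse of its double integral as a weight:
    the combination then has integral at most t1 + ... + t6 = 1 and only the constant in
    front remains. *)
Lemma trilinear_lt1 (e t1 t2 t3 t4 t5 t6 : R) (H : R -> R) :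
  0 < e -> 0 <= t1 -> 0 <= t2 -> 0 <= t3 -> 0 <= t4 -> 0 <= t5 -> 0 <= t6 ->
  a = t1 + t2 + t4 -> b = t1 + t3 + t5 -> e = t2 + t3 + t6 ->
  t1 + t2 + t3 + t4 + t5 + t6 = 1 -> unit_mass H ->
  dint_le J (fun z => F (z.1 - z.2) `^ a * G (z.1 - gam z.2) `^ b * H z.1 `^ e)
    (expR (- (t1 * ln d + t3 * ln s) + (1 - t1 - t2 - t3) * ln m)).
Proof.
move=> e0 t10 t20 t30 t40 t50 t60 aE bE eE ts LH.
set K := expR _.
have KE : K = expR (- (t1 * ln d + t2 * ln 1 + t3 * ln s + t4 * ln m^-1 +
    t5 * ln m^-1 + t6 * ln m^-1)).
  rewrite /K ln1 lnV ?posrE// -ts; congr expR; ring.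
have mV0 : 0 < m^-1 by rewrite invr_gt0.
have K0 : 0 <= K by exact: expR_ge0.
have H0 := LH.2.1.
apply: (@dint_leS _ _ mJ _ _ K _ _ (fun z => weighted_amgm6 a0 b0 e0
  (F0 _) (G0 _) (H0 _) d0 ltr01 s0 mV0 mV0 mV0 t10 t20 t30 t40 t50 t60 aE bE eE ts)).
- apply: measurable_funM; first exact: measurable_bilin_integrand.
  apply: (measurableT_comp (measurable_powR _)); apply: measurable_fst_comp.
  exact: LH.1.
- by move=> z; rewrite !mulr_ge0 ?powR_ge0.
rewrite -KE.
rewrite [X in dint_le _ _ X](_ : K = K * (t1 * (d * d^-1) + t2 * (1 * 1) +
    t3 * (s * s^-1) + t4 * (m^-1 * m) + t5 * (m^-1 * m) + t6 * (m^-1 * m))).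
  have V0 := ltW mV0.
  have T1 := dint_leZ mJ t10 (dint_leZ mJ (ltW d0) (dint_FG mJ mgam d0 h_exp LF LG)).
  have T2 := dint_leZ mJ t20 (dint_leZ mJ ler01 (dint_HF mJ LF LH)).
  have T3 := dint_leZ mJ t30 (dint_leZ mJ (ltW s0) (dint_HG mJ mgam s0 gam_exp LG LH)).
  have T4 := dint_leZ mJ t40 (dint_leZ mJ V0 (dint_F mJ Jm LF)).
  have T5 := dint_leZ mJ t50 (dint_leZ mJ V0 (dint_G mJ Jm mgam LG)).
  have T6 := dint_leZ mJ t60 (dint_leZ mJ V0 (dint_H mJ Jm LH)).
  exact: (dint_leZ mJ K0 (dint_leD mJ (dint_leD mJ (dint_leD mJ (dint_leD mJ
    (dint_leD mJ T1 T2) T3) T4) T5) T6)).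
by rewrite !mulfV ?mulVf ?gt_eqF// !mulr1 ts mulr1.
Qed.

Section Weight.
Variables (I I' : set R) (L : R) (L0 : 0 < L).
Hypotheses (mI : measurable I) (mI' : measurable I') (IL : (mu I <= L%:E)%E).
Hypothesis hI' : forall t, J t -> I' (t - gam t).
Hypothesis hI : forall t v, J t -> I' v -> I (t - v).

Let kap := normal_pdf (0 : R) 1.

(** The weight for [weighted_norm_ge1]. Its value at x contains the mass of G in the
    window x - I, its own mass is at most 2 L, and the Gaussian keeps it positive. *)
Definition local_weight x := fine (\int[mu]_(y in I) (G (x - y)%R)%:E)%E + L * kap x.

Let kap0 x : 0 < kap x.
Proof. by rewrite /kap normal_pdfE ?oner_neq0// mulr_gt0 ?normal_peak_gt0 ?oner_neq0// expR_gt0. Qed.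

Let mGsub : measurable_fun [set: R * R] (fun z => G (z.1 - z.2)).
Proof. exact: (measurable_fun_shift mG (phi := id)). Qed.

Let intG_fin x : (\int[mu]_(y in I) (G (x - y)%R)%:E)%E \is a fin_num.
Proof.
rewrite ge0_fin_numE; last by apply: integral_ge0 => y _; rewrite lee_fin.
apply: (@le_lt_trans _ _ 1%E); last exact: ltry.
apply: le_trans LG.2.2; rewrite -[leRHS]mul1e -invr1.
apply: (@ge0_integral_expanding R I setT (fun y => x - y) 1 (EFin \o G)) => //.
- exact: measurable_funB.
- by move=> y z _ _; rewrite mul1r distrC le_eqVlt; apply/predU1l; congr (`|_|); ring.
- exact/measurable_EFinP.
Qed.

Lemma local_weight_gt0 x : 0 < local_weight x.
Proof.
rewrite ltr_wpDl ?mulr_gt0// fine_ge0// integral_ge0// => y _.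
by rewrite lee_fin.
Qed.

Lemma measurable_local_weight : measurable_fun [set: R] local_weight.
Proof.
apply: measurable_funD; last by apply: measurable_funM => //; exact: measurable_normal_pdf.
apply: measurableT_comp => //.
exact: (measurable_dint mI mGsub (fun z => G0 _)).
Qed.

Lemma integral_local_weight : (\int[mu]_x (local_weight x)%:E <= (2 * L)%:E)%E.
Proof.
have E x : (local_weight x)%:E = (\int[mu]_(y in I) (G (x - y)%R)%:E + L%:E * (kap x)%:E)%E.
  by rewrite /local_weight EFinD fineK.
under eq_integral do rewrite E.
have mk : measurable_fun [set: R] (fun x => (kap x)%:E).
  by apply/measurable_EFinP; exact: measurable_normal_pdf.
rewrite ge0_integralD//; last 4 first.
- by move=> x _; apply: integral_ge0 => y _; rewrite lee_fin.
- exact: (measurable_dint mI mGsub (fun z => G0 _)).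
- by move=> x _; rewrite mule_ge0// lee_fin ltW.
- exact: measurable_funeM.
rewrite ge0_integralZl//; last 2 first.
- by move=> x _; rewrite lee_fin ltW.
- by rewrite lee_fin ltW.
rewrite integral_normal_pdf ?oner_neq0// mule1 mulr_natl mulr2n EFinD leeD//.
exact: (single_term mI LG (phi := id) (@measurable_id _ _ _) IL).
Qed.

(** The mass of G seen along the piece lies in u + I'; at every point u + t of the piece
    the weight is at least that mass, so the quotient integrates to at most 1 / d. *)
Lemma local_weight_ratio u :
  (\int[mu]_(t in J) (G (u + (t - gam t)) * (local_weight (u + t))^-1)%:E <= d^-1%:E)%E.
Proof.
pose S' := (\int[mu]_(v in I') (G (u + v)%R)%:E)%E.
have S'S t : J t -> (S' <= (local_weight (u + t)%R)%:E)%E.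
  move=> Jt; apply: (@le_trans _ _ (\int[mu]_(y in I) (G (u + t - y)%R)%:E)%E); last first.
    by rewrite -(fineK (intG_fin _)) lee_fin /local_weight lerDl ltW// mulr_gt0.
  have mt : measurable_fun [set: R] (fun v => t - v) by exact: measurable_funB.
  have dist y z : I' y -> I' z -> 1 * `|y - z| <= `|(t - y) - (t - z)|.
    by move=> _ _; rewrite mul1r distrC le_eqVlt; apply/predU1l; congr (`|_|); ring.
  have mGt : measurable_fun [set: R] (fun y => (G (u + t - y))%:E).
    by apply/measurable_EFinP; apply: measurableT_comp => //; exact: measurable_funB.
  have Gt0 y : (0 <= (G (u + t - y))%:E)%E by rewrite lee_fin.
  have := ge0_integral_expanding mI' mI mt ltr01 dist (fun v => hI Jt) mGt Gt0.
  rewrite invr1 mul1e; apply: le_trans; rewrite le_eqVlt; apply/predU1l.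
  by apply: eq_integral => v _; congr (G _)%:E; ring.
have mGu : measurable_fun [set: R] (fun t => G (u + (t - gam t))).
  by apply: measurableT_comp => //; apply: measurable_funD => //; exact: measurable_funB.
have mSu : measurable_fun [set: R] (fun t => (local_weight (u + t))^-1).
  apply: (measurable_fun_inv_pos (S := fun t => local_weight (u + t))) => [|t]; last exact: local_weight_gt0.
  by apply: measurableT_comp; [exact: measurable_local_weight|exact: measurable_funD].
have Si0 x : 0 <= (local_weight x)^-1 by rewrite invr_ge0 ltW// local_weight_gt0.
have mprod : measurable_fun J (fun t => (G (u + (t - gam t)) * (local_weight (u + t))^-1)%:E).
  by apply: measurable_funTS; apply/measurable_EFinP; exact: measurable_funM.
have hG : (\int[mu]_(t in J) (G (u + (t - gam t)))%:E <= d^-1%:E * S')%E.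
  exact: integral_hG.
have S'0 : (0 <= S')%E by apply: integral_ge0 => v _; rewrite lee_fin.
have S'fin : S' \is a fin_num.
  rewrite ge0_fin_numE//; apply: (@le_lt_trans _ _ 1%E); last exact: ltry.
  apply: le_trans (integral_translate_le1 LG u).
  apply: ge0_subset_integral => //; last by move=> v _; rewrite lee_fin.
  by apply/measurable_EFinP; apply: measurableT_comp => //; exact: measurable_funD.
have mGuE : measurable_fun J (fun t => (G (u + (t - gam t)))%:E).
  by apply: measurable_funTS; apply/measurable_EFinP.
have [S'z|S'nz] := eqVneq (fine S') 0.
  have S'E : S' = 0%E by rewrite -(fineK S'fin) S'z.
  have Gz : (\int[mu]_(t in J) `|(G (u + (t - gam t)))%:E| = 0)%E.
    apply/eqP; rewrite eq_le; apply/andP; split; last by apply: integral_ge0.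
    rewrite (_ : 0%E = d^-1%:E * S')%E; last by rewrite S'E mule0.
    apply: le_trans hG; under eq_integral do rewrite gee0_abs ?lee_fin//.
    by [].
  have Gae := (ae_eq_integral_abs mu mJ mGuE).1 Gz.
  rewrite (_ : (\int[mu]_(t in J) _)%E = 0%E) ?lee_fin ?invr_ge0 ?(ltW d0)//.
  rewrite -(integral0 mu J); apply: ge0_ae_eq_integral => //.
  - by move=> t _; rewrite lee_fin mulr_ge0.
  - by apply: filterS Gae => t /[apply] /= -[->]; rewrite mul0r.
have S'pos : 0 < fine S' by rewrite lt_def S'nz fine_ge0.
apply: (@le_trans _ _ (\int[mu]_(t in J) ((fine S')^-1%:E * (G (u + (t - gam t)))%:E))%E).
  apply: ge0_le_integral => //.
  - by move=> t _; rewrite lee_fin mulr_ge0.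
  - exact: measurable_funeM.
  move=> t Jt; rewrite -EFinM lee_fin mulrC ler_wpM2r// lef_pV2 ?posrE ?local_weight_gt0//.
  by rewrite -lee_fin fineK// S'S.
rewrite ge0_integralZl//; last 2 first.
- by move=> t _; rewrite lee_fin.
- by rewrite lee_fin invr_ge0 ltW.
rewrite lee_pdivrMl// fineK// muleC.
exact: hG.
Qed.

End Weight.
End FixFG.
End Piece.

(** K bounds an L^(1/c) quasi-norm. The inequality is between integrals of powers, so it
    has the same form for exponents above and below 1. *)
Definition bilin_bounded (R : realType) (a b c : R) (gam w : R -> R) (J : set R) (K : R) :=
  forall F G : R -> R,
  unit_mass F -> unit_mass G ->
  (\int[mu]_x (bilin a b gam w J F G x `^ c^-1) <= (K `^ c^-1)%:E)%E.

Section Piece2.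
Context {R : realType}.
Local Notation mu := (@lebesgue_measure R).
Variables (a b : R) (a0 : 0 < a) (a1 : a < 1) (b0 : 0 < b) (b1 : b < 1).
Variables (gam : R -> R) (mgam : measurable_fun [set: R] gam).
Variables (w : R -> R) (mw : measurable_fun [set: R] w) (w0 : forall t, 0 <= w t).
Variables (J : set R) (mJ : measurable J) (m : R) (m0 : 0 < m) (Jm : (mu J <= m%:E)%E).
Variables (s d W : R) (s0 : 0 < s) (d0 : 0 < d) (W0 : 0 < W).
Hypothesis wW : forall t, J t -> w t <= W.
Hypothesis gam_exp : forall x y, J x -> J y -> s * `|x - y| <= `|gam x - gam y|.
Hypothesis h_exp : forall x y, J x -> J y ->
  d * `|x - y| <= `|(x - gam x) - (y - gam y)|.

(** The case r > 1, by duality with a function H of mass one taken to the power 1 - c. *)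
Lemma piece_lt1 (c t1 t2 t3 t4 t5 t6 : R) : 0 < c -> c < 1 ->
  0 <= t1 -> 0 <= t2 -> 0 <= t3 -> 0 <= t4 -> 0 <= t5 -> 0 <= t6 ->
  a = t1 + t2 + t4 -> b = t1 + t3 + t5 -> 1 - c = t2 + t3 + t6 ->
  t1 + t2 + t3 + t4 + t5 + t6 = 1 ->
  bilin_bounded a b c gam w J
    (W * (expR (- (t1 * ln d + t3 * ln s) + (1 - t1 - t2 - t3) * ln m))).
Proof.
move=> c0 c1 t10 t20 t30 t40 t50 t60 aE bE eE ts F G LF LG.
have e0 : 0 < 1 - c by rewrite subr_gt0.
apply: dual_norm_lt1 => //.
- exact: (measurable_bilin a b mgam mw w0 mJ LF.1 LG.1).
- by move=> x; exact: bilin_ge0.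
- by rewrite mulr_gt0// expR_gt0.
move=> H mH H0 H1.
have LH : unit_mass H by [].
apply: (bilin_weighted mgam mw w0 mJ W0 wW LF LG (Q := fun x => H x `^ (1 - c))).
- exact: (measurableT_comp (measurable_powR _)).
- by move=> x; exact: powR_ge0.
exact: (trilinear_lt1 a0 b0 mgam mJ m0 Jm s0 d0 gam_exp h_exp LF LG e0 t10 t20 t30 t40
  t50 t60 aE bE eE ts LH).
Qed.

Section Ge1.
Variables (I I' : set R) (L : R) (L0 : 0 < L).
Hypotheses (mI : measurable I) (mI' : measurable I') (IL : (mu I <= L%:E)%E).
Hypothesis hI' : forall t, J t -> I' (t - gam t).
Hypothesis hI : forall t v, J t -> I' v -> I (t - v).

(** The inverse of the weight plays the part of the dual function: it can be put on the
    product FG at no cost by [local_weight_ratio]. *)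
Lemma trilinear_ge1 (F G : R -> R) (LF : unit_mass F) (LG : unit_mass G) (c : R) :
  1 <= c -> c <= a + b ->
  dint_le J (fun z => F (z.1 - z.2) `^ a * G (z.1 - gam z.2) `^ b *
      (local_weight G I L z.1)^-1 `^ (c - 1))
    (expR (- ((a + b - 1) * ln d) + (2 - a - b) * ln m)).
Proof.
move=> c1 cab.
set K := expR _.
have K0 : 0 <= K by exact: expR_ge0.
have F0 := LF.2.1. have G0 := LG.2.1.
have e0 : 0 <= c - 1 by rewrite subr_ge0.
have eab : c - 1 <= a + b - 1 by rewrite lerB.
have V0 : 0 <= m^-1 by rewrite invr_ge0 ltW.
have S0 x : 0 < (local_weight G I L x)^-1 by rewrite invr_gt0 (local_weight_gt0 LG).
have mS : measurable_fun [set: R] (fun x => (local_weight G I L x)^-1).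
  by apply: measurable_fun_inv_pos; [exact: (measurable_local_weight LG L mI)|move=> x; exact: (local_weight_gt0 LG)].
have e1 : 0 <= a + b - 1 - (c - 1) by rewrite subr_ge0.
have e2 : 0 <= 1 - b by rewrite subr_ge0 ltW.
have e3 : 0 <= 1 - a by rewrite subr_ge0 ltW.
apply: (@dint_leS _ _ mJ _ _ K _ _ (fun z => weighted_amgm4 a0 b0 e0
  (F0 _) (G0 _) (S0 _) d0 m0 (ltW a1) (ltW b1) eab)).
- apply: measurable_funM; first exact: (measurable_bilin_integrand a b mgam LF.1 LG.1).
  apply: (measurableT_comp (measurable_powR _)).
  exact: (measurable_fst_comp mS).
- by move=> z; rewrite !mulr_ge0 ?powR_ge0.
rewrite -/K.
rewrite [X in dint_le _ _ X](_ : K = K * ((c - 1) * (d * d^-1) +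
   (a + b - 1 - (c - 1)) * (d * d^-1) + (1 - b) * (m^-1 * m) + (1 - a) * (m^-1 * m))).
  have FGS : dint_le J (fun z => F (z.1 - z.2) * G (z.1 - gam z.2) * (local_weight G I L z.1)^-1) d^-1.
    have d0' : 0 <= d^-1 by rewrite invr_ge0 ltW.
    split.
    - apply: measurable_funM; last exact: (measurable_fst_comp mS).
      apply: measurable_funM; first exact: (measurable_shiftF LF).
      exact: (measurable_shiftG mgam LG).
    - by move=> z; rewrite !mulr_ge0// ltW.
    apply: (triple_term mJ LF LG mS (fun x => ltW (S0 x)) mgam d0') => u.
    exact: (local_weight_ratio mgam mJ d0 h_exp LG L0 mI mI' hI' hI).
  have T1 := dint_leZ mJ e0 (dint_leZ mJ (ltW d0) FGS).
  have T2 := dint_leZ mJ e1 (dint_leZ mJ (ltW d0) (dint_FG mJ mgam d0 h_exp LF LG)).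
  have T3 := dint_leZ mJ e2 (dint_leZ mJ V0 (dint_F mJ Jm LF)).
  have T4 := dint_leZ mJ e3 (dint_leZ mJ V0 (dint_G mJ Jm mgam LG)).
  exact: (dint_leZ mJ K0 (dint_leD mJ (dint_leD mJ (dint_leD mJ T1 T2) T3) T4)).
rewrite !mulfV ?mulVf ?gt_eqF// !mulr1.
rewrite (_ : _ + (1 - a) = 1) ?mulr1//; ring.
Qed.

Lemma piece_ge1 (c : R) : 1 <= c -> c <= a + b ->
  bilin_bounded a b c gam w J
    (W * expR (- ((a + b - 1) * ln d) + (2 - a - b) * ln m) * (2 * L) `^ (c - 1)).
Proof.
move=> c1 cab F G LF LG.
have c0 : 0 < c by rewrite (lt_le_trans _ c1).
have L20 : 0 < 2 * L by rewrite mulr_gt0.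
have K0 : 0 < W * expR (- ((a + b - 1) * ln d) + (2 - a - b) * ln m).
  by rewrite mulr_gt0// expR_gt0.
have S0 := local_weight_gt0 LG I L0.
set A := W * expR _ in K0 *.
have -> : (A * (2 * L) `^ (c - 1)) `^ c^-1 = A `^ c^-1 * (2 * L) `^ (1 - c^-1).
  rewrite powRM ?powR_ge0 ?(ltW K0)// -powRrM; congr (_ * _ `^ _).
  by rewrite mulrBl mul1r mulfV ?gt_eqF.
apply: (weighted_norm_ge1 _ _ c1 K0 L20 (S := local_weight G I L)) => //.
- exact: (measurable_bilin a b mgam mw w0 mJ LF.1 LG.1).
- by move=> x; exact: bilin_ge0.
- exact: (measurable_local_weight LG L mI).
- exact: (integral_local_weight LG L0 mI IL).
apply: (bilin_weighted mgam mw w0 mJ W0 wW LF LG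
  (Q := fun x => (local_weight G I L x)^-1 `^ (c - 1))).
- apply: (measurableT_comp (measurable_powR _)).
  by apply: measurable_fun_inv_pos => //; exact: (measurable_local_weight LG L mI).
- by move=> x; exact: powR_ge0.
exact: (trilinear_ge1 LF LG c1 cab).
Qed.
End Ge1.

End Piece2.

Section PieceInterval.
Context {R : realType}.
Variables (a b c : R) (a0 : 0 < a) (a1 : a < 1) (b0 : 0 < b) (b1 : b < 1) (c0 : 0 < c).
Hypotheses (cab : c < a + b) (sg1 : a + b - c < 1).
Variables (gam : R -> R) (mgam : measurable_fun [set: R] gam).
Variables (w : R -> R) (mw : measurable_fun [set: R] w) (w0 : forall t, 0 <= w t).
Variables (u v m s d B W : R) (m0 : 0 < m) (uvm : v - u <= m).
Variables (s0 : 0 < s) (d0 : 0 < d) (B0 : 0 <= B) (W0 : 0 < W).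
Let J : set R := `[u, v]%classic.
Hypothesis wW : forall t, J t -> w t <= W.
Hypothesis gam_exp : forall x y, J x -> J y -> s * `|x - y| <= `|gam x - gam y|.
Hypothesis h_exp : forall x y, J x -> J y ->
  d * `|x - y| <= `|(x - gam x) - (y - gam y)|.
Hypothesis h_lip : forall x y, J x -> J y ->
  `|(x - gam x) - (y - gam y)| <= B * `|x - y|.

Let mJ : measurable J. Proof. exact: measurable_itv. Qed.

Let Jm : (lebesgue_measure J <= m%:E)%E.
Proof.
rewrite lebesgue_measure_itv/= lte_fin; case: ifP => _; rewrite lee_fin//.
exact: ltW.
Qed.

Let pos (x : R) := Num.max 0 x.

(** Here t2 and t3 are the coefficients of the products hf and hg. The coefficient of fg is
    the least possible one, (a + b - 1)^+, since it is the exponent of 1 / d, and d is small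
    near the tangency; how the rest is shared decides the exponent t3 of 1 / s. *)
Lemma piece_interval_lt1 (t2 t3 : R) : c < 1 ->
  t2 + t3 = a + b - c - pos (a + b - 1) -> pos (a - c) <= t2 -> pos (b - c) <= t3 ->
  bilin_bounded a b c gam w J
    (W * (d `^ (- pos (a + b - 1)) * s `^ (- t3) * m `^ (1 - (a + b - c)))).
Proof.
move=> c1 tE; rewrite /pos in tE *; rewrite !ge_max => /andP[t20 t2c] /andP[t30 t3c].
have : 0 <= Num.max 0 (a + b - 1) by rewrite le_max lexx.
have : a + b - 1 <= Num.max 0 (a + b - 1) by rewrite le_max lexx orbT.
move: (Num.max 0 (a + b - 1)) tE => t1 tE t1ab t10.
have -> : W * (d `^ (- t1) * s `^ (- t3) * m `^ (1 - (a + b - c))) =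
    W * (expR (- (t1 * ln d + t3 * ln s) + (1 - t1 - t2 - t3) * ln m)).
  rewrite /powR !gt_eqF// -!expRD; congr (_ * expR _).
  have -> : 1 - t1 - t2 - t3 = 1 - (a + b - c) by lra.
  by ring.
have := @piece_lt1 R a b a0 b0 gam mgam w mw w0 J mJ m m0 Jm s d W s0 d0 W0 wW
  gam_exp h_exp c t1 t2 t3 (a - t1 - t2) (b - t1 - t3) (1 - c - t2 - t3) c0 c1 t10 t20 t30.
apply; lra.
Qed.

(** On an interval of length m the quantity t - gam t varies by at most B m, so the weight
    can be localised at the scale (2 B + 1) m. *)
Lemma piece_interval_ge1 : 1 <= c ->
  bilin_bounded a b c gam w J
    (W * (d `^ (- (a + b - 1)) * m `^ (1 - (a + b - c))) * (4 * (B + 1)) `^ (c - 1)).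
Proof.
move=> c1.
pose h t := t - gam t.
pose L := (2 * B + 1) * m.
have L0 : 0 < L by apply: mulr_gt0 => //; move: B0 uvm m0; lra.
pose I' : set R := `[h u - B * m, h u + B * m]%classic.
pose I : set R := `[u - h u - B * m, u + m - h u + B * m]%classic.
have uJ t : J t -> J u /\ `|t - u| <= m.
  rewrite /J/= !in_itv/= => /andP[ut tv]; split.
    by rewrite lexx (le_trans ut).
  by rewrite ger0_norm; move: B0 uvm m0; lra.
have mI : measurable I by exact: measurable_itv.
have mI' : measurable I' by exact: measurable_itv.
have IL : (lebesgue_measure I <= L%:E)%E.
  rewrite lebesgue_measure_itv/= lte_fin; case: ifP => _; rewrite lee_fin/L; last exact: ltW.
  by rewrite le_eqVlt; apply/predU1l; ring.
have hI' t : J t -> I' (t - gam t).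
  move=> Jt; have [Ju tu] := uJ t Jt.
  have := h_lip Jt Ju.
  have : B * `|t - u| <= B * m by rewrite ler_wpM2l.
  rewrite /I'/= in_itv/= /h => H1 H2; have := le_trans H2 H1.
  by rewrite ler_norml => /andP[H3 H4]; apply/andP; split; move: B0 uvm m0; lra.
have hI t x : J t -> I' x -> I (t - x).
  move=> Jt; have [_ tu] := uJ t Jt; move: Jt; rewrite /J /I /I' /= !in_itv/=.
  move: tu; rewrite ler_norml => /andP[H3 H4] /andP[H5 H6] /andP[H7 H8].
  by apply/andP; split; move: B0 uvm m0; lra.
have := @piece_ge1 R a b a0 a1 b0 b1 gam mgam w mw w0 J mJ m m0 Jm d W d0 W0 wW
  h_exp I I' L L0 mI mI' IL hI' hI c c1 (ltW cab).
move=> H F G LF LG; apply: le_trans (H F G LF LG) _.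
rewrite lee_fin ge0_ler_powR ?invr_ge0 ?(ltW c0)// ?nnegrE.
- by rewrite !mulr_ge0 ?powR_ge0 ?expR_ge0 ?ltW.
- by rewrite !mulr_ge0 ?powR_ge0 ?expR_ge0 ?ltW.
rewrite -!mulrA ler_wpM2l ?(ltW W0)//.
have -> : expR (- ((a + b - 1) * ln d) + (2 - a - b) * ln m) =
  d `^ (- (a + b - 1)) * m `^ (2 - a - b).
  by rewrite /powR !gt_eqF// -!expRD; congr expR; ring.
rewrite -mulrA ler_wpM2l ?powR_ge0//.
have -> : m `^ (1 - (a + b - c)) = m `^ (2 - a - b) * m `^ (c - 1).
  rewrite -powRD; last by rewrite (gt_eqF m0) implybT.
  by congr (_ `^ _); ring.
rewrite -mulrA ler_wpM2l ?powR_ge0//.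
rewrite -powRM ?(ltW m0)//; last by move: B0 uvm m0; lra.
rewrite ge0_ler_powR ?nnegrE ?subr_ge0//.
- by rewrite mulr_ge0// ltW.
- by rewrite mulr_ge0 ?(ltW m0)//; move: B0 uvm m0; lra.
rewrite /L mulrA mulrC ler_wpM2l ?(ltW m0)//; move: B0 uvm m0; lra.
Qed.

End PieceInterval.

(** * The geometric regimes *)

Lemma bilin_bounded_le (R : realType) (a b c : R) (gam w : R -> R) (J : set R) (K K' : R) :
  0 < c -> 0 <= K -> K <= K' ->
  bilin_bounded a b c gam w J K -> bilin_bounded a b c gam w J K'.
Proof.
move=> c0 K0 KK' H F G LF LG; apply: le_trans (H F G LF LG) _.
by rewrite lee_fin ge0_ler_powR ?invr_ge0 ?(ltW c0) ?nnegrE// (le_trans K0).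
Qed.

Section Regimes.
Context {R : realType}.
Variables (a b c : R) (a0 : 0 < a) (a1 : a < 1) (b0 : 0 < b) (b1 : b < 1) (c0 : 0 < c).
Hypotheses (cab : c < a + b) (sg1 : a + b - c < 1).
Variables (gam : R -> R) (mgam : measurable_fun [set: R] gam).
Variables (w : R -> R) (mw : measurable_fun [set: R] w) (w0 : forall t, 0 <= w t).

Local Notation pos x := (Num.max 0 x).
Local Notation sg := (a + b - c).

(** m only bounds the length, because the pieces next to the tangency are cut off at the
    ends of the region they cover. *)
Definition curve_piece (u v m s rho W : R) :=
  [/\ 0 < m, v - u <= m, 0 < s, 0 < W & forall x y, `[u, v]%classic x -> `[u, v]%classic y ->
    w x <= W /\ s * `|x - y| <= `|gam x - gam y| <= rho * `|x - y| ].

(* room for the remaining exponent once (a + b - 1)^+ and (b - c)^+ are taken *)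
Let slack1 : c < 1 -> pos (a - c) <= sg - pos (a + b - 1) - pos (b - c).
Proof.
move=> c1; rewrite ge_max; case: (leP 0 (a + b - 1)) => H1; case: (leP 0 (b - c)) => H2;
  apply/andP; split; move: c1 H1 H2 a0 a1 b0 b1 c0 cab sg1; lra.
Qed.

Let h_upper (x y rho : R) : `|gam x - gam y| <= rho * `|x - y| ->
  `|x - gam x - (y - gam y)| <= (1 + rho) * `|x - y|.
Proof.
move=> H; rewrite (_ : _ - (y - gam y) = (x - y) - (gam x - gam y)); last by ring.
by rewrite (le_trans (ler_normB _ _))// mulrDl mul1r lerD2l.
Qed.

Let h_lower (x y rho : R) : `|gam x - gam y| <= rho * `|x - y| ->
  (1 - rho) * `|x - y| <= `|x - gam x - (y - gam y)|.
Proof.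
move=> H; rewrite (_ : _ - (y - gam y) = (x - y) - (gam x - gam y)); last by ring.
by apply: le_trans (lerB_normD _ _); rewrite normrN mulrBl mul1r lerD2l lerN2.
Qed.

Let h_lower' (x y s : R) : s * `|x - y| <= `|gam x - gam y| ->
  (s - 1) * `|x - y| <= `|x - gam x - (y - gam y)|.
Proof.
move=> H; rewrite (_ : _ - (y - gam y) = - ((gam x - gam y) - (x - y))); last by ring.
rewrite normrN; apply: le_trans (lerB_normD _ _).
by rewrite normrN mulrBl mul1r lerD2r.
Qed.

(** Where t - gam t is bi-Lipschitz with fixed constants only the size s of the derivative
    of gam varies; its exponent is made as small as possible. *)
Lemma regime_transversal (d B : R) : 0 < d -> 0 <= B ->
  exists2 C : R, 0 < C & forall u v m s rho W : R, curve_piece u v m s rho W ->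
    (forall x y, `[u, v]%classic x -> `[u, v]%classic y ->
      d * `|x - y| <= `|x - gam x - (y - gam y)| <= B * `|x - y|) ->
    bilin_bounded a b c gam w `[u, v]
      (C * (W * m `^ (1 - sg) * s `^ (- pos (b - c)))).
Proof.
move=> d0 B0.
exists (d `^ (- pos (a + b - 1)) * (1 + (4 * (B + 1)) `^ (c - 1))).
  by rewrite mulr_gt0 ?powR_gt0// ltr_wpDr ?powR_ge0.
move=> u v m s rho W [m0 uvm s0 W0 H] h.
have H1 t : `[u, v]%classic t -> w t <= W by move=> Jt; have [] := H _ _ Jt Jt.
have H2 x y : `[u, v]%classic x -> `[u, v]%classic y -> s * `|x - y| <= `|gam x - gam y|.
  by move=> Jx Jy; have [_ /andP[]] := H _ _ Jx Jy.
have h1 x y : `[u, v]%classic x -> `[u, v]%classic y ->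
    d * `|x - y| <= `|x - gam x - (y - gam y)|.
  by move=> Jx Jy; have /andP[] := h _ _ Jx Jy.
have h2 x y : `[u, v]%classic x -> `[u, v]%classic y ->
    `|x - gam x - (y - gam y)| <= B * `|x - y|.
  by move=> Jx Jy; have /andP[] := h _ _ Jx Jy.
have [c1|c1] := ltP c 1.
  have := @piece_interval_lt1 R a b c a0 b0 c0 gam mgam w mw w0 u v m s d W m0 uvm s0 d0 W0
    H1 H2 h1 (sg - pos (a + b - 1) - pos (b - c)) (pos (b - c)) c1.
  rewrite subrK => /(_ erefl (slack1 c1) (lexx _)).
  apply: bilin_bounded_le => //; first by rewrite !mulr_ge0 ?powR_ge0 ?(ltW W0).
  rewrite [leRHS](_ : _ = W * (d `^ (- pos (a + b - 1)) * s `^ (- pos (b - c)) * m `^ (1 - sg)) *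
    (1 + (4 * (B + 1)) `^ (c - 1))); last by ring.
  by rewrite ler_peMr ?lerDl ?powR_ge0// !mulr_ge0 ?powR_ge0 ?(ltW W0).
have := @piece_interval_ge1 R a b c a0 a1 b0 b1 c0 cab gam mgam w mw w0 u v m d B W m0 uvm
  d0 B0 W0 H1 h1 h2 c1.
apply: bilin_bounded_le => //; first by rewrite !mulr_ge0 ?powR_ge0 ?(ltW W0).
rewrite (_ : pos (b - c) = 0); last by apply/max_idPl; move: b1 c1; lra.
rewrite (_ : pos (a + b - 1) = a + b - 1); last by apply/max_idPr; move: cab c1; lra.
rewrite oppr0 powRr0 mulr1.
rewrite [leRHS](_ : _ = W * (d `^ (- (a + b - 1)) * m `^ (1 - sg)) *
    (1 + (4 * (B + 1)) `^ (c - 1))); last by ring.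
by rewrite ler_wpM2l ?lerDr// !mulr_ge0 ?powR_ge0 ?(ltW W0).
Qed.

(** Where |gam'| <= 1/2 the map t - gam t is bi-Lipschitz with constants 1/2 and 3/2. *)
Lemma regime_small : exists2 C : R, 0 < C &
  forall u v m s W : R, curve_piece u v m s (2^-1) W ->
    bilin_bounded a b c gam w `[u, v]
      (C * (W * m `^ (1 - sg) * s `^ (- pos (b - c)))).
Proof.
have h0 : 0 < (1 - 2^-1 : R) by lra.
have h1 : 0 <= (1 + 2^-1 : R) by lra.
have [C C0 H] := regime_transversal h0 h1.
exists C => // u v m s W P; apply: (H _ _ _ _ _ _ P) => x y Jx Jy.
have [_ _ _ _ /(_ _ _ Jx Jy)[_ /andP[_ Q]]] := P.
by rewrite h_upper// h_lower.
Qed.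

(** Near the tangency the derivative of gam is bounded above and below and only the
    expansion d of t - gam t degenerates. *)
Lemma regime_singular (s rho : R) : 0 < s -> 0 < rho -> exists2 C : R, 0 < C &
  forall u v m d W : R, curve_piece u v m s rho W -> 0 < d ->
    (forall x y, `[u, v]%classic x -> `[u, v]%classic y ->
      d * `|x - y| <= `|x - gam x - (y - gam y)|) ->
    bilin_bounded a b c gam w `[u, v]
      (C * (W * m `^ (1 - sg) * d `^ (- pos (a + b - 1)))).
Proof.
move=> s0 rho0; pose B := 1 + rho.
have B0 : 0 <= B by rewrite addr_ge0// ltW.
exists (s `^ (- pos (b - c)) + (4 * (B + 1)) `^ (c - 1)).
  by rewrite ltr_wpDr ?powR_ge0// powR_gt0.
move=> u v m d W [m0 uvm _ W0 H] d0 h1.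
have H1 t : `[u, v]%classic t -> w t <= W by move=> Jt; have [] := H _ _ Jt Jt.
have H2 x y : `[u, v]%classic x -> `[u, v]%classic y -> s * `|x - y| <= `|gam x - gam y|.
  by move=> Jx Jy; have [_ /andP[]] := H _ _ Jx Jy.
have h2 x y : `[u, v]%classic x -> `[u, v]%classic y ->
    `|x - gam x - (y - gam y)| <= B * `|x - y|.
  by move=> Jx Jy; apply: h_upper; have [_ /andP[]] := H _ _ Jx Jy.
have [c1|c1] := ltP c 1.
  have := @piece_interval_lt1 R a b c a0 b0 c0 gam mgam w mw w0 u v m s d W m0 uvm s0 d0 W0
    H1 H2 h1 (sg - pos (a + b - 1) - pos (b - c)) (pos (b - c)) c1.
  rewrite subrK => /(_ erefl (slack1 c1) (lexx _)).
  apply: bilin_bounded_le => //; first by rewrite !mulr_ge0 ?powR_ge0 ?(ltW W0).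
  rewrite [leRHS]mulrDl [leLHS](_ : _ = s `^ (- pos (b - c)) * (W * m `^ (1 - sg) * d `^ (- pos (a + b - 1)))); last by ring.
  by rewrite lerDl !mulr_ge0 ?powR_ge0 ?(ltW W0).
have := @piece_interval_ge1 R a b c a0 a1 b0 b1 c0 cab gam mgam w mw w0 u v m d B W m0 uvm
  d0 B0 W0 H1 h1 h2 c1.
apply: bilin_bounded_le => //; first by rewrite !mulr_ge0 ?powR_ge0 ?(ltW W0).
rewrite (_ : pos (a + b - 1) = a + b - 1); last by apply/max_idPr; move: cab c1; lra.
rewrite [leRHS]mulrDl [leLHS](_ : _ = (4 * (B + 1)) `^ (c - 1) * (W * m `^ (1 - sg) * d `^ (- (a + b - 1)))); last by ring.
by rewrite lerDr !mulr_ge0 ?powR_ge0 ?(ltW W0).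
Qed.

Let slack2 : c < 1 -> pos (b - c) <= sg - pos (a + b - 1) - pos (a - c).
Proof.
move=> c1; rewrite ge_max; case: (leP 0 (a + b - 1)) => H1; case: (leP 0 (a - c)) => H2;
  apply/andP; split; move: c1 H1 H2 a0 a1 b0 b1 c0 cab sg1; lra.
Qed.

(** Where the curve is steep t - gam t expands like s / 2, so both the products fg and hg
    gain powers of s; the coefficient of hf, which gains nothing, is made as small as possible. *)
Lemma regime_large (rho : R) : 0 < rho -> exists2 C : R, 0 < C &
  forall u v m s W : R, curve_piece u v m s (rho * s) W -> 2 <= s ->
    bilin_bounded a b c gam w `[u, v]
      (C * (W * m `^ (1 - sg) * s `^ (- (sg - pos (a - c))))).
Proof.
move=> rho0.
exists (2^-1 `^ (- pos (a + b - 1)) * (1 + (4 * (1 + rho)) `^ (c - 1))).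
  by rewrite mulr_gt0 ?powR_gt0// ltr_wpDr ?powR_ge0.
move=> u v m s W [m0 uvm s0 W0 H] s2.
have H1 t : `[u, v]%classic t -> w t <= W by move=> Jt; have [] := H _ _ Jt Jt.
have H2 x y : `[u, v]%classic x -> `[u, v]%classic y -> s * `|x - y| <= `|gam x - gam y|.
  by move=> Jx Jy; have [_ /andP[]] := H _ _ Jx Jy.
pose d := 2^-1 * s.
have d0 : 0 < d by rewrite mulr_gt0.
have h1 x y : `[u, v]%classic x -> `[u, v]%classic y ->
    d * `|x - y| <= `|x - gam x - (y - gam y)|.
  move=> Jx Jy; apply: le_trans (h_lower' (H2 _ _ Jx Jy)).
  by rewrite ler_wpM2r// /d; move: s2; lra.
have dE x : d `^ x = 2^-1 `^ x * s `^ x by rewrite powRM// ltW.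
have [c1|c1] := ltP c 1.
  have := @piece_interval_lt1 R a b c a0 b0 c0 gam mgam w mw w0 u v m s d W m0 uvm s0 d0 W0
    H1 H2 h1 (pos (a - c)) (sg - pos (a + b - 1) - pos (a - c)) c1.
  rewrite addrC subrK => /(_ erefl (lexx _) (slack2 c1)).
  apply: bilin_bounded_le => //; first by rewrite !mulr_ge0 ?powR_ge0 ?(ltW W0).
  have -> : s `^ (- (sg - pos (a - c))) = s `^ (- pos (a + b - 1)) *
      s `^ (- (sg - pos (a + b - 1) - pos (a - c))).
    by rewrite -powRD ?(gt_eqF s0) ?implybT//; congr (_ `^ _); ring.
  rewrite dE [leRHS](_ : _ = W * (2^-1 `^ (- pos (a + b - 1)) * s `^ (- pos (a + b - 1)) *
     s `^ (- (sg - pos (a + b - 1) - pos (a - c))) * m `^ (1 - sg)) *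
    (1 + (4 * (1 + rho)) `^ (c - 1))); last by ring.
  by rewrite ler_peMr ?lerDl ?powR_ge0// !mulr_ge0 ?powR_ge0 ?(ltW W0).
pose B := 1 + rho * s.
have B0 : 0 <= B by rewrite addr_ge0// mulr_ge0// ltW.
have h2 x y : `[u, v]%classic x -> `[u, v]%classic y ->
    `|x - gam x - (y - gam y)| <= B * `|x - y|.
  by move=> Jx Jy; apply: h_upper; have [_ /andP[]] := H _ _ Jx Jy.
have := @piece_interval_ge1 R a b c a0 a1 b0 b1 c0 cab gam mgam w mw w0 u v m d B W m0 uvm
  d0 B0 W0 H1 h1 h2 c1.
apply: bilin_bounded_le => //; first by rewrite !mulr_ge0 ?powR_ge0 ?(ltW W0).
rewrite (_ : pos (a - c) = 0); last by apply/max_idPl; move: a1 c1; lra.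
rewrite (_ : pos (a + b - 1) = a + b - 1); last by apply/max_idPr; move: cab c1; lra.
have -> : s `^ (- (sg - 0)) = s `^ (- (a + b - 1)) * s `^ (c - 1).
  by rewrite -powRD ?(gt_eqF s0) ?implybT//; congr (_ `^ _); ring.
rewrite dE [leRHS](_ : _ = W * (2^-1 `^ (- (a + b - 1)) * s `^ (- (a + b - 1)) * m `^ (1 - sg)) *
    ((1 + (4 * (1 + rho)) `^ (c - 1)) * s `^ (c - 1))); last by ring.
rewrite ler_wpM2l ?mulr_ge0 ?powR_ge0 ?(ltW W0)//.
apply: (@le_trans _ _ ((4 * (1 + rho)) `^ (c - 1) * s `^ (c - 1))); last first.
  by rewrite ler_wpM2r ?powR_ge0// lerDr.
have r1 : 0 <= 1 + rho by rewrite addr_ge0// ltW.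
rewrite -powRM ?mulr_ge0 ?(ltW s0)// ge0_ler_powR ?nnegrE ?subr_ge0 ?mulr_ge0 ?addr_ge0 ?(ltW s0)//.
  by rewrite mulr_ge0 ?ltW.
  exact: ltW.
rewrite -mulrA ler_wpM2l// /B mulrDl mul1r; move: s2; lra.
Qed.

End Regimes.

(** * Summation over pieces *)

Lemma geometric_nneseries_le (R : realType) (z : R) : 0 <= z -> z < 1 ->
  (\sum_(n <oo) (z ^+ n)%:E <= ((1 - z)^-1)%:E)%E.
Proof.
move=> z0 z1; apply: lime_le.
  by apply: is_cvg_nneseries => n _ _; rewrite lee_fin exprn_ge0.
apply: nearW => n; rewrite sumEFin lee_fin.
have := congr1 (fun u => u n) (geometric_seriesE 1 (negbT (lt_eqF z1))).
rewrite /series/= /geometric/=; under eq_bigr do rewrite mul1r.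
move=> ->; rewrite mul1r ler_piMl ?invr_ge0 ?subr_ge0 ?(ltW z1)//.
by rewrite gerBl exprn_ge0.
Qed.

Lemma nneseries_term_le (R : realType) (u : nat -> \bar R) n : (forall k, 0 <= u k)%E ->
  (u n <= \sum_(k <oo) u k)%E.
Proof.
move=> u0; rewrite (@nneseriesD1 R u n)// leeDl//.
by apply: nneseries_ge0 => k _ _.
Qed.

(** Serves for r >= 1 and r < 1 alike. Call Z the series on the right: every term of it is
    at most Z, that is y n <= eta^n Z^(1/r), and these bounds have a geometric sum. *)
Lemma poweR_nneseries_le (R : realType) (r eta : R) (y : nat -> \bar R) :
  0 < r -> 0 < eta -> eta < 1 -> (forall n, 0 <= y n)%E ->
  ((\sum_(n <oo) y n) `^ r <=
   ((1 - eta)^-1 `^ r)%:E * \sum_(n <oo) ((eta ^- n)%:E * y n) `^ r)%E.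
Proof.
move=> r0 e0 e1 y0.
set Z := (\sum_(n <oo) ((eta ^- n)%:E * y n) `^ r)%E.
have t0 n : (0 <= ((eta ^- n)%:E * y n) `^ r)%E by exact: poweR_ge0.
have Z0 : (0 <= Z)%E by apply: nneseries_ge0.
have A0 : 0 < (1 - eta)^-1 by rewrite invr_gt0 subr_gt0.
have yn n : (y n <= (eta ^+ n)%:E * Z `^ r^-1)%E.
  have en : 0 < eta ^+ n by rewrite exprn_gt0.
  rewrite -lee_pdivrMl//.
  have h : (0 <= (eta ^- n)%:E * y n)%E by rewrite mule_ge0// lee_fin invr_ge0 ltW.
  have -> : ((eta ^- n)%:E * y n = (((eta ^- n)%:E * y n) `^ r) `^ r^-1)%E.
    by rewrite -poweRrM mulfV ?gt_eqF// poweRe1.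
  apply: gt0_ler_poweR; rewrite ?invr_ge0 ?(ltW r0)//.
  - by rewrite in_itv/= leey t0.
  - by rewrite in_itv/= leey Z0.
  exact: nneseries_term_le.
have Zr0 : (0 <= Z `^ r^-1)%E by exact: poweR_ge0.
have : (\sum_(n <oo) y n <= ((1 - eta)^-1)%:E * Z `^ r^-1)%E.
  have [Zoo|Zfin] := eqVneq Z +oo%E.
    by rewrite Zoo poweRyr ?invr_eq0 ?gt_eqF// gt0_muley ?lte_fin// leey.
  have Zf : (Z `^ r^-1 \is a fin_num)%E.
    by apply: fin_num_poweR; rewrite ge0_fin_numE// ltey.
  apply: (@le_trans _ _ (\sum_(n <oo) ((fine (Z `^ r^-1))%:E * (eta ^+ n)%:E))%E).
    by apply: lee_nneseries => // n _; rewrite fineK// muleC.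
  rewrite nneseriesZl; last by move=> n _; rewrite lee_fin exprn_ge0// ltW.
  rewrite fineK// muleC lee_wpmul2r//; apply: geometric_nneseries_le => //.
  exact: ltW.
move=> H.
have -> : (((1 - eta)^-1 `^ r)%:E * Z = (((1 - eta)^-1)%:E * Z `^ r^-1) `^ r)%E.
  rewrite poweRM//; last by rewrite lee_fin ltW.
  by rewrite poweR_EFin -poweRrM mulVf ?gt_eqF// poweRe1.
apply: gt0_ler_poweR => //; rewrite ?(ltW r0)// in_itv/= leey andbT.
- by apply: nneseries_ge0.
- by rewrite mule_ge0// lee_fin ltW.
Qed.

Section Family.
Context {R : realType}.
Local Notation mu := (@lebesgue_measure R).
Variables (a b c : R) (c0 : 0 < c).
Variables (gam : R -> R) (mgam : measurable_fun [set: R] gam).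
Variables (w : R -> R) (mw : measurable_fun [set: R] w) (w0 : forall t, 0 <= w t).

Lemma measurable_bilin_section (F G : R -> R) x (D : set R) :
  measurable_fun [set: R] F -> measurable_fun [set: R] G ->
  measurable_fun D (fun t => (F (x - t)%R `^ a * G (x - gam t)%R `^ b * w t)%:E).
Proof.
move=> mF mG.
exact: (measurable_section x (measurable_bilin_integrandw a b mgam mw mF mG)).
Qed.

Lemma bilin_bigcup_le (J : nat -> set R) (D : set R) (F G : R -> R) x :
  (forall n, measurable (J n)) -> measurable D -> D `<=` \bigcup_n J n ->
  measurable_fun [set: R] F -> measurable_fun [set: R] G ->
  (bilin a b gam w D F G x <= \sum_(n <oo) bilin a b gam w (J n) F G x)%E.
Proof.
move=> mJ mD DJ mF mG; rewrite /bilin.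
have pos t : (0 <= (F (x - t)%R `^ a * G (x - gam t)%R `^ b * w t)%:E)%E.
  by rewrite lee_fin !mulr_ge0 ?powR_ge0.
have mU : measurable (\bigcup_n J n) by exact: bigcup_measurable.
have mS n : measurable (seqDU J n).
  by apply: measurableD => //; exact: bigsetU_measurable.
apply: (@le_trans _ _ (\int[mu]_(t in \bigcup_n J n)
    (F (x - t)%R `^ a * G (x - gam t)%R `^ b * w t)%:E)%E).
  by apply: ge0_subset_integral => //; exact: (measurable_bilin_section x mF mG).
rewrite seqDU_bigcup_eq ge0_integral_bigcup//; last exact: (measurable_bilin_section x mF mG).
apply: lee_nneseries => [n _ _|n _].
  by apply: integral_ge0 => t _; exact: pos.
apply: ge0_subset_integral => //; [exact: mS|exact: mJ|exact: (measurable_bilin_section x mF mG)|].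
exact: subset_seqDU.
Qed.

(** A geometric decay of rate rho pays for the weights eta^(-n) of [poweR_nneseries_le] as
    soon as rho < eta < 1. *)
Lemma bilin_bounded_family (J : nat -> set R) (D : set R) (C rho : R) :
  (forall n, measurable (J n)) -> measurable D -> D `<=` \bigcup_n J n ->
  0 < C -> 0 < rho -> rho < 1 ->
  (forall n, bilin_bounded a b c gam w (J n) (C * rho ^+ n)) ->
  exists2 K, 0 < K & bilin_bounded a b c gam w D K.
Proof.
move=> mJ mD DJ C0 rho0 rho1 H.
set r := c^-1; have r0 : 0 < r by rewrite invr_gt0.
pose eta := (1 + rho) / 2.
have e0 : 0 < eta by rewrite divr_gt0// addr_gt0.
have e1 : eta < 1 by rewrite ltr_pdivrMr// mul1r; move: rho1; lra.
have re : rho < eta by rewrite ltr_pdivlMr//; move: rho1; lra.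
pose z := (rho / eta) `^ r.
have q0 : 0 < rho / eta by rewrite divr_gt0.
have z0 : 0 <= z by exact: powR_ge0.
have z1 : z < 1.
  rewrite /z [ltRHS](_ : _ = 1 `^ r); last by rewrite powR1.
  rewrite gt0_ltr_powR ?nnegrE ?(ltW q0)//.
  by rewrite ltr_pdivrMr// mul1r.
pose A := (1 - eta)^-1 `^ r * (C `^ r * (1 - z)^-1).
have A0 : 0 < A.
  by rewrite !mulr_gt0 ?powR_gt0 ?invr_gt0 ?subr_gt0.
exists (A `^ c); first exact: powR_gt0.
move=> F G LF LG; rewrite -powRrM mulfV ?gt_eqF// powRr1 ?(ltW A0)//.
have [mF [F0 F1]] := LF. have [mG [G0 G1]] := LG.
have mB n : measurable_fun [set: R] (bilin a b gam w (J n) F G).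
  by apply: measurable_bilin.
have B0 n x : (0 <= bilin a b gam w (J n) F G x)%E by exact: bilin_ge0.
have en n : 0 < eta ^- n by rewrite invr_gt0 exprn_gt0.
have eB n x : (0 <= (eta ^- n)%:E * bilin a b gam w (J n) F G x)%E.
  by rewrite mule_ge0// lee_fin ltW.
have meB n : measurable_fun [set: R] (fun x => ((eta ^- n)%:E * bilin a b gam w (J n) F G x) `^ r)%E.
  by apply: (measurableT_comp (measurable_poweR _)); exact: measurable_funeM.
have mSum : measurable_fun [set: R]
    (fun x => \sum_(n <oo) ((eta ^- n)%:E * bilin a b gam w (J n) F G x) `^ r)%E.
  by apply: ge0_emeasurable_sum => // n x _ _; exact: poweR_ge0.
have mD' : measurable_fun [set: R] (bilin a b gam w D F G) by exact: measurable_bilin.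
apply: (@le_trans _ _ (\int[mu]_x (((1 - eta)^-1 `^ r)%:E *
    \sum_(n <oo) ((eta ^- n)%:E * bilin a b gam w (J n) F G x) `^ r))%E).
  apply: ge0_le_integral => //.
  - by move=> x _; exact: poweR_ge0.
  - exact: (measurableT_comp (measurable_poweR _)).
  - exact: measurable_funeM.
  move=> x _; apply: le_trans (poweR_nneseries_le r0 e0 e1 (B0^~ x)).
  apply: gt0_ler_poweR; rewrite ?(ltW r0)//.
  - by rewrite in_itv/= leey bilin_ge0.
  - by rewrite in_itv/= leey andbT; apply: nneseries_ge0.
  exact: bilin_bigcup_le.
rewrite ge0_integralZl//; last 2 first.
- by move=> x _; apply: nneseries_ge0 => n _ _; exact: poweR_ge0.
- by rewrite lee_fin powR_ge0.
rewrite integral_nneseries//; last by move=> n x _; exact: poweR_ge0.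
rewrite /A EFinM lee_wpmul2l ?lee_fin ?powR_ge0//.
apply: (@le_trans _ _ (\sum_(n <oo) ((C `^ r)%:E * (z ^+ n)%:E))%E); last first.
  rewrite nneseriesZl; last by move=> n _; rewrite lee_fin exprn_ge0.
  by rewrite EFinM lee_wpmul2l ?lee_fin ?powR_ge0// geometric_nneseries_le.
apply: lee_nneseries => [n _ _|n _].
  by apply: integral_ge0 => x _; exact: poweR_ge0.
have enr : (0 <= ((eta ^- n) `^ r)%:E)%E by rewrite lee_fin powR_ge0.
have E x : (((eta ^- n)%:E * bilin a b gam w (J n) F G x) `^ r =
    ((eta ^- n) `^ r)%:E * (bilin a b gam w (J n) F G x) `^ r)%E.
  by rewrite poweRM// lee_fin (ltW (en n)).
under eq_integral do rewrite E.
rewrite ge0_integralZl//; last 2 first.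
- exact: (measurableT_comp (measurable_poweR _) (mB n)).
- by move=> x _; exact: poweR_ge0.
apply: le_trans (lee_wpmul2l enr (H n F G LF LG)) _.
rewrite -!EFinM lee_fin powRM ?exprn_ge0 ?(ltW C0) ?(ltW rho0)//.
have -> : z ^+ n = (eta ^- n * rho ^+ n) `^ r.
  rewrite -powR_mulrn ?powR_ge0// /z -powRrM (mulrC r) powRrM powR_mulrn ?(ltW q0)//.
  by rewrite expr_div_n [_ / _]mulrC.
by rewrite mulrCA -powRM ?exprn_ge0 ?(ltW (en n)) ?(ltW rho0).
Qed.

Lemma bilin_bounded_set0 K : 0 <= K -> bilin_bounded a b c gam w set0 K.
Proof.
move=> K0 F G LF LG; rewrite integral0_eq ?lee_fin ?powR_ge0// => x _.
by rewrite /bilin integral_set0 poweR0r// invr_eq0 gt_eqF.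
Qed.

Lemma bilin_bounded_union (D1 D2 D : set R) (K1 K2 : R) :
  measurable D1 -> measurable D2 -> measurable D -> D `<=` D1 `|` D2 ->
  0 < K1 -> 0 < K2 ->
  bilin_bounded a b c gam w D1 K1 -> bilin_bounded a b c gam w D2 K2 ->
  exists2 K, 0 < K & bilin_bounded a b c gam w D K.
Proof.
move=> mD1 mD2 mD D12 K10 K20 H1 H2.
pose J n := if n is n'.+1 then if n' is 0 then D2 else set0 else D1.
apply: (@bilin_bounded_family J D (2 * (K1 + K2)) 2^-1) => //.
- by move=> [|[|n]]; [exact: mD1|exact: mD2|exact: measurable0].
- by move=> x /D12[?|?]; [exists 0%N|exists 1%N].
- by rewrite mulr_gt0// addr_gt0.
- by rewrite invf_lt1//; lra.
move=> [|[|n]] /=.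
- by apply: bilin_bounded_le H1 => //; rewrite ?(ltW K10)// expr0; move: K10 K20; lra.
- by apply: bilin_bounded_le H2 => //; rewrite ?(ltW K20)// expr1; move: K10 K20; lra.
apply: bilin_bounded_set0; have K1' := ltW K10; have K2' := ltW K20.
by rewrite mulr_ge0 ?exprn_ge0// mulr_ge0// addr_ge0.
Qed.

End Family.

(** * Exponents in the interior of the hull *)

Section Hull.
Local Open Scope convex_scope.
Context {R : realType}.
Implicit Types (A : set (R * R * R)).

Definition affine_form (k0 k1 k2 k3 : R) (P : R * R * R) := k0 + k1 * P.1.1 + k2 * P.1.2 + k3 * P.2.

Lemma affine_hull A k0 k1 k2 k3 :
  (forall P, A P -> affine_form k0 k1 k2 k3 P <= 0) ->
  forall P, convex_hull A P -> affine_form k0 k1 k2 k3 P <= 0.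
Proof.
move=> hA; apply: smallest_sub => //= x y l; rewrite !inE /= => hx hy.
have -> : affine_form k0 k1 k2 k3 (x <| l |> y) =
  l%:num * affine_form k0 k1 k2 k3 x + (1 - l%:num) * affine_form k0 k1 k2 k3 y.
  transitivity (affine_form k0 k1 k2 k3 (l%:num * x.1.1 + (1 - l%:num) * y.1.1,
    l%:num * x.1.2 + (1 - l%:num) * y.1.2, l%:num * x.2 + (1 - l%:num) * y.2)).
    by [].
  by rewrite /affine_form/=; ring.
have l0 : 0 <= l%:num by [].
have l1 : 0 <= 1 - l%:num by rewrite subr_ge0.
by rewrite -oppr_ge0 opprD addr_ge0// oppr_ge0 mulr_ge0_le0.
Qed.

(** Otherwise a small step along the gradient (k1, k2, k3) would stay in the hull and make
    the form positive. *)
Lemma affine_interior_hull A k0 k1 k2 k3 : 0 < k1 ^+ 2 + k2 ^+ 2 + k3 ^+ 2 ->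
  (forall P, A P -> affine_form k0 k1 k2 k3 P <= 0) ->
  forall P, interior (convex_hull A) P -> affine_form k0 k1 k2 k3 P < 0.
Proof.
move=> k0' hA [[x y] z] /nbhs_ballP[e /= e0 he].
pose M := `|k1| + `|k2| + `|k3| + 1.
have M0 : 0 < M by rewrite ltr_wpDl// !addr_ge0.
pose d := e / M.
have d0 : 0 < d by rewrite divr_gt0.
have small k : `|k| < M -> `|d * k| < e.
  by move=> kM; rewrite normrM gtr0_norm// /d mulrAC ltr_pdivrMr// ltr_pM2l.
have := he (x + d * k1, y + d * k2, z + d * k3).
have b1 : `|k1| < M by rewrite /M; have := normr_ge0 k2; have := normr_ge0 k3; lra.
have b2 : `|k2| < M by rewrite /M; have := normr_ge0 k1; have := normr_ge0 k3; lra.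
have b3 : `|k3| < M by rewrite /M; have := normr_ge0 k2; have := normr_ge0 k1; lra.
have inball : ball ((x, y, z) : R * R * R) e (x + d * k1, y + d * k2, z + d * k3).
  by split; [split|]; rewrite /ball/= opprD addrA subrr sub0r normrN small.
move=> /(_ inball)/(affine_hull hA); apply: lt_le_trans.
rewrite /affine_form/= -subr_gt0.
rewrite [ltRHS](_ : _ = d * (k1 ^+ 2 + k2 ^+ 2 + k3 ^+ 2)); last by ring.
exact: mulr_gt0.
Qed.

End Hull.

Section Exponents.
Context {R : realType}.
Variables (alpha : R) (gamma : R -> R).
Hypotheses (al0 : 0 < alpha) (al1 : alpha < 1).
Local Notation w0 := (omega0_2 gamma).
Local Notation w1 := (omegaoo_1 gamma).
Local Notation w2 := (omegaoo_2 gamma).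
Hypotheses (w0_gt1 : 1 < w0) (w01 : w0 <= w1) (w12 : w1 <= w2).
Hypothesis alpha_lower : (w2 - w1) / (w2 - 1) < alpha / (1 - alpha).
Hypothesis alpha_upper : alpha / (1 - alpha) < w2 / (w2 - w1 + 1).

Let e := (w2 - alpha) / (2 * w2 - w1).

(** Replaces the indices by the few inequalities that the checks at the eight points
    rest on. Here u1 = alpha / omega_oo1, u0 = alpha / omega_02, and e is the coordinate
    shared by the last two points. The upper condition on alpha forces omega_oo1 > 2 alpha,
    whence 1/2 <= e and alpha <= omega_oo1 (1 - e); the lower one amounts to alpha + e > 1. *)
Lemma exponent_points_affine (k0 k1 k2 k3 : R) :
  (forall u1 u0 e : R, u1 * w1 = alpha -> u0 * w0 = alpha -> 0 < u1 -> u1 <= u0 -> u0 < 1 ->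
     1 <= 2 * e -> e < 1 -> alpha + e >= 1 -> alpha <= w1 * (1 - e) ->
   [/\ affine_form k0 k1 k2 k3 (alpha, 0, 0) <= 0, affine_form k0 k1 k2 k3 (1, 0, 1 - alpha) <= 0,
      affine_form k0 k1 k2 k3 (0, u1, 0) <= 0 & affine_form k0 k1 k2 k3 (0, u0, 0) <= 0] /\
    [/\ affine_form k0 k1 k2 k3 (0, 1, 1 - u1) <= 0, affine_form k0 k1 k2 k3 (0, 1, 1 - u0) <= 0,
      affine_form k0 k1 k2 k3 (1, e, 2 * e) <= 0 & affine_form k0 k1 k2 k3 (e, 1, 2 * e) <= 0]) ->
  forall P, exponent_points alpha gamma P -> affine_form k0 k1 k2 k3 P <= 0.
Proof.
move=> H.
have w1_gt1 : 1 < w1 by exact: lt_le_trans w0_gt1 w01.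
have w2_gt1 : 1 < w2 by exact: lt_le_trans w1_gt1 w12.
have al' : 0 < 1 - alpha by rewrite subr_gt0.
have w2' : 0 < w2 - 1 by rewrite subr_gt0.
have lower : (w2 - w1) * (1 - alpha) < alpha * (w2 - 1).
  by have L := alpha_lower; rewrite ltr_pdivrMr// mulrAC (ltr_pdivlMr _ _ al') in L.
have w21 : 0 < w2 - w1 + 1 by move: w12; lra.
have upper : alpha * (w2 - w1 + 1) < w2 * (1 - alpha).
  by have L := alpha_upper; rewrite (ltr_pdivrMr _ _ al') mulrAC (ltr_pdivlMr _ _ w21) in L.
have D0 : 0 < 2 * w2 - w1 by move: w12 w2_gt1; lra.
have eD : e * (2 * w2 - w1) = w2 - alpha by rewrite /e divfK// gt_eqF.
have w1al : 2 * alpha < w1.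
  rewrite ltNge; apply/negP => h.
  have h1 : 0 < 2 * alpha - 1 by lra.
  have h2 : 0 <= (2 * alpha - 1) * (w2 - w1) by apply: mulr_ge0; move: al0 al1 w0_gt1 w01 w12; lra.
  have h3 : alpha < (1 - alpha) * w1 by lra.
  have h4 : (1 - alpha) * w1 <= (1 - alpha) * (2 * alpha) by rewrite ler_wpM2l// ltW.
  have h5 : 0 < alpha * (2 * alpha - 1) by rewrite mulr_gt0.
  lra.
have e2 : 1 <= 2 * e.
  rewrite -(ler_pM2r D0) mul1r [leRHS](_ : _ = 2 * (e * (2 * w2 - w1))); last by ring.
  by rewrite eD; move: w1al; lra.
have e1 : e < 1 by rewrite -(ltr_pM2r D0) eD; move: w12 al0; lra.
have ea : alpha + e >= 1.
  by rewrite -(ler_pM2r D0) [leRHS]mulrDl eD; move: lower; lra.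
have we : alpha <= w1 * (1 - e).
  rewrite -(ler_pM2r D0) [leRHS](_ : _ = w1 * ((2 * w2 - w1) - e * (2 * w2 - w1))); last by ring.
  rewrite eD.
  have : 0 <= (w1 - 2 * alpha) * (w2 - w1) by apply: mulr_ge0; move: al0 al1 w0_gt1 w01 w12; lra.
  by lra.
have w1p : 0 < w1 by apply: lt_trans w1_gt1.
have w0p : 0 < w0 by apply: lt_trans w0_gt1.
have u1E : alpha / w1 * w1 = alpha by rewrite divfK ?gt_eqF.
have u0E : alpha / w0 * w0 = alpha by rewrite divfK ?gt_eqF.
have u10 : 0 < alpha / w1 by rewrite divr_gt0.
have u01 : alpha / w1 <= alpha / w0 by rewrite ler_pM2l// lef_pV2 ?posrE.
have u0lt : alpha / w0 < 1 by rewrite ltr_pdivrMr// mul1r (lt_trans al1).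
have [[h1 h2 h3 h4] [h5 h6 h7 h8]] := H _ _ e u1E u0E u10 u01 u0lt e2 e1 ea we.
have eE : 2 * (w2 - alpha) / (2 * w2 - w1) = 2 * e by rewrite /e mulrA.
rewrite /exponent_points -/e eE => P.
by move=> [[[[[[[->|->]|->]|->]|->]|->]|->]|->].
Qed.

(** The first two are needed on each piece; the others make the pieces summable, the third
    near the tangency, the fourth and fifth at infinity, the last two at zero. Each of
    the seven says that an affine form is negative, which is nonpositive at the eight
    points. *)
Lemma exponents_interior (x y z : R) :
  interior (convex_hull (exponent_points alpha gamma)) (x, y, z) ->
  [/\ x < 1, y < 1, 2 * x + 2 * y - z < 2 & alpha - x - w1 * y + z < 0] /\
  [/\ alpha - w1 * (x + y - z) < 0, 0 < alpha - x + w0 * (z - y) &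
     0 < alpha - (x + y - z)].
Proof.
move=> hP.
have w1_gt1 : 1 < w1 by exact: lt_le_trans w0_gt1 w01.
have key (k0 k1 k2 k3 : R) : 0 < k1 ^+ 2 + k2 ^+ 2 + k3 ^+ 2 -> _ ->
  k0 + k1 * x + k2 * y + k3 * z < 0 :=
  fun h H => affine_interior_hull h (@exponent_points_affine k0 k1 k2 k3 H) hP.
have sq (a b c : R) : a != 0 -> 0 < a ^+ 2 + b ^+ 2 + c ^+ 2.
  by move=> a0; rewrite -addrA ltr_pwDl ?addr_ge0 ?sqr_ge0// lt_def sqrf_eq0 a0 sqr_ge0.
have K1 : -1 + 1 * x + 0 * y + 0 * z < 0.
  apply: key; first by apply: sq; rewrite oner_eq0.
  move=> u1 u0 f U1 U0 u1p u10 u0l f2 f1 fa wf; rewrite /affine_form/=.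
  by split; split; move: al0 al1 f1; lra.
have K2 : -1 + 0 * x + 1 * y + 0 * z < 0.
  apply: key; first by rewrite addrAC addrC addrA; apply: sq; rewrite oner_eq0.
  move=> u1 u0 f U1 U0 u1p u10 u0l f2 f1 fa wf; rewrite /affine_form/=.
  by split; split; move: u10 u0l f1; lra.
have K3 : -2 + 2 * x + 2 * y + -1 * z < 0.
  apply: key; first by apply: sq; rewrite pnatr_eq0.
  move=> u1 u0 f U1 U0 u1p u10 u0l f2 f1 fa wf; rewrite /affine_form/=.
  by split; split; move: al0 al1 u10 u0l f1; lra.
have K4 : alpha + -1 * x + - w1 * y + 1 * z < 0.
  apply: key; first by apply: sq; rewrite oppr_eq0 oner_eq0.
  move=> u1 u0 f U1 U0 u1p u10 u0l f2 f1 fa wf; rewrite /affine_form/=.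
  have u1l : u1 < 1 by lra.
  have h1 : 0 <= u0 * (w1 - w0) by apply: mulr_ge0; move: al0 al1 w0_gt1 w01 w12; lra.
  have h2 : 0 <= (1 - u1) * (w1 - 1) by apply: mulr_ge0; move: al0 al1 w0_gt1 w01 w12; lra.
  have h3 : 0 <= (2 * f - 1) * (w1 - 1) by apply: mulr_ge0; move: al0 al1 w0_gt1 w01 w12; lra.
  have h4 : 0 <= f * (w1 - 1) by apply: mulr_ge0; move: al0 al1 w0_gt1 w01 w12; lra.
  by split; split; lra.
have K5 : alpha + - w1 * x + - w1 * y + w1 * z < 0.
  apply: key; first by apply: sq; rewrite oppr_eq0 gt_eqF//; lra.
  move=> u1 u0 f U1 U0 u1p u10 u0l f2 f1 fa wf; rewrite /affine_form/=.
  have h1 : 0 <= u0 * (w1 - w0) by apply: mulr_ge0; move: al0 al1 w0_gt1 w01 w12; lra.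
  have h2 : 0 <= alpha * (w1 - 1) by apply: mulr_ge0; move: al0 al1 w0_gt1 w01 w12; lra.
  by split; split; lra.
have K6 : - alpha + 1 * x + w0 * y + - w0 * z < 0.
  apply: key; first by apply: sq; rewrite oner_eq0.
  move=> u1 u0 f U1 U0 u1p u10 u0l f2 f1 fa wf; rewrite /affine_form/=.
  have h1 : 0 <= u1 * (w1 - w0) by apply: mulr_ge0; move: al0 al1 w0_gt1 w01 w12; lra.
  have h2 : 0 <= (w0 - 1) * (1 - alpha) by apply: mulr_ge0; move: al0 al1 w0_gt1 w01 w12; lra.
  have h3 : 0 <= (w0 - 1) * (2 * f - 1) by apply: mulr_ge0; move: al0 al1 w0_gt1 w01 w12; lra.
  have h4 : 0 <= (w0 - 1) * f by apply: mulr_ge0; move: al0 al1 w0_gt1 w01 w12; lra.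
  by split; split; lra.
have K7 : - alpha + 1 * x + 1 * y + -1 * z < 0.
  apply: key; first by apply: sq; rewrite oner_eq0.
  move=> u1 u0 f U1 U0 u1p u10 u0l f2 f1 fa wf; rewrite /affine_form/=.
  have h1 : 0 <= u1 * (w1 - 1) by apply: mulr_ge0; move: al0 al1 w0_gt1 w01 w12; lra.
  have h2 : 0 <= u0 * (w0 - 1) by apply: mulr_ge0; move: al0 al1 w0_gt1 w01 w12; lra.
  by split; split; lra.
by split; split; lra.
Qed.

End Exponents.

(** * Indices and growth of the curve *)

Section Limf.
Context {R : realType}.
Variables (F : set (set R)) (FF : ProperFilter F).
Variables (g : R -> R) (M : R) (gM : F [set t | `|g t| <= M]).
Let f t : \bar R := (g t)%:E.

Let low t : `|g t| <= M -> ((- M)%:E <= f t)%E.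
Proof. by rewrite ler_norml lee_fin => /andP[]. Qed.
Let upp t : `|g t| <= M -> (f t <= M%:E)%E.
Proof. by rewrite ler_norml lee_fin => /andP[]. Qed.

Lemma limf_einf_fin : limf_einf f F \is a fin_num.
Proof.
rewrite limf_einfE fin_numElt; apply/andP; split.
  apply: (@lt_le_trans _ _ (- M)%:E); first exact: ltNyr.
  apply: le_ereal_sup_tmp.
  exists (ereal_inf (f @` [set t | `|g t| <= M])); first by exists [set t | `|g t| <= M].
  by apply: le_ereal_inf_tmp => _ [t /= tM <-]; exact: low.
apply: (@le_lt_trans _ _ M%:E); last exact: ltry.
apply: ge_ereal_sup => _ [V FV <-].
have [t [Vt tM]] := filter_ex (filterI FV gM).
by apply: le_trans (upp tM); apply: ereal_inf_lbound; exists t.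
Qed.

Lemma limf_einf_near (v : R) : v < fine (limf_einf f F) -> F [set t | v < g t].
Proof.
rewrite -lte_fin fineK ?limf_einf_fin// limf_einfE => /ereal_sup_gt[_ [V FV <-]] vV.
apply: filterS FV => t Vt /=; rewrite -lte_fin.
by apply: lt_le_trans vV _; apply: ereal_inf_lbound; exists t.
Qed.

Lemma limf_esup_fin : limf_esup f F \is a fin_num.
Proof.
rewrite limf_esupE fin_numElt; apply/andP; split.
  apply: (@lt_le_trans _ _ (- M)%:E); first exact: ltNyr.
  apply: le_ereal_inf_tmp => _ [V FV <-].
  have [t [Vt tM]] := filter_ex (filterI FV gM).
  by apply: (le_trans (low tM)); apply: ereal_sup_ubound; exists t.
apply: (@le_lt_trans _ _ M%:E); last exact: ltry.
apply: (@le_trans _ _ (ereal_sup (f @` [set t | `|g t| <= M]))).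
  by apply: ereal_inf_lbound; exists [set t | `|g t| <= M].
by apply: ge_ereal_sup => _ [t /= tM <-]; exact: upp.
Qed.

Lemma limf_esup_near (v : R) : fine (limf_esup f F) < v -> F [set t | g t < v].
Proof.
rewrite -lte_fin fineK ?limf_esup_fin// limf_esupE => /ereal_inf_lt[_ [V FV <-]] vV.
apply: filterS FV => t Vt /=; rewrite -lte_fin.
by apply: le_lt_trans vV; apply: ereal_sup_ubound; exists t.
Qed.

Lemma fine_limf_einf_le_esup : fine (limf_einf f F) <= fine (limf_esup f F).
Proof.
rewrite -lee_fin !fineK ?limf_einf_fin ?limf_esup_fin// limf_einfE limf_esupE.
apply: ge_ereal_sup => _ [V FV <-]; apply: le_ereal_inf_tmp => _ [W FW <-].
have [t [Vt Wt]] := filter_ex (filterI FV FW).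
apply: (@le_trans _ _ (f t)); first by apply: ereal_inf_lbound; exists t.
by apply: ereal_sup_ubound; exists t.
Qed.

End Limf.

Section MeanValue.
Context {R : realType}.

Lemma mvt_between (f df : R -> R) (x y : R) :
  (forall z, Num.min x y <= z <= Num.max x y -> is_derive z 1 f (df z)) ->
  exists2 z, Num.min x y <= z <= Num.max x y & f x - f y = df z * (x - y).
Proof.
wlog xy : x y / x <= y => [wlg|].
  have /orP[xy|yx] := le_total x y; first exact: wlg.
  move=> H; have [|z zI E] := wlg y x yx; first by rewrite minC maxC.
  exists z; first by rewrite minC maxC in zI.
  by rewrite -(opprB (f y)) E -mulrN opprB.
rewrite min_l// max_r// => H.
have cont : {within `[x, y], continuous f}.
  apply: derivable_within_continuous => z; rewrite in_itv/= => zI.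
  by have [] := H z zI.
have dz z : z \in `]x, y[%R -> is_derive z 1 f (df z).
  by rewrite in_itv/= => /andP[z1 z2]; apply: H; rewrite !ltW.
have [z zI E] := MVT_segment xy dz cont.
exists z; first by rewrite in_itv/= in zI.
by rewrite -(opprB (f y)) E -mulrN opprB.
Qed.

Lemma mvt_lower (f df : R -> R) (u v m x y : R) :
  (forall z, u <= z <= v -> is_derive z 1 f (df z) /\ m <= `|df z|) ->
  u <= x <= v -> u <= y <= v -> m * `|x - y| <= `|f x - f y|.
Proof.
move=> H /andP[ux xv] /andP[uy yv].
have sub z : Num.min x y <= z <= Num.max x y -> u <= z <= v.
  move=> /andP[z1 z2]; apply/andP; split.
    by apply: le_trans z1; rewrite le_min ux.
  by apply: (le_trans z2); rewrite ge_max xv.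
have [z /sub/H[//]|z /sub/H[_ mz] ->] := @mvt_between f df x y.
by rewrite normrM ler_wpM2r.
Qed.

Lemma mvt_upper (f df : R -> R) (u v m x y : R) :
  (forall z, u <= z <= v -> is_derive z 1 f (df z) /\ `|df z| <= m) ->
  u <= x <= v -> u <= y <= v -> `|f x - f y| <= m * `|x - y|.
Proof.
move=> H /andP[ux xv] /andP[uy yv].
have sub z : Num.min x y <= z <= Num.max x y -> u <= z <= v.
  move=> /andP[z1 z2]; apply/andP; split.
    by apply: le_trans z1; rewrite le_min ux.
  by apply: (le_trans z2); rewrite ge_max xv.
have [z /sub/H[//]|z /sub/H[_ mz] ->] := @mvt_between f df x y.
by rewrite normrM ler_wpM2r.
Qed.

(** The derivative of x |-> ln (g (e^x))^2 is 2 e^x g'(e^x) / g(e^x); the square takes care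
    of the unknown sign of g. *)
Lemma log_growth (g dg : R -> R) (C : R) :
  (forall t : R, 0 < t -> is_derive t 1 g (dg t)) -> (forall t : R, 0 < t -> g t != 0) ->
  (forall t : R, 0 < t -> `|t * dg t / g t| <= C) ->
  forall s t : R, 0 < s -> 0 < t -> `|ln `|g s| - ln `|g t| | <= C * `|ln s - ln t|.
Proof.
move=> dgE gn0 gC s t s0 t0.
pose phi x := ln (g (expR x) ^+ 2).
pose dphi x := 2 * (expR x * dg (expR x) / g (expR x)).
have dphiE (x : R) : is_derive x 1 phi (dphi x).
  have e0 := expR_gt0 x.
  have d1 : is_derive x 1 (g \o expR) (expR x * dg (expR x)).
    have Dg := dgE _ e0; have De := is_derive_expR x.
    by apply: is_derive_eq (is_derive1_comp Dg De) _; rewrite mulrC.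
  have d2 := is_deriveX 2 d1.
  have g2 : 0 < ((g \o expR) ^+ 2) x by rewrite exprfctE/= exprn_even_gt0//= gn0.
  have d3 := is_derive1_comp (is_derive1_ln g2) d2.
  apply: is_derive_eq d3 _.
  transitivity ((g (expR x) ^+ 2)^-1 * (2 * g (expR x) * (expR x * dg (expR x)))).
    by rewrite exprfctE.
  rewrite /dphi.
  have gx := gn0 _ e0.
  by field.
have half (x : R) : 0 < x -> ln (g x ^+ 2) = 2 * ln `|g x|.
  move=> x0; rewrite -real_normK ?num_real// lnXn ?normr_gt0 ?gn0//.
  by rewrite mulr_natl.
have := @mvt_upper phi dphi (Num.min (ln s) (ln t)) (Num.max (ln s) (ln t)) (2 * C) (ln s) (ln t).
rewrite /phi !lnK ?posrE// !half// -mulrBr normrM gtr0_norm// -mulrA ler_pM2l//; apply.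
- move=> z _; split; first exact: dphiE.
  by rewrite /dphi normrM gtr0_norm// ler_pM2l// gC// expR_gt0.
- by rewrite ge_min le_max lexx.
- by rewrite ge_min le_max lexx !orbT.
Qed.

End MeanValue.

Lemma perturbation (R : realType) (v k : R) : 0 < v ->
  exists2 e, 0 < e & forall d, 0 < d -> d <= e -> d * `|k| < v.
Proof.
move=> v0; have k1 : 0 < `|k| + 1 by rewrite ltr_wpDl.
exists (v / (`|k| + 1)); first by rewrite divr_gt0.
move=> d d0; rewrite ler_pdivlMr// => h; apply: lt_le_trans h.
by rewrite ltr_pM2l// ltrDl.
Qed.

Section Indices.
Context {R : realType}.
Variables (gamma g1 : R -> R) (C : R).
Hypothesis dgam : forall t : R, 0 < t -> is_derive t 1 gamma (g1 t).
Hypothesis gam_neq0 : forall t : R, 0 < t -> gamma t != 0.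
Hypothesis g1_up : forall t : R, 0 < t -> `|t * g1 t / gamma t| <= C.

Let M := `|ln `|gamma 1| | + C.

(** Keeps the indices finite, so that [fine] returns the actual lower and upper limits. *)
Lemma log_ratio_bounded (t : R) : 0 < t -> 1 <= `|ln t| -> `|ln `|gamma t| / ln t| <= M.
Proof.
move=> t0 lt1; have l0 : 0 < `|ln t| by apply: lt_le_trans lt1.
have := log_growth dgam gam_neq0 g1_up t0 ltr01; rewrite ln1 subr0 => H.
rewrite normrM normfV ler_pdivrMr// /M mulrDl.
rewrite -[X in `|X|](subrK (ln `|gamma 1|)) addrC.
apply: le_trans (ler_normD _ _) _; apply: lerD => //.
by rewrite ler_peMr.
Qed.

Lemma log_ratio_pinfty : (+oo%R : set_system R) [set t | `|ln `|gamma t| / ln t| <= M].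
Proof.
exists (expR 1); split; first exact: num_real.
move=> t et /=; have t0 : 0 < t by apply: lt_trans et; exact: expR_gt0.
apply: log_ratio_bounded => //; apply: le_trans (ler_norm _).
by rewrite -ler_expR lnK// ltW.
Qed.

Lemma log_ratio_at_right : (0^'+ : set_system R) [set t | `|ln `|gamma t| / ln t| <= M].
Proof.
near=> t; have t0 : 0 < t by near: t; exact: nbhs_right_gt.
apply: log_ratio_bounded => //; rewrite -normrN; apply: le_trans (ler_norm _).
rewrite lerNr -ler_expR lnK//; near: t; apply: nbhs_right_le.
exact: expR_gt0.
Unshelve. all: end_near. Qed.

Lemma omega0_le : omega0_1 gamma <= omega0_2 gamma.
Proof. exact: fine_limf_einf_le_esup log_ratio_at_right. Qed.

Lemma omegaoo_le : omegaoo_1 gamma <= omegaoo_2 gamma.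
Proof. exact: fine_limf_einf_le_esup log_ratio_pinfty. Qed.

Lemma growth_at_infinity (v : R) : v < omegaoo_1 gamma ->
  exists2 T : R, 0 < T & forall t, T <= t -> t `^ v <= `|gamma t|.
Proof.
move=> /(limf_einf_near _ log_ratio_pinfty) [T [_ HT]].
exists (Num.max (T + 1) (expR 1)); first by rewrite lt_max expR_gt0 orbT.
move=> t; rewrite ge_max => /andP[Tt et].
have t0 : 0 < t by apply: lt_le_trans et; exact: expR_gt0.
have l0 : 0 < ln t by apply: (@lt_le_trans _ _ 1) => //; rewrite -ler_expR lnK.
have : v < ln `|gamma t| / ln t by apply: HT; apply: lt_le_trans Tt; rewrite ltrDl.
rewrite ltr_pdivlMr// => /ltW; rewrite -ler_expR lnK ?posrE ?normr_gt0 ?gam_neq0//.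
by rewrite /powR gt_eqF.
Qed.

Lemma growth_at_zero (v : R) : omega0_2 gamma < v ->
  \forall t \near 0^'+, t `^ v <= `|gamma t|.
Proof.
move=> /(limf_esup_near _ log_ratio_at_right) H; near=> t.
have t0 : 0 < t by near: t; exact: nbhs_right_gt.
have l0 : ln t < 0.
  by rewrite -ltr_expR expR0 lnK//; near: t; exact: nbhs_right_lt.
have : ln `|gamma t| / ln t < v by near: t.
rewrite ltr_ndivrMr// => /ltW; rewrite -ler_expR lnK ?posrE ?normr_gt0 ?gam_neq0//.
by rewrite /powR gt_eqF.
Unshelve. all: end_near. Qed.

End Indices.

(** * Decomposition of the curve *)

Lemma dyadic_scale (R : realType) (D x : R) : 0 < x -> x <= D ->
  exists n, D * 2^-1 ^+ n.+1 <= x <= D * 2^-1 ^+ n.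
Proof.
move=> x0 xD.
have D0 : 0 < D by exact: lt_le_trans xD.
have ex : exists n, D * 2^-1 ^+ n.+1 <= x.
  have [n hn] : exists n, D / x < n%:R.
    exists (Num.truncn (D / x)).+1; exact: truncnS_gt.
  exists n; rewrite exprVn -ler_pdivlMr ?invr_gt0 ?exprn_gt0// invrK mulrC -ler_pdivrMr//.
  apply: le_trans (ltW hn) _; rewrite -natrX ler_nat.
  by apply: leq_trans (ltnW (ltn_expl n (ltnSn 1))) _; rewrite leq_exp2l.
case: (ex_minnP ex) => n hn nmin; exists n; rewrite hn/=.
case: n hn nmin => [|n] hn nmin; first by rewrite expr0 mulr1.
rewrite leNgt; apply/negP => h.
by have := nmin n (ltW h); rewrite ltnn.
Qed.

Lemma powR_geometric (R : realType) (D eta : R) (n : nat) : 0 < D ->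
  (D * 2^-1 ^+ n) `^ eta = D `^ eta * (2^-1 `^ eta) ^+ n.
Proof.
move=> D0; rewrite powRM ?exprn_ge0 ?(ltW D0)//.
by rewrite -[in LHS]powR_mulrn// -powRrM (mulrC n%:R) powRrM powR_mulrn// powR_ge0.
Qed.

Section Curve.
Context {R : realType}.
Variables (a b c : R) (a0 : 0 < a) (a1 : a < 1) (b0 : 0 < b) (b1 : b < 1) (c0 : 0 < c).
Variable alpha : R.
Hypothesis al1 : alpha < 1.
Hypotheses (cab : c < a + b) (sg1 : a + b - c < 1).
Variables (gam g1 g2 gt : R -> R) (mgt : measurable_fun [set: R] gt).
Hypothesis gtE : forall t : R, 0 < t -> gt t = gam t.
Hypothesis dgam : forall t : R, 0 < t -> is_derive t 1 gam (g1 t).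
Hypothesis dg1 : forall t : R, 0 < t -> is_derive t 1 g1 (g2 t).
Hypothesis gam_neq0 : forall t : R, 0 < t -> gam t != 0.
Variables (c1 c2 c3 : R) (c1_gt0 : 0 < c1) (c2_gt0 : 0 < c2) (c3_gt0 : 0 < c3).
Hypothesis g1_lo : forall t : R, 0 < t -> c1 <= `|t * g1 t / gam t|.
Hypothesis g1_up : forall t : R, 0 < t -> `|t * g1 t / gam t| <= c2.
Hypothesis g2_lo : forall t : R, 0 < t -> c3 <= `|t ^+ 2 * g2 t / gam t|.

Let w (t : R) := t `^ (alpha - 1).
Local Notation pos x := (Num.max 0 x).
Local Notation sg := (a + b - c).
Local Notation Gam t := (`|gam t|).
Local Notation bdd := (bilin_bounded a b c gt w).

Let mw : measurable_fun [set: R] w.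
Proof. exact: measurable_powR. Qed.
Let w0 t : 0 <= w t. Proof. exact: powR_ge0. Qed.

Let G0 t : 0 < t -> 0 < Gam t.
Proof. by move=> t0; rewrite normr_gt0 gam_neq0. Qed.

Let w_dec (u t : R) : 0 < u -> u <= t -> w t <= w u.
Proof.
move=> u0 ut; have t0 := lt_le_trans u0 ut.
rewrite /w /powR !gt_eqF// ler_expR -subr_ge0 -mulrBr -mulrNN mulr_ge0//.
  by rewrite oppr_ge0 subr_le0 ltW.
by rewrite opprB subr_ge0 ler_ln.
Qed.

Lemma abs_derive_lower t : 0 < t -> c1 * Gam t / t <= `|g1 t|.
Proof.
move=> t0; rewrite ler_pdivrMr// -ler_pdivlMr ?G0// [`|g1 t| * t]mulrC.
by have := g1_lo t0; rewrite normrM normfV normrM (gtr0_norm t0).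
Qed.

Lemma abs_derive_upper t : 0 < t -> `|g1 t| <= c2 * Gam t / t.
Proof.
move=> t0; rewrite ler_pdivlMr// -ler_pdivrMr ?G0// [`|g1 t| * t]mulrC.
by have := g1_up t0; rewrite normrM normfV normrM (gtr0_norm t0).
Qed.

(* the growth factor of |gam| over an octave *)
Let A := expR (c2 * ln 2).
Let A_gt0 : 0 < A. Proof. exact: expR_gt0. Qed.

Let doubling (u t : R) : 0 < u -> u <= t <= 2 * u -> Gam u <= A * Gam t /\ Gam t <= A * Gam u.
Proof.
move=> u0 /andP[ut tu]; have t0 := lt_le_trans u0 ut.
have := log_growth dgam gam_neq0 g1_up u0 t0.
have -> : `|ln u - ln t| = ln (t / u).
  by rewrite distrC ger0_norm ?subr_ge0 ?ler_ln ?posrE// lnM ?posrE ?invr_gt0// lnV ?posrE.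
move=> H.
have {H} : `|ln (Gam u) - ln (Gam t)| <= c2 * ln 2.
  apply: le_trans H _; rewrite ler_pM2l// ler_ln ?posrE ?divr_gt0//.
  by rewrite ler_pdivrMr.
rewrite ler_norml => /andP[h1 h2]; have gu := G0 u0; have gt0 := G0 t0.
split; rewrite /A.
  by rewrite -[leLHS](lnK gu) -[X in _ * X](lnK gt0) -expRD ler_expR; lra.
by rewrite -[leLHS](lnK gt0) -[X in _ * X](lnK gu) -expRD ler_expR; lra.
Qed.

Let kap := c1 / (2 * A).
Let kap0 : 0 < kap. Proof. by rewrite divr_gt0// mulr_gt0. Qed.
Let rho := c2 * A / kap.
Let rho0 : 0 < rho. Proof. by rewrite divr_gt0// mulr_gt0. Qed.

Let octave_derive (u z : R) : 0 < u -> u <= z <= 2 * u ->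
  kap * Gam u / u <= `|g1 z| <= rho * (kap * Gam u / u).
Proof.
move=> u0 /andP[uz zu]; have z0 := lt_le_trans u0 uz.
have [h1 h2] := @doubling u z u0 (introT andP (conj uz zu)).
apply/andP; split.
  apply: le_trans (abs_derive_lower z0).
  rewrite ler_pdivlMr// mulrAC ler_pdivrMr//.
  have -> : kap * Gam u * z = c1 * (Gam u / A) * (z / 2) by rewrite /kap; field; rewrite gt_eqF.
  rewrite -mulrA -[leRHS]mulrA ler_pM2l//.
  apply: ler_pM; rewrite ?divr_ge0 ?(ltW z0) ?(ltW A_gt0)//.
    by rewrite ler_pdivrMr// mulrC.
  by rewrite ler_pdivrMr// mulrC.
apply: le_trans (abs_derive_upper z0) _.
have -> : rho * (kap * Gam u / u) = c2 * (A * Gam u / u).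
  by rewrite /rho; field; rewrite !gt_eqF.
rewrite -mulrA ler_pM2l//; apply: ler_pM; rewrite ?invr_ge0 ?(ltW z0)//.
by rewrite lef_pV2 ?posrE.
Qed.

Let octave_piece (u r : R) : 0 < u ->
  (forall z, u <= z <= 2 * u -> `|g1 z| <= r) ->
  curve_piece gt w u (2 * u) u (kap * Gam u / u) r (w u).
Proof.
move=> u0 hr; split => //.
- by rewrite mulr_natl mulr2n addrK.
- by rewrite divr_gt0// mulr_gt0// G0.
- by rewrite powR_gt0.
move=> x y /=; rewrite !in_itv/= => xI yI.
have /andP[ux _] := xI; have /andP[uy _] := yI.
have x0 := lt_le_trans u0 ux; have y0 := lt_le_trans u0 uy.
split; first exact: w_dec.
rewrite !gtE//; apply/andP; split.
  apply: (@mvt_lower _ gam g1 u (2 * u)) => // z zI; have /andP[uz _] := zI.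
  split; first exact: dgam (lt_le_trans u0 uz).
  by have /andP[] := octave_derive u0 zI.
apply: (@mvt_upper _ gam g1 u (2 * u)) => // z zI; have /andP[uz _] := zI.
by split; [exact: dgam (lt_le_trans u0 uz)|exact: hr].
Qed.

Let octave_cost (om tau u : R) : 0 < u -> 0 <= tau -> u `^ om <= Gam u ->
  w u * u `^ (1 - sg) * (kap * Gam u / u) `^ (- tau) <=
  kap `^ (- tau) * u `^ (alpha - sg - tau * (om - 1)).
Proof.
move=> u0 t0 h; have gu := G0 u0.
have -> : kap * Gam u / u = kap * (Gam u / u) by rewrite mulrA.
rewrite [X in _ * X]powRM ?(ltW kap0) ?divr_ge0 ?(ltW u0)// mulrCA ler_pM2l ?powR_gt0//.
rewrite /w /powR !gt_eqF ?divr_gt0// -!expRD ler_expR lnM ?posrE ?invr_gt0// lnV ?posrE//.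
have h' : om * ln u <= ln (Gam u).
  by rewrite -ler_expR lnK// ; move: h; rewrite /powR gt_eqF.
have : 0 <= tau * (ln (Gam u) - om * ln u) by rewrite mulr_ge0// subr_ge0.
by lra.
Qed.

(** On the octave [u, 2u] the derivative of gam is comparable to s = |gam u| / u. The bound of
    [regime_large] for it is a power of u after |gam u| >= u^om, and the two hypotheses
    on the exponents say that this power is negative. *)
Lemma region_large (om T : R) : 0 < T -> 1 < om ->
  (forall t, T <= t -> t `^ om <= Gam t) ->
  alpha - a + c - om * b < 0 -> alpha < om * sg ->
  exists T1 K : R, [/\ T <= T1, 0 < K & bdd `[T1, +oo[%classic K].
Proof.
move=> T0 om1 hT e1 e2.
pose tau := sg - pos (a - c).
have tau0 : 0 <= tau.
  rewrite /tau; case: (leP 0 (a - c)) => ?; move: b0 cab; lra.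
pose eta := - (alpha - sg - tau * (om - 1)).
have eta0 : 0 < eta.
  by rewrite /eta /tau; case: (leP 0 (a - c)) => ?; move: e1 e2; lra.
have [C C0 HC] := regime_large a0 a1 b0 b1 c0 cab sg1 mgt mw w0 rho0.
(* beyond T1 the derivative is at least 2 on each octave *)
pose T1 := Num.max T ((2 / kap) `^ (om - 1)^-1).
have T1T : T <= T1 by rewrite le_max lexx.
have T10 : 0 < T1 by exact: lt_le_trans T1T.
have om1' : 0 < om - 1 by rewrite subr_gt0.
have steep u : T1 <= u -> 2 <= kap * Gam u / u.
  move=> uT; have u0 : 0 < u by exact: lt_le_trans uT.
  rewrite -mulrA mulrC -ler_pdivrMr//.
  apply: (@le_trans _ _ (u `^ (om - 1))).
    have -> : 2 / kap = ((2 / kap) `^ (om - 1)^-1) `^ (om - 1).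
      by rewrite -powRrM mulVf ?lt0r_neq0// powRr1// divr_ge0// ltW.
    rewrite ge0_ler_powR ?nnegrE ?powR_ge0 ?(ltW om1') ?(ltW u0)//.
    by apply: le_trans uT; rewrite le_max lexx orbT.
  rewrite ler_pdivlMr// [X in _ * X <= _](_ : u = u `^ 1); last by rewrite powRr1 ?ltW.
  by rewrite -powRD ?(gt_eqF u0) ?implybT// subrK hT// (le_trans T1T).
exists T1; pose K0 := C * (kap `^ (- tau) * T1 `^ (- eta)).
have K00 : 0 < K0 by rewrite !mulr_gt0 ?powR_gt0.
pose J n : set R := `[T1 * 2 ^+ n, 2 * (T1 * 2 ^+ n)]%classic.
have [] := @bilin_bounded_family R a b c c0 gt mgt w mw w0 J `[T1, +oo[%classic K0 (2^-1 `^ eta).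
- by move=> n; exact: measurable_itv.
- exact: measurable_itv.
- move=> t /=; rewrite in_itv/= andbT => Tt.
  have t0 : 0 < t by exact: lt_le_trans Tt.
  have [n /andP[n1 n2]] := @dyadic_scale R 1 (T1 / t) (divr_gt0 T10 t0) ltac:(by rewrite ler_pdivrMr// mul1r).
  exists n => //; rewrite /J/= in_itv/=; move: n1 n2; rewrite !mul1r !exprVn.
  rewrite ler_pdivlMr// mulrC ler_pdivrMr ?exprn_gt0// => n1.
  rewrite ler_pdivrMr// mulrC ler_pdivlMr ?exprn_gt0// => n2.
  by rewrite n2/= (le_trans n1)// exprS mulrCA.
- exact: K00.
- exact: powR_gt0.
- rewrite /powR gt_eqF// -[ltRHS]expR0 ltr_expR lnV ?posrE// mulrN oppr_lt0.
  by rewrite mulr_gt0// ln_gt0// ltr1n.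
- move=> n; set u := T1 * 2 ^+ n.
  have T1u : T1 <= u by rewrite ler_peMr ?(ltW T10)// exprn_ege1// ler1n.
  have u0 : 0 < u by exact: lt_le_trans T1u.
  have P := octave_piece u0 (fun z zI => (andP (octave_derive u0 zI)).2).
  have := HC _ _ _ _ _ P (steep _ T1u); rewrite -/tau.
  apply: bilin_bounded_le => //.
    by rewrite !mulr_ge0 ?powR_ge0 ?(ltW C0).
  rewrite /K0 -[leRHS]mulrA ler_pM2l//.
  have uu : u `^ om <= Gam u by rewrite hT// (le_trans T1T).
  apply: le_trans (octave_cost u0 tau0 uu) _.
  rewrite -[leRHS]mulrA ler_pM2l ?powR_gt0//.
  rewrite (_ : alpha - sg - tau * (om - 1) = - eta); last by rewrite /eta opprK.
  rewrite powRM ?(ltW T10) ?exprn_ge0// ler_pM2l ?powR_gt0//.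
  rewrite -[in leLHS]powR_mulrn// -powRrM (mulrC n%:R) powRrM powR_mulrn ?powR_ge0//.
  by rewrite /powR !gt_eqF// lnV ?posrE// mulrN mulNr.
by move=> K K1 HK; exists K.
Qed.

(** The same octaves near zero, where |gam'| <= 1/2. Here s is small, and its negative
    exponent makes the lower bound |gam u| >= u^om necessary. *)
Lemma region_small (om t1 : R) : 0 < t1 ->
  (forall t, 0 < t -> t <= t1 -> t `^ om <= Gam t) ->
  (forall t, 0 < t -> t <= t1 -> `|g1 t| <= 2^-1) ->
  0 < alpha - a + om * (c - b) -> 0 < alpha - sg ->
  exists2 K : R, 0 < K & bdd `]0, t1]%classic K.
Proof.
move=> t10 hT flat e1 e2.
pose tau := pos (b - c).
have tau0 : 0 <= tau by rewrite le_max lexx.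
pose eta := alpha - sg - tau * (om - 1).
have eta0 : 0 < eta.
  by rewrite /eta /tau; case: (leP 0 (b - c)) => ?; move: e1 e2; lra.
have [C C0 HC] := regime_small a0 a1 b0 b1 c0 cab sg1 mgt mw w0.
pose D := t1 * 2^-1.
have D0 : 0 < D by rewrite mulr_gt0.
pose K0 := C * (kap `^ (- tau) * D `^ eta).
have K00 : 0 < K0 by rewrite !mulr_gt0 ?powR_gt0.
pose J n : set R := `[D * 2^-1 ^+ n, 2 * (D * 2^-1 ^+ n)]%classic.
have E n : 2 * (D * 2^-1 ^+ n) = t1 * 2^-1 ^+ n.
  by rewrite mulrA /D [2 * _]mulrC divfK// pnatr_eq0.
apply: (@bilin_bounded_family R a b c c0 gt mgt w mw w0 J `]0, t1]%classic K0 (2^-1 `^ eta)) => //.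
- by move=> n; exact: measurable_itv.
- move=> t /=; rewrite in_itv/= => /andP[t0 tt1].
  have [n /andP[n1 n2]] := dyadic_scale t0 tt1.
  exists n => //; rewrite /J/= in_itv/= E n2 andbT.
  by apply: le_trans n1; rewrite exprS /D mulrA.
- rewrite /powR gt_eqF// -[ltRHS]expR0 ltr_expR lnV ?posrE// mulrN oppr_lt0.
  by rewrite mulr_gt0// ln_gt0// ltr1n.
move=> n; rewrite /J; set u := D * 2^-1 ^+ n.
have u0 : 0 < u by rewrite mulr_gt0// exprn_gt0.
have ut : 2 * u <= t1.
  by rewrite /u E ler_piMr ?(ltW t10)// exprn_ile1// invf_le1// ler1n.
have ut1 : u <= t1 by apply: le_trans ut; move: u0; lra.
have flat' z : u <= z <= 2 * u -> `|g1 z| <= 2^-1.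
  by move=> /andP[uz zu]; apply: flat; [exact: lt_le_trans uz|exact: le_trans ut].
have := HC _ _ _ _ _ (octave_piece u0 flat'); rewrite -/tau.
apply: bilin_bounded_le => //; first by rewrite !mulr_ge0 ?powR_ge0 ?(ltW C0).
rewrite /K0 -[leRHS]mulrA ler_pM2l//.
apply: le_trans (octave_cost u0 tau0 (hT _ u0 ut1)) _.
by rewrite -/eta powR_geometric// mulrA.
Qed.

Section Middle.
Variables (t1 T1 : R) (t10 : 0 < t1) (tT : t1 < T1).

Let D := T1 - t1.
Let D0 : 0 < D. Proof. by rewrite subr_gt0. Qed.
Let itv_gt0 z : t1 <= z <= T1 -> 0 < z.
Proof. by move=> /andP[z1 _]; exact: lt_le_trans z1. Qed.

Let osc := expR (c2 * ln (T1 / t1)).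
Let osc0 : 0 < osc. Proof. exact: expR_gt0. Qed.

Let Gam_range z : t1 <= z <= T1 -> Gam t1 / osc <= Gam z <= Gam t1 * osc.
Proof.
move=> zI; have z0 := itv_gt0 zI; move: zI => /andP[z1 z2].
have := log_growth dgam gam_neq0 g1_up t10 z0.
have -> : `|ln t1 - ln z| = ln (z / t1).
  by rewrite distrC ger0_norm ?subr_ge0 ?ler_ln ?posrE// lnM ?posrE ?invr_gt0// lnV ?posrE.
move=> H.
have {H} : `|ln (Gam t1) - ln (Gam z)| <= c2 * ln (T1 / t1).
  have TT := lt_trans t10 tT.
  apply: le_trans H _; rewrite ler_pM2l// ler_ln ?posrE ?divr_gt0//.
  by rewrite ler_pM2r// invr_gt0.
rewrite ler_norml => /andP[h1 h2]; have gu := G0 t10; have gt0 := G0 z0.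
apply/andP; split; rewrite /osc.
  rewrite -expRN -[leRHS](lnK gt0) -[X in X * _](lnK gu) -expRD ler_expR; lra.
rewrite -[leLHS](lnK gt0) -[X in X * _](lnK gu) -expRD ler_expR; lra.
Qed.

Let s := c1 * (Gam t1 / osc) / T1.
Let r := c2 * (Gam t1 * osc) / t1.
Let k := c3 * (Gam t1 / osc) / T1 ^+ 2.

Let TT0 : 0 < T1. Proof. exact: lt_trans tT. Qed.
Let s0 : 0 < s. Proof. by rewrite !mulr_gt0 ?invr_gt0// G0. Qed.
Let r0 : 0 < r. Proof. by rewrite !mulr_gt0 ?invr_gt0// G0. Qed.
Let k0 : 0 < k. Proof. by rewrite !mulr_gt0 ?invr_gt0 ?exprn_gt0// G0. Qed.

Let g1_range z : t1 <= z <= T1 -> s <= `|g1 z| <= r.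
Proof.
move=> zI; have z0 := itv_gt0 zI; have /andP[h1 h2] := Gam_range zI.
have G1 : 0 <= Gam t1 / osc by rewrite divr_ge0// ltW.
move: zI => /andP[z1 z2]; apply/andP; split.
  apply: le_trans (abs_derive_lower z0).
  apply: ler_pM; rewrite ?invr_ge0 ?mulr_ge0 ?(ltW c1_gt0) ?(ltW TT0) ?invr_ge0 ?(ltW osc0)//.
    by rewrite ler_pM2l.
  by rewrite lef_pV2 ?posrE.
apply: le_trans (abs_derive_upper z0) _.
apply: ler_pM; rewrite ?invr_ge0 ?mulr_ge0 ?(ltW c2_gt0) ?(ltW z0)//.
  by rewrite ler_pM2l.
by rewrite lef_pV2 ?posrE.
Qed.

Let g2_range z : t1 <= z <= T1 -> k <= `|g2 z|.
Proof.
move=> zI; have z0 := itv_gt0 zI; have /andP[h1 h2] := Gam_range zI.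
have G1 : 0 <= Gam t1 / osc by rewrite divr_ge0// ltW.
have : c3 * Gam z / z ^+ 2 <= `|g2 z|.
  rewrite ler_pdivrMr ?exprn_gt0// -ler_pdivlMr ?G0// [`|g2 z| * _]mulrC.
  by have := g2_lo z0; rewrite normrM normfV normrM [`|z ^+ 2|]gtr0_norm ?exprn_gt0.
apply: le_trans; move: zI => /andP[z1 z2].
apply: ler_pM; rewrite ?invr_ge0 ?mulr_ge0 ?exprn_ge0 ?(ltW c3_gt0) ?(ltW TT0) ?invr_ge0 ?(ltW osc0)//.
  by rewrite ler_pM2l.
by rewrite lef_pV2 ?posrE ?exprn_gt0// ler_pXn2r// nnegrE ltW.
Qed.

(* t0 minimises |1 - g1|; since |g2| >= k, g1 moves away from g1 t0 linearly, and so does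
   |1 - g1| from zero, even if 1 is not a value of g1 *)
Let tangency : exists2 t0, t1 <= t0 <= T1 &
  forall z, t1 <= z <= T1 -> k / 2 * `|z - t0| <= `|1 - g1 z|.
Proof.
have cg : {within `[t1, T1], continuous (fun z => `|1 - g1 z|)}.
  apply: continuous_in_subspaceT => z; rewrite inE/= in_itv/= => zI.
  have z0 := itv_gt0 zI.
  have [dz _] := dg1 z0.
  have cz : {for z, continuous g1}.
    exact/differentiable_continuous/derivable1_diffP.
  apply: (continuous_comp (f := fun z => 1 - g1 z)); last exact: norm_continuous.
  by apply: cvgB; [exact: cvg_cst|exact: cz].
have [t0 t0I tmin] := EVT_min (ltW tT) cg.
rewrite in_itv/= in t0I; exists t0 => // z zI.
have h1 : k * `|z - t0| <= `|g1 z - g1 t0|.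
  apply: (@mvt_lower _ g1 g2 t1 T1) => // x xI; split; first exact: dg1 (itv_gt0 xI).
  exact: g2_range.
have h2 : `|1 - g1 t0| <= `|1 - g1 z| by apply: tmin; rewrite in_itv.
have h3 : `|g1 z - g1 t0| <= `|1 - g1 z| + `|1 - g1 t0|.
  rewrite (_ : g1 z - g1 t0 = (1 - g1 t0) - (1 - g1 z)); last by ring.
  by rewrite [leRHS]addrC ler_normB.
by lra.
Qed.

(** On a compact part of the curve only the tangency is singular. At distance l from it,
    t - gam t expands by a multiple of l, and the bound l^(1 - sg - (a + b - 1)^+) is
    summable over dyadic l. *)
Lemma region_middle : 2 * a + 2 * b - c < 2 ->
  exists2 K : R, 0 < K & bdd `[t1, T1]%classic K.
Proof.
move=> e3.
have [t0 t0I tan] := tangency.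
pose P := pos (a + b - 1).
pose eta := 1 - sg - P.
have eta0 : 0 < eta.
  by rewrite /eta /P; case: (leP 0 (a + b - 1)) => ?; move: e3 sg1; lra.
have [C C0 HC] := regime_singular a0 a1 b0 b1 c0 cab sg1 mgt mw w0 s0 r0.
pose kk := k / 2.
have kk0 : 0 < kk by rewrite divr_gt0.
pose E := D * 2^-1.
have E0 : 0 < E by rewrite mulr_gt0.
pose K0 := C * (w t1 * kk `^ (- P) * E `^ eta).
have K00 : 0 < K0 by rewrite !mulr_gt0 ?powR_gt0.
have piece (u v l : R) : 0 < l -> t1 <= u -> v <= T1 -> v - u <= l ->
    (forall z, u <= z <= v -> l <= `|z - t0|) ->
    bdd `[u, v]%classic (C * (w t1 * kk `^ (- P) * l `^ eta)).
  move=> l0 tu vT vul far.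
  have sub z : u <= z <= v -> t1 <= z <= T1.
    by move=> /andP[z1 z2]; rewrite (le_trans tu z1) (le_trans z2 vT).
  have dl0 : 0 < kk * l by rewrite mulr_gt0.
  have cp : curve_piece gt w u v l s r (w t1).
    split => //; first by rewrite powR_gt0.
    move=> x y /=; rewrite !in_itv/= => xI yI.
    have x0 := itv_gt0 (sub _ xI); have y0 := itv_gt0 (sub _ yI).
    split; first by apply: w_dec => //; have /andP[] := sub _ xI.
    rewrite !gtE//; apply/andP; split.
      apply: (@mvt_lower _ gam g1 u v) => // z /sub zI.
      split; first exact: dgam (itv_gt0 zI).
      by have /andP[] := g1_range zI.
    apply: (@mvt_upper _ gam g1 u v) => // z /sub zI.
    split; first exact: dgam (itv_gt0 zI).
    by have /andP[] := g1_range zI.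
  have := HC u v l (kk * l) (w t1) cp dl0.
  rewrite -/P powRM ?(ltW kk0) ?(ltW l0)//.
  have -> : w t1 * l `^ (1 - sg) * (kk `^ (- P) * l `^ (- P)) = w t1 * kk `^ (- P) * l `^ eta.
    rewrite /eta [l `^ (1 - sg - P)]powRD ?(gt_eqF l0) ?implybT//; ring.
  apply => x y /=; rewrite !in_itv/= => xI yI.
  have x0 := itv_gt0 (sub _ xI); have y0 := itv_gt0 (sub _ yI).
  rewrite !gtE//.
  apply: (@mvt_lower _ (fun t => t - gam t) (fun t => 1 - g1 t) u v) => // z zI.
  split; last first.
    by apply: le_trans (tan _ (sub _ zI)); rewrite ler_pM2l// far.
  have dz := dgam (itv_gt0 (sub _ zI)).
  by apply: (@is_deriveB _ _ _ id gam) => //; exact: is_derive_id.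
have decay : 2^-1 `^ eta < 1.
  rewrite /powR gt_eqF// -[ltRHS]expR0 ltr_expR lnV ?posrE// mulrN oppr_lt0.
  by rewrite mulr_gt0// ln_gt0// ltr1n.
have hl n : 0 < E * 2^-1 ^+ n by rewrite mulr_gt0// exprn_gt0.
have EE n : 2 * (E * 2^-1 ^+ n) = D * 2^-1 ^+ n.
  by rewrite mulrA /E [2 * _]mulrC divfK// pnatr_eq0.
have ES n : D * 2^-1 ^+ n.+1 = E * 2^-1 ^+ n by rewrite exprS mulrA.
move: (t0I) => /andP[t0a t0b].
pose Jr n : set R := `[t0 + E * 2^-1 ^+ n, Num.min T1 (t0 + D * 2^-1 ^+ n)]%classic.
have [Kr Kr0 Hr] : exists2 K, 0 < K & bdd `]t0, T1]%classic K.
  apply: (@bilin_bounded_family R a b c c0 gt mgt w mw w0 Jr _ K0 (2^-1 `^ eta)) => //.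
  - by move=> n; exact: measurable_itv.
  - move=> t /=; rewrite in_itv/= => /andP[tt0 tT1].
    have d0 : 0 < t - t0 by rewrite subr_gt0.
    have dD : t - t0 <= D by rewrite /D lerB.
    have [n /andP[n1 n2]] := dyadic_scale d0 dD.
    exists n => //; rewrite /Jr/= in_itv/= le_min tT1/=.
    by rewrite -ES -lerBrDl n1 -lerBlDl n2.
  move=> n; rewrite /K0 -[X in bdd _ X]mulrA -[X in bdd _ (_ * X)]mulrA -powR_geometric//.
  apply: piece => //.
  - by apply: (le_trans t0a); rewrite lerDl ltW.
  - by rewrite ge_min lexx.
  - have : Num.min T1 (t0 + D * 2^-1 ^+ n) <= t0 + D * 2^-1 ^+ n by rewrite ge_min lexx orbT.
    by rewrite -EE; lra.
  - move=> z /andP[z1 _]; rewrite ger0_norm; last by have := hl n; lra.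
    by rewrite lerBrDl.
pose Jl n : set R := `[Num.max t1 (t0 - D * 2^-1 ^+ n), t0 - E * 2^-1 ^+ n]%classic.
have [Kl Kl0 Hl] : exists2 K, 0 < K & bdd `[t1, t0[%classic K.
  apply: (@bilin_bounded_family R a b c c0 gt mgt w mw w0 Jl _ K0 (2^-1 `^ eta)) => //.
  - by move=> n; exact: measurable_itv.
  - move=> t /=; rewrite in_itv/= => /andP[tt1 tt0].
    have d0 : 0 < t0 - t by rewrite subr_gt0.
    have dD : t0 - t <= D by rewrite /D lerB.
    have [n /andP[n1 n2]] := dyadic_scale d0 dD.
    exists n => //; rewrite /Jl/= in_itv/= ge_max tt1/=.
    by rewrite -ES; move: n1 n2; lra.
  move=> n; rewrite /K0 -[X in bdd _ X]mulrA -[X in bdd _ (_ * X)]mulrA -powR_geometric//.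
  apply: piece => //.
  - by rewrite le_max lexx.
  - by apply: (le_trans _ t0b); rewrite gerBl ltW.
  - have : t0 - D * 2^-1 ^+ n <= Num.max t1 (t0 - D * 2^-1 ^+ n) by rewrite le_max lexx orbT.
    by rewrite -EE; lra.
  - move=> z /andP[_ z2]; rewrite distrC ger0_norm; last by have := hl n; lra.
    by move: z2; lra.
have Hp : bdd [set t0] 1.
  move=> F G LF LG; rewrite integral0_eq ?lee_fin ?powR_ge0// => x _.
  by rewrite /bilin integral_set1 poweR0r// invr_eq0 gt_eqF.
have m1 : measurable (`]t0, T1]%classic : set R) by exact: measurable_itv.
have m2 : measurable (`[t1, t0[%classic : set R) by exact: measurable_itv.
have m3 : measurable ([set t0] : set R) by exact: measurable_set1.
have [K1 K10 H1] := bilin_bounded_union c0 mgt mw w0 m1 m3 (measurableU _ _ m1 m3)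
  (@subset_refl _ _) Kr0 ltr01 Hr Hp.
apply: (bilin_bounded_union c0 mgt mw w0 (measurableU _ _ m1 m3) m2 _ _ K10 Kl0 H1 Hl).
  exact: measurable_itv.
move=> t /=; rewrite !in_itv/= => /andP[tt1 tT1].
case: (ltgtP t t0) => [tt0|tt0|->].
- by right; rewrite tt1.
- by left; left; rewrite tT1.
- by left; right.
Qed.

End Middle.

Lemma region_all (om0 om1 tau T : R) : 0 < tau -> 0 < T ->
  (forall t, 0 < t -> t <= tau -> t `^ om0 <= Gam t) ->
  (forall t, 0 < t -> t <= tau -> `|g1 t| <= 2^-1) ->
  1 < om1 -> (forall t, T <= t -> t `^ om1 <= Gam t) ->
  0 < alpha - a + om0 * (c - b) -> 0 < alpha - sg -> 2 * a + 2 * b - c < 2 ->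
  alpha - a + c - om1 * b < 0 -> alpha < om1 * sg ->
  exists2 K : R, 0 < K & bdd `]0, +oo[%classic K.
Proof.
move=> tau0 T0 s1 s2 om11 l1 e1 e2 e3 e4 e5.
have [Ks Ks0 Hs] := region_small tau0 s1 s2 e1 e2.
have T0' : 0 < Num.max T (tau + 1) by rewrite lt_max T0.
have l1' t : Num.max T (tau + 1) <= t -> t `^ om1 <= Gam t.
  by rewrite ge_max => /andP[+ _]; exact: l1.
have [T1 [Kl [TT1 Kl0 Hl]]] := region_large T0' om11 l1' e4 e5.
have tT : tau < T1 by apply: lt_le_trans TT1; rewrite lt_max ltrDl ltr01 orbT.
have [Km Km0 Hm] := region_middle tau0 tT e3.
have m1 : measurable (`]0, tau]%classic : set R) by exact: measurable_itv.
have m2 : measurable (`[tau, T1]%classic : set R) by exact: measurable_itv.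
have m3 : measurable (`[T1, +oo[%classic : set R) by exact: measurable_itv.
have [K1 K10 H1] := bilin_bounded_union c0 mgt mw w0 m1 m2 (measurableU _ _ m1 m2)
  (@subset_refl _ _) Ks0 Km0 Hs Hm.
apply: (bilin_bounded_union c0 mgt mw w0 (measurableU _ _ m1 m2) m3 _ _ K10 Kl0 H1 Hl).
  exact: measurable_itv.
move=> t /=; rewrite !in_itv/= andbT => t0.
have [tt|tt] := leP t tau; first by left; left; rewrite t0.
have [tT1|tT1] := leP t T1; first by left; right; rewrite (ltW tt).
by right; rewrite ltW.
Qed.

End Curve.

(** * From the positive form to the operator *)

Local Notation normc := Normc.normc.

(** Read off the definition by simple functions. It is applied to the norm of the operator
    as a function of x, for which measurability has not been established. *)
Lemma ge0_le_integral_pointwise d (T : measurableType d) (R : realType)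
    (m : {measure set T -> \bar R}) (f g : T -> \bar R) :
  (forall x, 0 <= f x)%E -> (forall x, f x <= g x)%E ->
  (\int[m]_x f x <= \int[m]_x g x)%E.
Proof.
move=> f0 fg; have g0 x : (0 <= g x)%E by exact: le_trans (fg x).
rewrite !ge0_integralTE//; apply: ge_ereal_sup => _ [h hf <-].
by apply: ereal_sup_ubound; exists h => // x; exact: le_trans (fg x).
Qed.

Section ComplexNorm.
Local Open Scope complex_scope.
Context {R : realType}.
Implicit Types (z : R[i]) (f : R -> R[i]).

Lemma normc_ge0 z : 0 <= normc z.
Proof. by case: z => x y; exact: sqrtr_ge0. Qed.

Lemma Re_le_normc z : `|complex.Re z| <= normc z.
Proof.
case: z => x y /=; rewrite -sqrtr_sqr ler_wsqrtr// lerDl sqr_ge0//.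
Qed.

Lemma Im_le_normc z : `|complex.Im z| <= normc z.
Proof.
case: z => x y /=; rewrite -sqrtr_sqr ler_wsqrtr// lerDr sqr_ge0//.
Qed.

Lemma normc_le z : normc z <= `|complex.Re z| + `|complex.Im z|.
Proof.
case: z => x y /=; rewrite -[leRHS]ger0_norm ?addr_ge0// -sqrtr_sqr ler_wsqrtr//.
rewrite sqrrD !real_normK ?num_real// -addrA lerD2l lerDr.
by rewrite mulrn_wge0// mulr_ge0.
Qed.

Lemma Re_mul_real (z1 z2 : R[i]) (y : R) : complex.Re (z1 * z2 / y%:C) =
  (complex.Re z1 * complex.Re z2 - complex.Im z1 * complex.Im z2) * y^-1.
Proof.
rewrite -fmorphV; move: z1 z2 (y^-1) => [x1 y1] [x2 y2] k /=.
by rewrite mulr0 subr0.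
Qed.

Lemma Im_mul_real (z1 z2 : R[i]) (y : R) : complex.Im (z1 * z2 / y%:C) =
  (complex.Re z1 * complex.Im z2 + complex.Im z1 * complex.Re z2) * y^-1.
Proof.
rewrite -fmorphV; move: z1 z2 (y^-1) => [x1 y1] [x2 y2] k /=.
by rewrite mulr0 add0r.
Qed.

Lemma normc_mul_real (z1 z2 : R[i]) (y : R) : 0 <= y ->
  normc (z1 * z2 / y%:C) = normc z1 * normc z2 * y^-1.
Proof.
move=> y0; rewrite !Normc.normcM Normc.normcV; congr (_ * _^-1).
by rewrite /= expr0n/= addr0 sqrtr_sqr ger0_norm.
Qed.

Lemma measurable_normc f : cmeasurable f -> measurable_fun [set: R] (fun x => normc (f x)).
Proof.
move=> [mRe mIm].
rewrite (_ : (fun x => _) =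
    (fun x => (complex.Re (f x) ^+ 2 + complex.Im (f x) ^+ 2) `^ 2^-1)).
  apply: (measurableT_comp (measurable_powR _)).
  by apply: measurable_funD; exact: measurable_funX.
apply/funext => x; case: (f x) => u v /=.
by rewrite powR12_sqrt// addr_ge0// sqr_ge0.
Qed.

End ComplexNorm.

Section Assembly.
Local Open Scope complex_scope.
Context {R : realType}.
Local Notation mu := (@lebesgue_measure R).
Variables (alpha : R) (gam gt : R -> R) (mgt : measurable_fun [set: R] gt).
Hypothesis gtE : forall t : R, 0 < t -> gt t = gam t.
Variables (p q r : R) (p0 : 0 < p) (q0 : 0 < q) (r0 : 0 < r).
Let w (t : R) := t `^ (alpha - 1).
Variables (K : R) (K0 : 0 < K).
Hypothesis HK : bilin_bounded p^-1 q^-1 r^-1 gt w `]0, +oo[%classic K.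

Let D : set R := `]0, +oo[%classic.
Let mD : measurable D. Proof. exact: measurable_itv. Qed.
Let memD t : t \in D -> 0 < t.
Proof. by rewrite inE /D/= in_itv/= andbT. Qed.
Let mw : measurable_fun [set: R] w. Proof. exact: measurable_powR. Qed.
Let w0 t : 0 <= w t. Proof. exact: powR_ge0. Qed.

Lemma normalized_mass (s A : R) (f : R -> R[i]) : 0 < s -> 0 < A -> cmeasurable f ->
  (cLnorm s f <= A%:E)%E ->
  unit_mass (fun x => (normc (f x) / A) `^ s).
Proof.
move=> s0 A0 mf fA; have mn := measurable_normc mf.
split; [|split].
- apply: (measurableT_comp (measurable_powR _)); exact: measurable_funM.
- by move=> x; exact: powR_ge0.
have Ai : 0 <= A^-1 by rewrite invr_ge0 ltW.
under eq_integral do rewrite powRM ?normc_ge0// mulrC EFinM.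
rewrite ge0_integralZl ?lee_fin ?powR_ge0//; last 2 first.
- apply/measurable_EFinP; exact: (measurableT_comp (measurable_powR _)).
- by move=> x _; rewrite lee_fin powR_ge0.
have E : (\int[mu]_x (normc (f x) `^ s)%:E = cLnorm s f `^ s)%E.
  rewrite /cLnorm poweR_Lnorm ?gt_eqF//; apply: eq_integral => x _.
  by rewrite gee0_abs ?lee_fin ?normc_ge0.
rewrite E.
apply: (@le_trans _ _ ((A^-1 `^ s)%:E * (A `^ s)%:E)%E); last first.
  by rewrite -EFinM -powRM// ?mulVf ?gt_eqF ?powR1// ltW.
rewrite lee_wpmul2l ?lee_fin ?powR_ge0// -poweR_EFin.
apply: gt0_ler_poweR; rewrite ?(ltW s0)// in_itv/= leey andbT ?Lnorm_ge0//.
by rewrite lee_fin ltW.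
Qed.

Section FixFG.
Variables (f g : R -> R[i]) (A B : R) (A0 : 0 < A) (B0 : 0 < B).
Hypotheses (mf : cmeasurable f) (mg : cmeasurable g).
Hypotheses (fA : (cLnorm p f <= A%:E)%E) (gB : (cLnorm q g <= B%:E)%E).

Let F x := (normc (f x) / A) `^ p.
Let G x := (normc (g x) / B) `^ q.
Let T := bilin p^-1 q^-1 gt w D F G.
Let LF := normalized_mass p0 A0 mf fA.
Let LG := normalized_mass q0 B0 mg gB.

Let mT : measurable_fun [set: R] T.
Proof. exact: (measurable_bilin _ _ mgt mw w0 mD LF.1 LG.1). Qed.

Let T_ge0 x : (0 <= T x)%E.
Proof. exact: bilin_ge0. Qed.

Let T_norm : (\int[mu]_x (T x `^ r) <= (K `^ r)%:E)%E.
Proof. by have := HK LF LG; rewrite invrK. Qed.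

Let wE t : 0 < t -> (t `^ (1 - alpha))^-1 = w t.
Proof. by move=> t0; rewrite -powRN opprB. Qed.

Let rootE (s M n : R) : 0 < s -> 0 < M -> 0 <= n -> ((n / M) `^ s) `^ s^-1 = n / M.
Proof.
move=> s0 M0 n0; rewrite -powRrM mulfV ?gt_eqF// powRr1// divr_ge0//.
exact: ltW.
Qed.

Let norm_integrand x t : 0 < t -> normc (H_integrand alpha gam f g x t) =
  A * B * (F (x - t) `^ p^-1 * G (x - gt t) `^ q^-1 * w t).
Proof.
move=> t0; rewrite /H_integrand normc_mul_real ?powR_ge0// wE// -gtE// /F /G.
rewrite !rootE ?normc_ge0//.
by field; rewrite !gt_eqF.
Qed.

Let mkern x : measurable_fun D
  (fun t => (F (x - t) `^ p^-1 * G (x - gt t) `^ q^-1 * w t)%:E).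
Proof. exact: (@measurable_bilin_section R p^-1 q^-1 gt mgt w mw F G x D LF.1 LG.1). Qed.

Let int_norm x : (\int[mu]_(t in D) (normc (H_integrand alpha gam f g x t))%:E =
  (A * B)%:E * T x)%E.
Proof.
rewrite /T /bilin -ge0_integralZl//; last 3 first.
- exact: (mkern x).
- by move=> t _; rewrite lee_fin !mulr_ge0 ?powR_ge0.
- by rewrite lee_fin mulr_ge0// ltW.
apply: eq_integral => t /memD t0.
by rewrite norm_integrand.
Qed.

Let mRe x : measurable_fun D (fun t => (complex.Re (H_integrand alpha gam f g x t))%:E).
Proof.
apply/measurable_EFinP.
apply: (@eq_measurable_fun _ _ _ _ D (fun t => (complex.Re (f (x - t)) * complex.Re (g (x - gt t)) -
  complex.Im (f (x - t)) * complex.Im (g (x - gt t))) * w t)).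
  move=> t /memD t0.
  by rewrite /H_integrand Re_mul_real wE// gtE.
apply: measurable_funM; last exact: measurable_funTS.
apply: measurable_funB; apply: measurable_funM.
- by apply: measurable_funTS; apply: (measurableT_comp mf.1); exact: measurable_funB.
- by apply: measurable_funTS; apply: (measurableT_comp mg.1); exact: measurable_funB.
- by apply: measurable_funTS; apply: (measurableT_comp mf.2); exact: measurable_funB.
- by apply: measurable_funTS; apply: (measurableT_comp mg.2); exact: measurable_funB.
Qed.

Let mIm x : measurable_fun D (fun t => (complex.Im (H_integrand alpha gam f g x t))%:E).
Proof.
apply/measurable_EFinP.
apply: (@eq_measurable_fun _ _ _ _ D (fun t => (complex.Re (f (x - t)) * complex.Im (g (x - gt t)) +
  complex.Im (f (x - t)) * complex.Re (g (x - gt t))) * w t)).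
  move=> t /memD t0.
  by rewrite /H_integrand Im_mul_real wE// gtE.
apply: measurable_funM; last exact: measurable_funTS.
apply: measurable_funD; apply: measurable_funM.
- by apply: measurable_funTS; apply: (measurableT_comp mf.1); exact: measurable_funB.
- by apply: measurable_funTS; apply: (measurableT_comp mg.2); exact: measurable_funB.
- by apply: measurable_funTS; apply: (measurableT_comp mf.2); exact: measurable_funB.
- by apply: measurable_funTS; apply: (measurableT_comp mg.1); exact: measurable_funB.
Qed.

Let mnorm x : measurable_fun D (fun t => (normc (H_integrand alpha gam f g x t))%:E).
Proof.
apply: (@eq_measurable_fun _ _ _ _ D (fun t =>
  ((A * B)%:E * (F (x - t) `^ p^-1 * G (x - gt t) `^ q^-1 * w t)%:E)%E)).
  by move=> t /memD t0; rewrite norm_integrand.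
apply: measurable_funeM.
exact: (mkern x).
Qed.

Let int_Re x : (\int[mu]_(t in D) `|(complex.Re (H_integrand alpha gam f g x t))%:E| <=
  (A * B)%:E * T x)%E.
Proof.
rewrite -int_norm; apply: ge0_le_integral => //.
- by apply: measurableT_comp => //; exact: mRe.
- exact: mnorm.
- by move=> t _; rewrite lee_fin Re_le_normc.
Qed.

Let int_Im x : (\int[mu]_(t in D) `|(complex.Im (H_integrand alpha gam f g x t))%:E| <=
  (A * B)%:E * T x)%E.
Proof.
rewrite -int_norm; apply: ge0_le_integral => //.
- by apply: measurableT_comp => //; exact: mIm.
- exact: mnorm.
- by move=> t _; rewrite lee_fin Im_le_normc.
Qed.

Let integrand_integrable x : T x \is a fin_num ->
  cintegrable D (H_integrand alpha gam f g x).
Proof.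
move=> Tx.
have fin : ((A * B)%:E * T x < +oo)%E by rewrite ltey_eq fin_numM.
by split; apply/integrableP; split; [exact: mRe|exact: le_lt_trans fin|
  exact: mIm|exact: le_lt_trans fin].
Qed.

Lemma operator_defined : H_defined alpha gam f g.
Proof.
have mTr : measurable_fun [set: R] (fun x => T x `^ r)%E.
  exact: (measurableT_comp (measurable_poweR _)).
have iT : mu.-integrable [set: R] (fun x => T x `^ r)%E.
  apply/integrableP; split => //.
  under eq_integral do rewrite gee0_abs ?poweR_ge0//.
  by apply: le_lt_trans T_norm _; exact: ltry.
have := integrable_ae measurableT iT; apply: filterS => x /(_ I) Txr.
apply: integrand_integrable; rewrite ge0_fin_numE//.
apply: (@lty_poweRy _ _ r); rewrite ?gt_eqF//.
by rewrite -ge0_fin_numE// poweR_ge0.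
Qed.

Let operator_pointwise x :
  ((normc (H_op alpha gam f g x))%:E <= (2 * (A * B))%:E * T x)%E.
Proof.
have AB0 : 0 < A * B by rewrite mulr_gt0.
have [Tx|Tx] := boolP (T x \is a fin_num); last first.
  have -> : T x = +oo%E by apply/eqP; move: Tx; rewrite ge0_fin_numE// -leNgt leye_eq.
  by rewrite gt0_muley ?lte_fin ?mulr_gt0// leey.
have [iRe iIm] := integrand_integrable Tx.
have part (h : R -> R) : mu.-integrable D (fun t => (h t)%:E) ->
    (\int[mu]_(t in D) `|(h t)%:E| <= (A * B)%:E * T x)%E ->
    `|Rintegral mu D h| <= A * B * fine (T x).
  move=> ih hle; have := @le_normr_Rintegral _ _ _ mu D h mD ih; move=> /le_trans; apply.
  rewrite -lee_fin.
  have -> : (A * B * fine (T x))%:E = ((A * B)%:E * T x)%E by rewrite EFinM fineK.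
  have fin : (\int[mu]_(t in D) `|(h t)%:E|)%E \is a fin_num.
    rewrite ge0_fin_numE ?integral_ge0//; apply: (le_lt_trans hle).
    by rewrite ltey_eq fin_numM.
  by rewrite /Rintegral fineK.
apply: (@le_trans _ _ (2 * (A * B) * fine (T x))%:E); last by rewrite EFinM fineK.
rewrite lee_fin; apply: le_trans (normc_le _) _.
have h1 := part _ iRe (int_Re x); have h2 := part _ iIm (int_Im x).
by rewrite -mulrA mulr_natl mulr2n lerD.
Qed.

(** The factor 2 comes from bounding the real and the imaginary part of the integral
    separately. *)
Lemma operator_norm : (cLnorm r (H_op alpha gam f g) <= (2 * K * A * B)%:E)%E.
Proof.
have AB0 : 0 < 2 * (A * B) by rewrite !mulr_gt0.
have AB0' : (0 <= (2 * (A * B))%:E)%E by rewrite lee_fin ltW.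
have H1 : (cLnorm r (H_op alpha gam f g) `^ r <= ((2 * (A * B)) `^ r * K `^ r)%:E)%E.
  rewrite /cLnorm poweR_Lnorm ?gt_eqF//.
  apply: (@le_trans _ _ (\int[mu]_x (((2 * (A * B)) `^ r)%:E * T x `^ r))%E).
    apply: ge0_le_integral_pointwise => x; first exact: poweR_ge0.
    rewrite -poweR_EFin -poweRM// gee0_abs ?lee_fin ?normc_ge0//.
    apply: gt0_ler_poweR; rewrite ?(ltW r0)//.
    - have := normc_ge0 (H_op alpha gam f g x); move: (normc _) => n n0.
      by rewrite in_itv/= leey lee_fin n0.
    - by rewrite in_itv/= leey mule_ge0.
  rewrite ge0_integralZl ?lee_fin ?powR_ge0//; last 2 first.
  - exact: (measurableT_comp (measurable_poweR _)).
  - by move=> x _; exact: poweR_ge0.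
  by rewrite EFinM lee_wpmul2l ?lee_fin ?powR_ge0.
have N0 : (0 <= cLnorm r (H_op alpha gam f g))%E by exact: Lnorm_ge0.
have -> : cLnorm r (H_op alpha gam f g) = ((cLnorm r (H_op alpha gam f g) `^ r) `^ r^-1)%E.
  by rewrite -poweRrM mulfV ?gt_eqF// poweRe1.
have -> : (2 * K * A * B)%:E = (((2 * (A * B)) `^ r * K `^ r)%:E `^ r^-1)%E.
  rewrite poweR_EFin -powRM ?(ltW AB0) ?(ltW K0)// -powRrM mulfV ?gt_eqF// powRr1.
    by congr _%:E; ring.
  by rewrite mulr_ge0 ?(ltW AB0) ?(ltW K0).
apply: gt0_ler_poweR => //; first by rewrite invr_ge0 ltW.
  by rewrite in_itv/= leey poweR_ge0.
by rewrite in_itv/= leey lee_fin mulr_ge0 ?powR_ge0.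
Qed.

End FixFG.

(** A and B are taken above the two norms, which covers functions of norm zero; then they
    tend to the norms. *)
Lemma operator_bound (f g : R -> R[i]) : in_Lp p f -> in_Lp q g ->
  H_defined alpha gam f g /\
  (cLnorm r (H_op alpha gam f g) <= (2 * K)%:E * cLnorm p f * cLnorm q g)%E.
Proof.
move=> [mf ffin] [mg gfin].
have f0 : (0 <= cLnorm p f)%E by exact: Lnorm_ge0.
have g0 : (0 <= cLnorm q g)%E by exact: Lnorm_ge0.
have fF : cLnorm p f \is a fin_num by rewrite ge0_fin_numE.
have gF : cLnorm q g \is a fin_num by rewrite ge0_fin_numE.
rewrite -(fineK fF) -(fineK gF).
set a := fine (cLnorm p f); set b := fine (cLnorm q g).
have a0 : 0 <= a by exact: fine_ge0.
have b0 : 0 <= b by exact: fine_ge0.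
have fa e : 0 <= e -> (cLnorm p f <= (a + e)%:E)%E.
  by move=> e0; rewrite -(fineK fF) lee_fin lerDl.
have gb e : 0 <= e -> (cLnorm q g <= (b + e)%:E)%E.
  by move=> e0; rewrite -(fineK gF) lee_fin lerDl.
have ae e : 0 < e -> 0 < a + e by move=> e0; rewrite ltr_wpDl.
have be e : 0 < e -> 0 < b + e by move=> e0; rewrite ltr_wpDl.
split; first exact: (operator_defined (ae _ ltr01) (be _ ltr01) mf mg (fa _ ler01) (gb _ ler01)).
apply/lee_addgt0Pr => e e0.
pose M := 2 * K * (a + b + 1).
have M0 : 0 < M by rewrite !mulr_gt0// ltr_wpDl// addr_ge0.
pose d := Num.min 1 (e / M).
have d0 : 0 < d by rewrite lt_min ltr01 divr_gt0.
have d1 : d <= 1 by rewrite ge_min lexx.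
have dM : d * M <= e by rewrite -ler_pdivlMr// ge_min lexx orbT.
apply: le_trans (operator_norm (ae _ d0) (be _ d0) mf mg (fa _ (ltW d0)) (gb _ (ltW d0))) _.
rewrite -!EFinM -EFinD lee_fin.
apply: (@le_trans _ _ (2 * K * a * b + d * M)); last by rewrite lerD2l.
rewrite /M; have : 0 <= 2 * K * (d * (1 - d)).
  by rewrite !mulr_ge0 ?subr_ge0 ?(ltW K0) ?(ltW d0).
by lra.
Qed.

End Assembly.

Unset Implicit Arguments.
Set Strict Implicit.
Set Printing Implicit Defensive.

Theorem theorem1p1 (R : realType) (alpha : R) (gamma : R -> R)
    (alpha_gt0 : 0 < alpha) (alpha_lt1 : alpha < 1)
    (gamma_C2 : C2_pos gamma)
    (gamma_mono : monotonic_pos gamma)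
    (gamma_lim0 : gamma t @[t --> 0^'+] --> (0 : R))
    (dgamma_lim0 : derive1n 1 gamma t @[t --> 0^'+] --> (0 : R))
    (omega_le : omega0_2 gamma <= omegaoo_1 gamma)
    (omega_gt1 : 1 < omega0_1 gamma)
    (gamma_bounds : exists C11 C12 C21 : R,
      [/\ 0 < C11, 0 < C12, 0 < C21
        & forall t : R, 0 < t ->
          [/\ `|t ^+ 1 * derive1n 1 gamma t / gamma t| <= C21,
              C11 <= `|t ^+ 1 * derive1n 1 gamma t / gamma t|
            & C12 <= `|t ^+ 2 * derive1n 2 gamma t / gamma t|]])
    (alpha_lower :
      (omegaoo_2 gamma - omegaoo_1 gamma) / (omegaoo_2 gamma - 1)
        < alpha / (1 - alpha))
    (alpha_upper :
      alpha / (1 - alpha)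
        < omegaoo_2 gamma / (omegaoo_2 gamma - omegaoo_1 gamma + 1))
    (p q r : R) (p_gt0 : 0 < p) (q_gt0 : 0 < q) (r_gt0 : 0 < r)
    (pqr_hull : interior (convex_hull (exponent_points alpha gamma))
                  (p^-1, q^-1, r^-1)) :
  exists2 C : R, 0 < C &
    forall f g : R -> R[i], in_Lp p f -> in_Lp q g ->
      H_defined alpha gamma f g /\
      (cLnorm r (H_op alpha gamma f g)
        <= C%:E * cLnorm p f * cLnorm q g)%E.
Proof.
have [c1 [c3 [c2 [c1_gt0 c3_gt0 c2_gt0 bounds]]]] := gamma_bounds.
set g1 := derive1n 1 gamma; set g2 := derive1n 2 gamma.
have gam_neq0 (t : R) : 0 < t -> gamma t != 0.
  move=> t0; apply/eqP => gt; have [_ + _] := bounds t t0.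
  by rewrite gt invr0 mulr0 normr0 leNgt c1_gt0.
have g1_lo (t : R) : 0 < t -> c1 <= `|t * g1 t / gamma t| by case/bounds.
have g1_up (t : R) : 0 < t -> `|t * g1 t / gamma t| <= c2 by case/bounds.
have g2_lo (t : R) : 0 < t -> c3 <= `|t ^+ 2 * g2 t / gamma t| by case/bounds.
have dgam (t : R) : 0 < t -> is_derive t 1 gamma (g1 t).
  by move=> t0; have [d _ _] := gamma_C2 t t0; rewrite /g1 derive1n1 derive1E; apply: DeriveDef.
have dg1 (t : R) : 0 < t -> is_derive t 1 g1 (g2 t).
  by move=> t0; have [_ d _] := gamma_C2 t t0; rewrite /g2 derive1nS derive1E; apply: DeriveDef.
have w0_gt1 : 1 < omega0_2 gamma.
  by apply: lt_le_trans omega_gt1 _; apply: omega0_le dgam gam_neq0 g1_up.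
have w12 : omegaoo_1 gamma <= omegaoo_2 gamma.
  by apply: omegaoo_le dgam gam_neq0 g1_up.
have [[a1 b1 e3 e4] [e5 e6 e7]] := exponents_interior alpha_gt0 alpha_lt1 w0_gt1
  omega_le w12 alpha_lower alpha_upper pqr_hull.
set a := p^-1 in a1 e3 e4 e5 e6 e7 *; set b := q^-1 in b1 e3 e4 e5 e6 e7 *.
set c := r^-1 in e3 e4 e5 e6 e7 *.
have a0 : 0 < a by rewrite invr_gt0.
have b0 : 0 < b by rewrite invr_gt0.
have c0 : 0 < c by rewrite invr_gt0.
have w1_gt1 : 1 < omegaoo_1 gamma by exact: lt_le_trans omega_le.
have sg0 : 0 < a + b - c.
  rewrite -(pmulr_rgt0 _ (lt_trans ltr01 w1_gt1)).
  by move: alpha_gt0 e5; lra.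
have sg1 : a + b - c < 1 by move: alpha_lt1 e7; lra.
have cab : c < a + b by move: sg0; lra.
(* the strict inequalities survive a small change of the indices *)
have [om1 [om1_gt1 om1_lt h4 h5]] : exists om1 : R, [/\ 1 < om1, om1 < omegaoo_1 gamma,
    alpha - a + c - om1 * b < 0 & alpha < om1 * (a + b - c)].
  have [v [v1 va vb vc]] : exists v, [/\ v < omegaoo_1 gamma, 1 <= v,
      (alpha - a + c) / b <= v & alpha / (a + b - c) <= v].
    exists (Num.max 1 (Num.max ((alpha - a + c) / b) (alpha / (a + b - c)))).
    rewrite !gt_max w1_gt1 !ltr_pdivrMr// !le_max !lexx ?orbT; split => //.
    by apply/andP; split; move: e4 e5; lra.
  have [m1 m2] := midf_lt v1.
  exists ((v + omegaoo_1 gamma) / 2); split => //; first exact: le_lt_trans m1.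
    have := le_lt_trans vb m1; rewrite ltr_pdivrMr//; lra.
  by rewrite -ltr_pdivrMr//; exact: le_lt_trans m1.
have [om0 om0_gt h0] : exists2 om0 : R, omega0_2 gamma < om0 & 0 < alpha - a + om0 * (c - b).
  have [e e_gt0 he] := @perturbation R _ (c - b) e6.
  exists (omega0_2 gamma + e); first by rewrite ltrDl.
  have := he e e_gt0 (lexx _).
  have : - (e * (c - b)) <= e * `|c - b|.
    by rewrite -mulrN ler_pM2l// -normrN ler_norm.
  by lra.
have [T T_gt0 far] := growth_at_infinity dgam gam_neq0 g1_up om1_lt.
have flat : \forall t \near 0^'+, `|g1 t| <= 2^-1.
  have half0 : 0 < 2^-1 :> R by rewrite invr_gt0.
  have /cvgrPdist_le/(_ _ half0) := dgamma_lim0.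
  by apply: filterS => t; rewrite sub0r normrN.
have near0 := filterI (growth_at_zero dgam gam_neq0 g1_up om0_gt) flat.
have [tau tau_gt0 small] : exists2 tau : R, 0 < tau & forall t, 0 < t -> t <= tau ->
    t `^ om0 <= `|gamma t| /\ `|g1 t| <= 2^-1.
  have [e /= e0 he] := near0.
  exists (e / 2); first by rewrite divr_gt0.
  move=> t t0 te; apply: he => //=.
  by rewrite sub0r normrN gtr0_norm//; move: e0 te; lra.
(* gamma is only controlled on (0, oo): cut it off to get a Borel function on R *)
pose gt : R -> R := gamma \_ `]0, +oo[%classic.
have gtE (t : R) : 0 < t -> gt t = gamma t.
  by move=> t0; rewrite /gt patchE ifT// inE/= in_itv/= t0.
have mgt : measurable_fun [set: R] gt.
  apply/(measurable_restrictT _ (measurable_itv _)).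
  apply: open_continuous_measurable_fun; first exact: interval_open.
  move=> t; rewrite inE/= in_itv/= andbT => t0.
  have [d _ _] := gamma_C2 t t0.
  exact/differentiable_continuous/derivable1_diffP.
have [K K0 HK] := region_all a0 a1 b0 b1 c0 alpha_lt1 cab sg1 mgt gtE dgam dg1
  gam_neq0 c1_gt0 c2_gt0 c3_gt0 g1_lo g1_up g2_lo tau_gt0 T_gt0
  (fun t h1 h2 => (small t h1 h2).1) (fun t h1 h2 => (small t h1 h2).2)
  om1_gt1 far h0 e7 ltac:(move: e3; lra) h4 h5.
exists (2 * K); first by rewrite mulr_gt0.
by move=> f g hf hg; exact: (operator_bound mgt gtE p_gt0 q_gt0 r_gt0 K0 HK hf hg).
Qed.
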